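(* Let $(N,g)$ be a connected and globally hyperbolic Lorentzian manifold of dimension $d+1$ with a $C^0$-regular metric $g$, and let $\psi_k : U_k \to D_k$, $k=1,\dots,K$, be a finite collection of regular flow charts for $N$ with $\bigcup_{1\le k\le K} U_k = N$. Then the spacelike diameter of $N$ is finite: $\mathrm{diam}_s(N) < \infty$.
   Context: All manifolds are smooth, Hausdorff, second countable, of dimension $d+1\ge 2$. Timelike curve: in a Lorentzian manifold with continuous metric (signature $(-,+,\dots,+)$), a piecewise smooth curve $\gamma: I\to M$ ($I\subseteq\mathbb{R}$ an interval) is timelike if its tangent vectors are timelike ($g(\dot\gamma,\dot\gamma)<0$) wherever it is differentiable, and at break points the left and right derivatives are both timelike and lie in the same component of the timelike double cone. Inextendible: a future directed timelike curve on an interval with endpoints $a<b$ (possibly infinite) is future (past) extendible if it can be extended continuously to $b$ (to $a$), i.e. has a limit in the manifold there; it is inextendible if it is neither future nor past extendible. Cauchy hypersurface: a smooth embedded hypersurface $\Sigma$ of a time-oriented Lorentzian manifold which is met exactly once by every inextendible timelike curve. A time-oriented Lorentzian manifold is globally hyperbolic if it admits a Cauchy hypersurface. Spacelike diameter: for connected globally hyperbolic $(N,g)$, $$\mathrm{diam}_s(N) := \sup_{\Sigma}\ \mathrm{diam}\,\Sigma = \sup_{\Sigma}\ \sup_{p,q\in\Sigma}\ \inf_{\gamma} L(\gamma),$$ where $\Sigma$ ranges over all Cauchy hypersurfaces of $N$, $\gamma:[0,1]\to\Sigma$ over piecewise smooth curves in $\Sigma$ from $p$ to $q$, and $L(\gamma)=\int_0^1\sqrt{g(\dot\gamma(s),\dot\gamma(s))}\,ds$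 (well defined because tangent spaces of Cauchy hypersurfaces contain no timelike vectors). Regular flow chart: a chart $\psi : U\to D$ for $N$, $U\subseteq N$, $D\subseteq\mathbb{R}^{d+1}$ (coordinates $(x_0,\underline{x})$), such that 1. there are constants $C,c$ with $|g_{\mu\nu}|\le C<\infty$ and $g_{00}\le c<0$ for the metric components in this chart, uniformly on $D$; 2. $D=\bigcup_{\underline{x}\in B} I_{\underline{x}}\times\{\underline{x}\}\subseteq\mathbb{R}\times B$, where $B\subseteq\mathbb{R}^d$ and each $I_{\underline{x}}\subseteq\mathbb{R}$ is an open and connected interval; moreover the coordinate diameter $\mathrm{diam}_e(B)$ is finite, where $\mathrm{diam}_e(B)$ is the diameter of $B$ with respect to the Euclidean Riemannian metric $e$ on $B$, i.e. the supremum over $\underline{x},\underline{y}\in B$ of the infimum of Euclidean lengths of piecewise smooth curves in $B$ from $\underline{x}$ to $\underline{y}$; 3. the timelike curves $I_{\underline{x}}\ni s\mapsto\psi^{-1}(s,\underline{x})$ are inextendible in $N$. *)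

(* Defs.v *)
From HB Require Import structures.
From mathcomp Require Import all_boot all_order all_algebra.
From mathcomp Require Import all_classical all_reals all_analysis.

Set Implicit Arguments.
Unset Strict Implicit.
Unset Printing Implicit Defensive.

Import Order.TTheory GRing.Theory Num.Theory.
Import numFieldNormedType.Exports.

Local Open Scope classical_set_scope.
Local Open Scope ring_scope.

Section Smoothness.
Variable R : realType.

(* For an open set A of a finite-dimensional space this is C^k regularity:
   all directional derivatives of order at most k exist and are continuous. *)
Fixpoint Ck (V W : normedModType R) (k : nat) (A : set V) (f : V -> W) : Prop :=
  (forall x, A x -> {for x, continuous f}) /\
  if k is k'.+1 then
    forall v : V, (forall x, A x -> derivable f x v) /\ Ck k' A ('D_v f)
  else True.

(* On an arbitrary set A, smoothness means having local smooth extensions; for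
   A open this is the usual notion, and for A a compact interval it means that
   all one-sided derivatives exist at the endpoints. *)
Definition smooth_on (V W : normedModType R) (A : set V) (f : V -> W) : Prop :=
  forall x, A x -> exists (O : set V) (F : V -> W),
    [/\ open_nbhs x O, forall k, Ck k O F &
        forall y, A y -> O y -> f y = F y].

(* The break points may accumulate only outside of I. *)
Definition piecewise (P : set R -> Prop) (I : set R) : Prop :=
  exists S : set R,
    (forall a b, I a -> I b -> finite_set (S `&` `[a, b]%classic)) /\
    (forall a b, I a -> I b -> a < b ->
       (forall c, S c -> ~ (a < c < b)) -> P `[a, b]%classic).

(* Supremum over p, q in A of the infimum of the lengths of the curves
   [0, 1] -> A from p to q; the infimum is +oo if there is no such curve, and
   the supremum is -oo if A is empty. *)
Definition intrinsic_diam (T : Type) (adm : (R -> T) -> Prop)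
    (len : (R -> T) -> \bar R) (A : set T) : \bar R :=
  ereal_sup [set ereal_inf [set len gam | gam in
                 [set gam : R -> T | [/\ adm gam,
                     forall s, 0 <= s <= 1 -> A (gam s),
                     gam 0 = pq.1 & gam 1 = pq.2]]]
            | pq in A `*` A].

Definition euclid_norm (d : nat) (v : 'rV[R]_d) : R :=
  Num.sqrt (\sum_i v ord0 i ^+ 2).

Definition euclid_length (d : nat) (gam : R -> 'rV[R]_d) : \bar R :=
  (\int[lebesgue_measure]_(s in `[0%R, 1%R]%classic)
     (euclid_norm (derive1 gam s))%:E)%E.

Definition euclid_diam (d : nat) (B : set 'rV[R]_d) : \bar R :=
  intrinsic_diam
    (fun gam => piecewise (fun J => smooth_on J gam)
       `[0, 1]%classic)
    (@euclid_length d) B.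

End Smoothness.

Section Manifold.
Variables (R : realType) (N : topologicalType) (n : nat).

(* cmap and cinv are meaningful only on cdom and on its image. *)
Record chart := Chart {
  cdom : set N;
  cmap : N -> 'rV[R]_n;
  cinv : 'rV[R]_n -> N }.

Definition ccod (phi : chart) : set 'rV[R]_n := cmap phi @` cdom phi.

Definition is_chart (phi : chart) : Prop :=
  [/\ open (cdom phi), open (ccod phi),
      forall p, cdom phi p -> cinv phi (cmap phi p) = p,
      {within cdom phi, continuous (cmap phi)} &
      {within ccod phi, continuous (cinv phi)}].

Definition transition (phi psi : chart) : 'rV[R]_n -> 'rV[R]_n :=
  cmap psi \o cinv phi.

Definition compatible (phi psi : chart) : Prop :=
  smooth_on (cmap phi @` (cdom phi `&` cdom psi)) (transition phi psi) /\
  smooth_on (cmap psi @` (cdom psi `&` cdom phi)) (transition psi phi).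

Record smooth_manifold := SmoothManifold {
  atlas : set chart;
  chart_at : N -> chart;
  manifold_hausdorff : hausdorff_space N;
  manifold_second_countable : @second_countable N;
  atlas_chart : forall phi, atlas phi -> is_chart phi;
  chart_at_atlas : forall p, atlas (chart_at p);
  chart_at_dom : forall p, cdom (chart_at p) p;
  atlas_compatible : forall phi psi, atlas phi -> atlas psi ->
    compatible phi psi;
  atlas_maximal : forall phi, is_chart phi ->
    (forall psi, atlas psi -> compatible phi psi) -> atlas phi }.

(* The effect on components at p of changing coordinates from phi to psi. *)
Definition change_comp (phi psi : chart) (p : N) (u : 'rV[R]_n) : 'rV[R]_n :=
  'D_u (transition phi psi) (cmap phi p).

Definition qform (G : 'M[R]_n) (u v : 'rV[R]_n) : R :=
  (u *m G *m v^T) ord0 ord0.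

Definition lorentz_signature (G : 'M[R]_n) : Prop :=
  exists2 P : 'M[R]_n, P \in unitmx &
    P *m G *m P^T = diag_mx (\row_i (if i == 0%N :> nat then -1 else 1)).

Variable M : smooth_manifold.

Definition smooth_curve (J : set R) (gam : R -> N) : Prop :=
  forall t, J t -> exists (phi : chart) (O : set R),
    [/\ atlas M phi, open_nbhs t O,
        forall s, J s -> O s -> cdom phi (gam s) &
        smooth_on (J `&` O) (cmap phi \o gam)].

Definition piecewise_smooth (I : set R) (gam : R -> N) : Prop :=
  piecewise (fun J => smooth_curve J gam) I.

(* metric_comp phi p is the matrix (g_{mu nu}) at p in the chart phi; it is relevant
   only for phi in the atlas and p in its domain. *)
Record lorentz_metric := LorentzMetric {
  metric_comp : chart -> N -> 'M[R]_n;
  metric_sym : forall phi p, atlas M phi -> cdom phi p ->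
    (metric_comp phi p)^T = metric_comp phi p;
  metric_sign : forall phi p, atlas M phi -> cdom phi p ->
    lorentz_signature (metric_comp phi p);
  metric_continuous : forall phi, atlas M phi ->
    {within cdom phi, continuous (metric_comp phi)};
  metric_tensor : forall phi psi p, atlas M phi -> atlas M psi ->
    cdom phi p -> cdom psi p -> forall u v,
    qform (metric_comp phi p) u v =
    qform (metric_comp psi p)
      (change_comp phi psi p u) (change_comp phi psi p v) }.

Variable g : lorentz_metric.

Definition timelike (phi : chart) (p : N) (v : 'rV[R]_n) : Prop :=
  qform (metric_comp g phi p) v v < 0.

(* X phi p is the row of components at p in the chart phi of a continuous
   timelike vector field. *)
Definition time_orientation (X : chart -> N -> 'rV[R]_n) : Prop :=
  [/\ forall phi psi p, atlas M phi -> atlas M psi -> cdom phi p ->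
        cdom psi p -> X psi p = change_comp phi psi p (X phi p),
      forall phi, atlas M phi -> {within cdom phi, continuous (X phi)} &
      forall phi p, atlas M phi -> cdom phi p -> timelike phi p (X phi p)].

Definition has_right_velocity (phi : chart) (gam : R -> N) (t : R)
    (v : 'rV[R]_n) : Prop :=
  (fun h : R => h^-1 *: (cmap phi (gam (t + h)) - cmap phi (gam t)))
    @ 0^'+ --> v.

Definition has_left_velocity (phi : chart) (gam : R -> N) (t : R)
    (v : 'rV[R]_n) : Prop :=
  (fun h : R => h^-1 *: (cmap phi (gam (t + h)) - cmap phi (gam t)))
    @ 0^'- --> v.

(* The one-sided velocities exist by piecewise smoothness.  Where the curve is
   differentiable they agree with its tangent vector, so that the last
   condition has content only at break points. *)
Definition timelike_curve (I : set R) (gam : R -> N) : Prop :=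
  [/\ is_interval I /\ (exists a b, [/\ I a, I b & a < b]),
      piecewise_smooth I gam,
      forall t v, I t -> (exists2 b, I b & t < b) ->
        has_right_velocity (chart_at M (gam t)) gam t v ->
        timelike (chart_at M (gam t)) (gam t) v,
      forall t v, I t -> (exists2 a, I a & a < t) ->
        has_left_velocity (chart_at M (gam t)) gam t v ->
        timelike (chart_at M (gam t)) (gam t) v &
      forall t v w, I t -> (exists2 a, I a & a < t) ->
        (exists2 b, I b & t < b) ->
        has_left_velocity (chart_at M (gam t)) gam t v ->
        has_right_velocity (chart_at M (gam t)) gam t w ->
        connected_component [set u | timelike (chart_at M (gam t)) (gam t) u]
          v w].

(* The filters of the two ends of a nonempty interval I, whether or not the
   endpoints are finite.  If an endpoint belongs to I, a curve on I always
   converges there, to its value. *)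
Definition right_end (I : set R) : set_system R :=
  filter_from I (fun t0 => I `&` [set t | t0 <= t]).

Definition left_end (I : set R) : set_system R :=
  filter_from I (fun t0 => I `&` [set t | t <= t0]).

(* Reversing the time orientation only exchanges the future and past ends, so
   inextendibility does not refer to it. *)
Definition inextendible (I : set R) (gam : R -> N) : Prop :=
  ~ (exists p : N, gam @ right_end I --> p) /\
  ~ (exists p : N, gam @ left_end I --> p).

Definition curve_length (gam : R -> N) : \bar R :=
  (\int[lebesgue_measure]_(s in `[0%R, 1%R]%classic)
     (let phi := chart_at M (gam s) in
      let v := derive1 (cmap phi \o gam) s in
      Num.sqrt (qform (metric_comp g phi (gam s)) v v))%:E)%E.

Definition riem_diam (Sigma : set N) : \bar R :=
  intrinsic_diam (piecewise_smooth `[0, 1]%classic) curve_length Sigma.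

End Manifold.

Section Causality.
Variables (R : realType) (N : topologicalType) (d : nat).
Variables (M : smooth_manifold R N d.+1) (g : lorentz_metric M).

Definition embedded_hypersurface (Sigma : set N) : Prop :=
  forall p, Sigma p -> exists2 phi, atlas M phi /\ cdom phi p &
    forall q, cdom phi q -> (Sigma q <-> cmap phi q ord0 ord0 = 0).

Definition cauchy_hypersurface (Sigma : set N) : Prop :=
  embedded_hypersurface Sigma /\
  forall (I : set R) (gam : R -> N),
    timelike_curve g I gam -> inextendible I gam ->
    exists! t, I t /\ Sigma (gam t).

Definition globally_hyperbolic : Prop :=
  (exists X, time_orientation g X) /\
  (exists Sigma, cauchy_hypersurface Sigma).

Definition spacelike_diam : \bar R :=
  ereal_sup [set riem_diam g Sigma | Sigma in cauchy_hypersurface].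

Definition coords (s : R) (x : 'rV[R]_d) : 'rV[R]_d.+1 :=
  row_mx (s%:M : 'rV[R]_1) x.

Record regular_flow_chart (psi : chart R N d.+1) : Prop := RegularFlowChart {
  flow_chart_atlas : atlas M psi;
  flow_chart_bounds : exists C c : R, c < 0 /\
    forall p, cdom psi p ->
      (forall mu nu, `|metric_comp g psi p mu nu| <= C) /\
      metric_comp g psi p ord0 ord0 <= c;
  flow_chart_lines : exists (B : set 'rV[R]_d) (I : 'rV[R]_d -> set R),
    [/\ forall x, B x -> [/\ I x !=set0, open (I x) & is_interval (I x)],
        ccod psi = [set coords z.1 z.2 | z in [set z | B z.2 /\ I z.2 z.1]],
        (euclid_diam B < +oo)%E &
        forall x, B x -> inextendible (I x) (fun s => cinv psi (coords s x))] }.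

End Causality.

(* Main.v *)
(* Let Sigma be a Cauchy hypersurface.  Every flow line of a chart U_k meets Sigma
   exactly once and transversally, so the part of Sigma in U_k is the graph of a smooth
   function over the base B_k.  A tangent vector a e_0 + w of Sigma satisfies
   0 <= g(a e_0 + w) <= c a^2 + 2 C' |a| |w| + C' |w|^2, and since c < 0 the right
   side is at most kappa^2 |w|^2, with kappa independent of Sigma.  Hence lifting
   to the graph stretches lengths of curves in B_k by at most kappa, and two
   points of Sigma in U_k have distance at most kappa_k diam_e(B_k) in Sigma.  It
   remains to see that these pieces of Sigma are chained together, because a
   chain of distinct charts has at most K links.

   Suppose that the charts split into two classes such that charts of different
   classes have no common point on Sigma.  As N is connected, a point p lies in
   charts of both classes, and its two flow lines lead to both parts A and B of
   Sigma, say downwards.  Let Q be the set of points from which descending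
   timelike curves reach both A and B.  If q in Q lies in a chart of the class
   of A, follow a descending curve from q to B: it has to leave the chart, and as
   long as it is in the chart its points have flow lines ending in A, so it stays
   in Q.  Doing this for a sequence of closed sets, each contained in a chart,
   whose interiors cover N, and leaving each of them infinitely often, one obtains
   a descending curve in Q without a limit in N.  Prolonged upwards along a flow
   line it is an inextendible timelike curve missing Sigma, a contradiction. *)
Require Import Defs.
From mathcomp Require Import all_boot all_order all_algebra.
From mathcomp Require Import all_classical all_reals all_analysis.
From mathcomp Require Import measurable_realfun.
From mathcomp Require Import ring lra.

Set Implicit Arguments.
Unset Strict Implicit.
Unset Printing Implicit Defensive.

Import Order.TTheory GRing.Theory Num.Theory.
Import numFieldNormedType.Exports.

Local Open Scope classical_set_scope.
Local Open Scope ring_scope.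

(** * Calculus of C^k maps *)

Section Calculus.
Variable R : realType.

(** [Ck] speaks only of directional derivatives, so the chain rule and the smoothness of implicit
    functions are obtained from the mean value theorem along lines. The causal arguments reduce to
    achronality: a timelike curve between two points of Sigma, prolonged by flow lines at both ends,
    would be inextendible and meet Sigma twice. The curves needed for this are assembled, even
    infinitely often, from pieces in different charts. They are therefore taken straight in charts,
    and a fixed timelike field [X] decides in which half of the cone a velocity lies; then the cone
    condition at a break point is automatic. If both flow lines at p meet Sigma upwards instead of
    downwards, the argument is applied to -X; if they meet it on opposite sides, achronality fails
    at once. The length of a curve is computed in charts that may vary wildly with the point. The
    speed is therefore estimated in any convenient chart and dominated by an explicit measurable
    function, and only this function is reparametrized and integrated. *)

Lemma Ck_sub (V W : normedModType R) k (A B : set V) (f : V -> W) :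
  A `<=` B -> Ck k B f -> Ck k A f.
Proof.
move=> AB; elim: k f => [|k IH] f /= [cf df]; split=> //; first by move=> x /AB/cf.
  by move=> x /AB/cf.
by move=> v; have [dfv Cf] := df v; split; [move=> x /AB/dfv|exact: IH].
Qed.

Lemma Ck_cont (V W : normedModType R) k (A : set V) (f : V -> W) :
  Ck k A f -> forall x, A x -> {for x, continuous f}.
Proof. by case: k => [|k] []. Qed.

Lemma CkW (V W : normedModType R) k (A : set V) (f : V -> W) :
  Ck k.+1 A f -> Ck k A f.
Proof.
elim: k f => [|k IH] f [cf df]; first by split.
by split=> // v; have [dfv /IH Cf] := df v; split.
Qed.

Lemma Ck_eq (V W : normedModType R) k (A : set V) (f g : V -> W) :
  open A -> (forall x, A x -> f x = g x) -> Ck k A f -> Ck k A g.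
Proof.
move=> oA; elim: k f g => [|k IH] f g fg [cf df].
all: have nfg x : A x -> \near x, f x = g x
  by move=> Ax; near=> y; apply: fg; near: y; exact: open_nbhs_nbhs.
all: have cg x : A x -> {for x, continuous g}.
1,3: move=> Ax; apply: cvg_trans (near_eq_cvg (nfg x Ax)) _.
1,2: by rewrite -(fg x Ax); exact: cf.
- by split.
split=> // v; have [dfv Cf] := df v; split=> [x Ax|].
  exact: near_eq_derivable (nfg x Ax) (dfv x Ax).
by apply: IH Cf => x Ax; apply: near_eq_derive; exact: nfg.
Unshelve. all: by end_near. Qed.

Lemma is_derive_line (V W : normedModType R) (F : V -> W) (z v : V) (t : R) :
  derivable F (z + t *: v) v ->
  is_derive t 1 (fun u => F (z + u *: v)) ('D_v F (z + t *: v)).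
Proof.
have E : (fun h : R => h^-1 *: (F (z + (h *: 1 + t) *: v) - F (z + t *: v))) =
    (fun h => h^-1 *: (F (h *: v + (z + t *: v)) - F (z + t *: v))).
  apply/funext => h; congr (_ *: (F _ - _)).
  by rewrite [h *: 1]mulr1 scalerDl addrCA.
move=> dF; split; first by rewrite /derivable E.
by rewrite /derive E.
Qed.

(** Applying the mean value theorem on [0, 1] to [F (z + (t * s) *: v)] treats positive, negative
    and zero [s] alike. *)
Lemma MVT_line n (F : 'rV[R]_n -> R) (z v : 'rV[R]_n) (s : R) :
  (forall t : R, 0 <= t <= 1 -> derivable F (z + (t * s) *: v) v) ->
  exists2 t : R, 0 <= t <= 1 &
    F (z + s *: v) - F z = s * 'D_v F (z + (t * s) *: v).
Proof.
move=> dF; pose G t := F (z + (t * s) *: v).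
have dG (t : R) : 0 <= t <= 1 -> is_derive t 1 G ('D_v F (z + (t * s) *: v) * s).
  move=> t01.
  have H := is_derive_line (dF t t01).
  have H2 : is_derive t (1:R) (fun u : R => u * s) s.
    apply: (@is_derive_eq _ _ _ (id * cst s : R -> R)).
    by rewrite scaler0 add0r [LHS]mulr1.
  exact: (@is_derive1_comp R (fun u => F (z + u *: v)) ( *%R^~ s) t).
have cG : {within `[0, 1], continuous G}.
  apply: derivable_within_continuous => t; rewrite in_itv /= => /dG dGt.
  by apply: ex_derive.
have dGo (t : R) : t \in `]0, 1[%R -> is_derive t 1 G ('D_v F (z + (t * s) *: v) * s).
  by rewrite in_itv /= => /andP[/ltW t0 /ltW t1]; apply: dG; rewrite t0.
have [t t01] := MVT ltr01 dGo cG.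
rewrite subr0 mulr1 /G mul1r mul0r scale0r addr0 => ->.
exists t; last by rewrite mulrC.
by move: t01; rewrite in_itv /= => /andP[/ltW -> /ltW ->].
Qed.

Lemma cvg_sumr (T I : Type) (F : set_system T) (FF : Filter F) (r : seq I)
    (f : I -> T -> R) (a : I -> R) :
  (forall i, f i @ F --> a i) ->
  (fun x => \sum_(i <- r) f i x) @ F --> \sum_(i <- r) a i.
Proof.
move=> fa; elim: r => [|i r IH].
  by under eq_fun do rewrite big_nil; rewrite big_nil; exact: cvg_cst.
by under eq_fun do rewrite big_cons; rewrite big_cons; apply: cvgD.
Qed.

Lemma rV_norm_le n (x : 'rV[R]_n) (e : R) :
  0 <= e -> (forall i, `|x ord0 i| <= e) -> `|x| <= e.
Proof.
move=> e0 xe; rewrite /Num.Def.normr /= mx_normrE.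
by apply: bigmax_le => // -[i j] _ /=; rewrite (ord1 i).
Qed.

Lemma ler_coord_norm n (x : 'rV[R]_n) i : `|x ord0 i| <= `|x|.
Proof.
rewrite [leRHS]/Num.Def.normr /= mx_normrE.
exact: (le_bigmax _ (fun ij => `|x ij.1 ij.2|) (ord0, i)).
Qed.

(** The coordinates of the increment are switched on one at a time, each switch being a mean value
    step. In the maximum norm no intermediate point is farther from [y] than [|a|]. *)
Lemma telescope_MVT n (F : 'rV[R]_n -> R) (y a : 'rV[R]_n) :
  (forall z v : 'rV[R]_n, `|z - y| <= `|a| -> derivable F z v) ->
  exists2 xi : 'I_n -> 'rV[R]_n, forall i, `|xi i - y| <= `|a| &
    F (y + a) - F y =
      \sum_i a ord0 i * 'D_(delta_mx ord0 i) F (xi i).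
Proof.
move=> dF.
pose z (j : nat) : 'rV[R]_n := y + \row_(i < n) (if (i < j)%N then a ord0 i else 0).
have zy j (i : 'I_n) (t : R) : (0 <= t <= 1) -> (j <= i)%N ->
    `|z j + (t * a ord0 i) *: delta_mx ord0 i - y| <= `|a|.
  move=> /andP[t0 t1] ji; rewrite /z addrAC -[y + _]addrC addrK.
  apply: rV_norm_le => // k; rewrite !mxE eqxx /=.
  have [->|ki] := eqVneq k i.
    rewrite ltnNge ji /= add0r mulr1 normrM (ger0_norm t0).
    by apply: le_trans (ler_coord_norm a i); rewrite ler_piMl.
  rewrite mulr0 addr0; case: ifP => _; first exact: ler_coord_norm.
  by rewrite normr0.
have step (i : 'I_n) : exists2 xi : 'rV[R]_n, `|xi - y| <= `|a| &
    F (z i.+1) - F (z i) = a ord0 i * 'D_(delta_mx ord0 i) F xi.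
  have -> : z i.+1 = z i + a ord0 i *: delta_mx ord0 i.
    rewrite /z -addrA; congr (_ + _); apply/rowP => k; rewrite !mxE eqxx /=.
    have [->|ki] := eqVneq k i; first by rewrite ltnS leqnn ltnn add0r mulr1.
    by rewrite mulr0 addr0 ltnS leq_eqVlt (inj_eq val_inj) (negbTE ki).
  have [t|t t01 ->] := @MVT_line n F (z i) (delta_mx ord0 i) (a ord0 i).
    by move=> t01; apply: dF; exact: zy.
  by eexists; last reflexivity; exact: zy.
have [xi xiP] := choice (fun i => let: ex_intro2 x p q := step i in
  ex_intro (fun x => `|x - y| <= `|a| /\
    F (z i.+1) - F (z i) = a ord0 i * 'D_(delta_mx ord0 i) F x) x (conj p q)).
exists xi => [i|]; first by have [] := xiP i.
rewrite -(eq_bigr _ (fun i _ => (xiP i).2)).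
rewrite -(big_mkord xpredT (fun i => F (z i.+1) - F (z i))) telescope_sumr //.
congr (F _ - F _); rewrite /z; first congr (_ + _).
  by apply/rowP => i; rewrite mxE ltn_ord.
rewrite -[LHS]addr0; congr (_ + _).
by apply/rowP => i; rewrite !mxE.
Qed.

(** [Ck] supplies no total derivative. The increment of [F] is telescoped instead; its difference
    quotient converges because the mean value points tend to [c t] and the partial derivatives of
    [F] are continuous there. *)
Lemma chain_rule n (F : 'rV[R]_n -> R) (c : R -> 'rV[R]_n) (t : R)
    (c' : 'rV[R]_n) (O : set 'rV[R]_n) :
  open O -> O (c t) -> Ck 1 O F -> is_derive t 1 c c' ->
  is_derive t 1 (F \o c)
    (\sum_i c' ord0 i * 'D_(delta_mx ord0 i) F (c t)).
Proof.
move=> oO Oct [_ dF] [dc c'E].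
pose a h := c (h *: 1 + t) - c t.
have ca : (fun h => h^-1 *: a h) @ 0^' --> c' by rewrite -c'E; exact: dc.
have a0 : a @ 0^' --> (0 : 'rV[R]_n).
  have ct : {for t, continuous c}.
    by apply: differentiable_continuous; apply/derivable1_diffP.
  have ht : (fun h : R => h *: 1 + t) @ 0^' --> t.
    have : (fun h : R => h + t) @ (0 : R) --> 0 + t.
      by apply: cvgD; [exact: cvg_id|exact: cvg_cst].
    rewrite add0r => ht; apply: cvg_within_filter.
    by under eq_fun do rewrite [_ *: 1]mulr1.
  rewrite -(subrr (c t)); apply: cvgB; last exact: cvg_cst.
  exact: cvg_comp ht ct.
have [r r0 rO] : exists2 r : R, 0 < r & forall z, `|z - c t| < r -> O z.
  have /nbhs_ballP[r /= r0 rO] : nbhs (c t) O by exact: open_nbhs_nbhs.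
  by exists r => // z zr; apply: rO; rewrite -ball_normE /= distrC.
(* Where the increment leaves the ball on which [F] is known, the points are set to [c t]; only
   small [h] count. *)
have step h : exists xi : 'I_n -> 'rV[R]_n, (forall i, `|xi i - c t| <= `|a h|) /\
    (`|a h| < r -> F (c (h *: 1 + t)) - F (c t) =
       \sum_i a h ord0 i * 'D_(delta_mx ord0 i) F (xi i)).
  have [ar|ra] := ltP `|a h| r; last first.
    by exists (fun=> c t); split=> // i; rewrite subrr normr0.
  have [z v zv|xi xi1 xi2] := @telescope_MVT n F (c t) (a h).
    by have [+ _] := dF v; apply; apply: rO; exact: le_lt_trans ar.
  by exists xi; split=> // _; rewrite -xi2 /a [c t + _]addrC subrK.
have [xi xiP] := choice step.
have xic i : (fun h => xi h i) @ 0^' --> c t.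
  apply/cvgrPdist_lt => e e0; near=> h.
  rewrite distrC; apply: le_lt_trans ((xiP h).1 i) _.
  near: h; move/cvgrPdist_lt : a0 => /(_ _ e0); apply: filterS => h.
  by rewrite sub0r normrN.
suff C : (fun h => h^-1 *: ((F \o c) (h *: 1 + t) - (F \o c) t)) @ 0^' -->
    \sum_i c' ord0 i * 'D_(delta_mx ord0 i) F (c t).
  by split; [apply/cvg_ex; eexists; exact: C|exact: cvg_lim C].
have /near_eq_cvg/cvg_trans : \forall h \near 0^',
    \sum_i (h^-1 *: a h) ord0 i * 'D_(delta_mx ord0 i) F (xi h i) =
    h^-1 *: ((F \o c) (h *: 1 + t) - (F \o c) t).
  near=> h; rewrite /= (xiP h).2; last first.
    near: h; move/cvgrPdist_lt : a0 => /(_ _ r0); apply: filterS => h.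
    by rewrite sub0r normrN.
  rewrite scaler_sumr; apply: eq_bigr => i _.
  by rewrite mxE -mulrA.
apply; apply: cvg_sumr => i; apply: cvgM.
  exact: (cvg_comp _ _ ca (@coord_continuous _ _ _ ord0 i c')).
have [_ [cdF _]] := dF (delta_mx ord0 i).
exact: (cvg_comp _ _ (xic i) (cdF _ Oct)).
Unshelve. all: by end_near. Qed.

(** A directional derivative is a derivative along a line, so this is the chain rule for the curve
    [h (t *: v + x)] at parameter 0. *)
Lemma derive_comp (V : normedModType R) n (F : 'rV[R]_n -> R)
    (h : V -> 'rV[R]_n) (O : set 'rV[R]_n) (x v : V) :
  open O -> O (h x) -> Ck 1 O F -> derivable h x v ->
  is_derive x v (F \o h)
    (\sum_i 'D_v h x ord0 i * 'D_(delta_mx ord0 i) F (h x)).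
Proof.
move=> oO Ohx CF dh; pose c (t : R) := h (t *: v + x).
have E (W : normedModType R) (f : V -> W) :
    (fun t : R => t^-1 *: (f ((t *: (1 : R) + 0 : R) *: v + x) - f ((0 : R) *: v + x))) =
    (fun t => t^-1 *: (f (t *: v + x) - f x)).
  by apply/funext => t; rewrite [t *: 1]mulr1 addr0 scale0r add0r.
have dc : is_derive (0:R) (1:R) c ('D_v h x).
  by split; rewrite /derivable /derive E.
have c0 : c 0 = h x by rewrite /c scale0r add0r.
have := @chain_rule n F c 0 _ O oO _ CF dc; rewrite c0 => /(_ Ohx) [].
by rewrite /derivable /derive (E R (F \o h)) => ? ?; split.
Qed.

Section CkAlgebra.
Variables (V : normedModType R) (A : set V).
Hypothesis oA : open A.

Lemma Ck_cst (W : normedModType R) k (a : W) : Ck k A (cst a).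
Proof.
elim: k a => [|k IH] a; split=> //; try by move=> x _; exact: cst_continuous.
move=> v; split=> [x _|]; first exact: derivable_cst.
by apply: Ck_eq (IH 0) => // x _; rewrite derive_cst.
Qed.

Lemma CkD (W : normedModType R) k (f g : V -> W) :
  Ck k A f -> Ck k A g -> Ck k A (fun x => f x + g x).
Proof.
elim: k f g => [|k IH] f g [cf df] [cg dg]; split=> //;
  try by move=> x Ax; apply: cvgD; [exact: cf|exact: cg].
move=> v; have [dfv Cf] := df v; have [dgv Cg] := dg v; split=> [x Ax|].
  by apply: derivableD; [exact: dfv|exact: dgv].
apply: Ck_eq (IH _ _ Cf Cg) => // x Ax.
by apply/esym/(@deriveD _ _ _ f g); [exact: dfv|exact: dgv].
Qed.

Lemma Ck_sum (W : normedModType R) k (I : Type) (r : seq I) (f : I -> V -> W) :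
  (forall i, Ck k A (f i)) -> Ck k A (fun x => \sum_(i <- r) f i x).
Proof.
move=> Cf; elim: r => [|i r IH].
  by apply: Ck_eq (Ck_cst k 0) => // x _; rewrite big_nil.
by apply: Ck_eq (CkD (Cf i) IH) => // x _; rewrite big_cons.
Qed.

Lemma CkM k (f g : V -> R) :
  Ck k A f -> Ck k A g -> Ck k A (fun x => f x * g x).
Proof.
elim: k f g => [|k IH] f g Cf0 Cg0;
  have [cf df] := Cf0; have [cg dg] := Cg0; split=> //;
  try by move=> x Ax; apply: cvgM; [exact: cf|exact: cg].
move=> v; have [dfv Cf] := df v; have [dgv Cg] := dg v; split=> [x Ax|].
  by apply: derivableM; [exact: dfv|exact: dgv].
apply: Ck_eq (CkD (IH _ _ (CkW Cf0) Cg) (IH _ _ (CkW Cg0) Cf)) => // x Ax.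
have := @deriveM _ _ f g x v (dfv x Ax) (dgv x Ax).
by rewrite /GRing.mul /= => ->.
Qed.

Lemma CkV k (f : V -> R) :
  (forall x, A x -> f x != 0) -> Ck k A f -> Ck k A (fun x => (f x)^-1).
Proof.
move=> f0; elim: k => [|k IH] Cf0; have [cf df] := Cf0; split=> //;
  try by move=> x Ax; apply: cvgV; [exact: f0|exact: cf].
move=> v; have [dfv Cf] := df v; split=> [x Ax|].
  by apply: derivableV; [exact: f0|exact: dfv].
have Ci := IH (CkW Cf0).
apply: Ck_eq (CkM (CkM (Ck_cst k (-1 : R)) (CkM Ci Ci)) Cf) => // x Ax.
have := @deriveV _ _ f x v (f0 x Ax) (dfv x Ax).
by rewrite /= mulN1r -expr2 exprVn => ->.
Qed.

Lemma Ck_coord k n (f : V -> 'rV[R]_n) i :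
  Ck k A f -> Ck k A (fun x => f x ord0 i).
Proof.
elim: k f => [|k IH] f [cf df]; split=> //;
  try by move=> x Ax; exact: (cvg_comp _ _ (cf x Ax) (@coord_continuous _ _ _ ord0 i _)).
move=> v; have [dfv Cf] := df v; split=> [x Ax|].
  by have /derivable_mxP := dfv x Ax; exact.
by apply: Ck_eq (IH _ Cf) => // x Ax; rewrite derive_mx ?mxE //; exact: dfv.
Qed.

(** The induction runs over all [F] at once, because the chain rule replaces [F] by its partial
    derivatives. *)
Lemma Ck_comp k n (O : set 'rV[R]_n) (F : 'rV[R]_n -> R) (h : V -> 'rV[R]_n) :
  open O -> (forall x, A x -> O (h x)) -> Ck k O F -> Ck k A h ->
  Ck k A (F \o h).
Proof.
move=> oO AO; elim: k F h AO => [|k IH] F h AO CF0 Ch0;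
  have [cF dF] := CF0; have [ch dh] := Ch0; split=> //;
  try by move=> x Ax; exact: (cvg_comp _ _ (ch x Ax) (cF _ (AO x Ax))).
have C1F : Ck 1 O F.
  by elim: {IH dF dh cF ch Ch0} k CF0 => // k IHk /CkW.
have D v x : A x -> is_derive x v (F \o h)
    (\sum_i 'D_v h x ord0 i * 'D_(delta_mx ord0 i) F (h x)).
  by move=> Ax; apply: (derive_comp oO (AO x Ax) C1F); have [+ _] := dh v; apply.
move=> v; split=> [x /D Dx|]; first by have [] := Dx v.
have : Ck k A (fun x => \sum_i 'D_v h x ord0 i * 'D_(delta_mx ord0 i) F (h x)).
  apply: Ck_sum => i; apply: CkM; first by apply: Ck_coord; have [_] := dh v.
  apply: (IH ('D_(delta_mx ord0 i) F) h) => //; last exact: CkW.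
  by have [_] := dF (delta_mx ord0 i).
by apply: Ck_eq => // x /(D v) [].
Qed.

Lemma Ck_rV k n (f : V -> 'rV[R]_n) :
  (forall i, Ck k A (fun x => f x ord0 i)) -> Ck k A f.
Proof.
elim: k f => [|k IH] f Cf; split=> //.
1,2: move=> x Ax; apply/cvgrPdist_le => e e0; near=> y;
  apply: rV_norm_le (ltW e0) _ => i; rewrite !mxE; move: i; near: y;
  apply: filter_forall => i;
  have /cvgrPdist_le := Ck_cont (Cf i) Ax; exact.
move=> v; have dfv x : A x -> derivable f x v.
  move=> Ax; apply/derivable_mxP => i j; rewrite (ord1 i).
  by have [_ /(_ v) [+ _]] := Cf j; apply.
split=> //; apply: IH => i; have [_ /(_ v) [_]] := Cf i.
by apply: Ck_eq => // x Ax; rewrite derive_mx ?mxE //; exact: dfv.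
Unshelve. all: by end_near. Qed.

End CkAlgebra.

End Calculus.

(** * Splitting coordinates into time and space *)

Section Coordinates.
Variables (R : realType) (d : nat).
Local Notation coords := (@coords R d).

Lemma coords_ord0 s x : coords s x ord0 ord0 = s.
Proof.
have -> : (ord0 : 'I_d.+1) = lshift d (ord0 : 'I_1) by apply: val_inj.
rewrite /Defs.coords; apply: etrans (@row_mxEl R 1 1 d _ _ _ _) _.
by rewrite mxE eqxx mulr1n.
Qed.

Lemma coords_lift s x j : coords s x ord0 (lift ord0 j) = x ord0 j.
Proof.
have -> : lift (ord0 : 'I_d.+1) j = rshift 1 j by apply: val_inj.
exact: (@row_mxEr R 1 1 d).
Qed.

Definition spatial (y : 'rV[R]_d.+1) : 'rV[R]_d := \row_j y ord0 (lift ord0 j).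

Lemma coords_eq (y z : 'rV[R]_d.+1) :
  y ord0 ord0 = z ord0 ord0 -> spatial y = spatial z -> y = z.
Proof.
move=> yz0 /rowP yz; apply/rowP => i; have [j ->|->] // := unliftP ord0 i.
by have := yz j; rewrite !mxE.
Qed.

Lemma spatial_coords s x : spatial (coords s x) = x.
Proof. by apply/rowP => j; rewrite mxE coords_lift. Qed.

Lemma coords_spatial (y : 'rV[R]_d.+1) : coords (y ord0 ord0) (spatial y) = y.
Proof. by apply: coords_eq; rewrite ?coords_ord0 ?spatial_coords. Qed.

Lemma coordsD s t x y : coords (s + t) (x + y) = coords s x + coords t y.
Proof.
apply: coords_eq; first by rewrite [RHS]mxE !coords_ord0.
rewrite spatial_coords; apply/rowP => j.
by rewrite [RHS]mxE [RHS]mxE !coords_lift mxE.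
Qed.

Lemma coordsZ a s x : coords (a * s) (a *: x) = a *: coords s x.
Proof.
apply: coords_eq; first by rewrite [RHS]mxE !coords_ord0.
rewrite spatial_coords; apply/rowP => j.
by rewrite [RHS]mxE [RHS]mxE !coords_lift mxE.
Qed.

Lemma coords_norm s x (e : R) : `|s| <= e -> `|x| <= e -> `|coords s x| <= e.
Proof.
move=> se xe; have e0 : 0 <= e := le_trans (normr_ge0 _) se.
apply: rV_norm_le => // i; have [j ->|->] := unliftP ord0 i.
  by rewrite coords_lift; exact: le_trans (ler_coord_norm x j) xe.
by rewrite coords_ord0.
Qed.

Lemma cvg_coords (T : Type) (F : set_system T) {FF : Filter F}
    (f : T -> R) (h : T -> 'rV[R]_d) (a : R) (b : 'rV[R]_d) :
  f @ F --> a -> h @ F --> b -> (fun t => coords (f t) (h t)) @ F --> coords a b.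
Proof.
move=> /cvgrPdist_le fa /cvgrPdist_le hb; apply/cvgrPdist_le => e e0.
near=> t; rewrite -[- _]scaleN1r -coordsZ -coordsD mulN1r scaleN1r.
by apply: coords_norm; near: t; [exact: fa|exact: hb].
Unshelve. all: by end_near. Qed.

Lemma Ck_id (V : normedModType R) k (A : set V) : open A -> Ck k A id.
Proof.
move=> oA; case: k => [|k]; split=> //; try by move=> x _; exact: cvg_id.
move=> v; split=> [x _|]; first exact: derivable_id.
apply: (@Ck_eq _ _ _ _ _ _ _ oA _ (Ck_cst oA k v)) => x _.
by rewrite derive_id.
Qed.

Lemma Ck_coords (V : normedModType R) k (A : set V) (f : V -> R) (h : V -> 'rV[R]_d) :
  open A -> Ck k A f -> Ck k A h -> Ck k A (fun x => coords (f x) (h x)).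
Proof.
move=> oA Cf Ch; apply: Ck_rV => // i; have [j ->|->] := unliftP ord0 i.
  by apply: Ck_eq (Ck_coord oA j Ch) => // x _; rewrite coords_lift.
by apply: Ck_eq Cf => // x _; rewrite coords_ord0.
Qed.

(** * Smoothness of a continuous function given implicitly *)

Section ImplicitFunction.
Variables (O : set 'rV[R]_d.+1) (F : 'rV[R]_d.+1 -> R).
Variables (A : set 'rV[R]_d) (f : 'rV[R]_d -> R).
Hypotheses (oO : open O) (oA : open A) (CF : forall k, Ck k O F).
Hypotheses (AO : forall x, A x -> O (coords (f x) x))
  (F0 : forall x, A x -> F (coords (f x) x) = 0)
  (dF0 : forall x, A x -> 'D_(coords 1 0) F (coords (f x) x) != 0)
  (cf : forall x, A x -> {for x, continuous f}).

(** Since [F] vanishes on the graph, the mean value theorem in the time direction writes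
    [- F (f x, x + h v)] as the increment of [f] times a time derivative of [F] near the graph
    point. Dividing by [h], the left side tends to minus the derivative of [F] along [(0, v)].
    Continuity of [f] makes the mean value points converge. *)
Lemma implicit_is_derive x v : A x ->
  is_derive x v f (- ('D_(coords 0 v) F (coords (f x) x) *
    ('D_(coords 1 0) F (coords (f x) x))^-1)).
Proof.
move=> Ax; set p := coords (f x) x.
have [_ /(_ (coords 0 v)) [dF _]] := CF 1.
have [_ /(_ (coords 1 0)) [dFe [cFe _]]] := CF 1.
pose D h := f (h *: v + x) - f x.
have hx : (fun h : R => h *: v + x) @ 0^' --> x.
  have : (fun h : R => h *: v + x) @ (0 : R) --> (0 : R) *: v + x.
    by apply: cvgD; [apply: cvgZr_tmp; exact: cvg_id|exact: cvg_cst].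
  by rewrite scale0r add0r => ?; exact: cvg_within_filter.
have D0 : D @ 0^' --> (0 : R).
  have : D @ 0^' --> f x - f x.
    by apply: cvgB; [exact: (cvg_comp _ _ hx (cf Ax))|exact: cvg_cst].
  by rewrite subrr.
have [r r0 rO] : exists2 r : R, 0 < r & forall z, `|z - p| <= r -> O z.
  have /nbhs_ballP[r /= r0 rO] : nbhs p O by apply: open_nbhs_nbhs; split => //; exact: AO.
  exists (r / 2); first by rewrite divr_gt0.
  move=> z zr; apply: rO; rewrite mx_norm_ball /ball_ /= distrC.
  by apply: le_lt_trans zr _; rewrite ltr_pdivrMr // ltr_pMr // ltr1n.
have step h : exists t : R, 0 <= t <= 1 /\
    (`|D h| <= r -> `|h *: v| <= r ->
     F (coords (f (h *: v + x)) (h *: v + x)) - F (coords (f x) (h *: v + x)) =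
     D h * 'D_(coords 1 0) F (coords (f x) (h *: v + x) + (t * D h) *: coords 1 0)).
  have [/andP[Dr hr]|] := boolP ((`|D h| <= r) && (`|h *: v| <= r)); last first.
    by move=> n; exists 0; split => [|Dr hr]; [rewrite lexx ler01|move: n; rewrite Dr hr].
  have := @MVT_line _ _ F (coords (f x) (h *: v + x)) (coords 1 0) (D h).
  case=> [t /andP[t0 t1]|t t01 tE].
    apply: dFe; apply: rO.
    rewrite -coordsZ -coordsD /p -[- _]scaleN1r -coordsZ -coordsD.
    rewrite mulN1r scaleN1r scaler0 addr0 addrK mulr1 addrC addKr.
    apply: coords_norm hr; apply: le_trans Dr.
    by rewrite normrM (ger0_norm t0) ler_piMl.
  exists t; split=> // _ _; rewrite -tE; congr (F _ - _).
  by rewrite -coordsZ -coordsD /D mulr1 scaler0 addr0 [f x + _]addrC subrK.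
have [t tP] := choice step.
have xic : (fun h => coords (f x) (h *: v + x) + (t h * D h) *: coords 1 0) @ 0^' --> p.
  suff tD : (fun h => t h * D h) @ 0^' --> (0 : R).
    have H := cvgD (cvg_coords (cvg_cst (f x)) hx) (cvgZr_tmp (a := coords 1 0) tD).
    rewrite scale0r addr0 in H; exact: H.
  apply/cvgrPdist_le => e e0; near=> h; rewrite sub0r normrN normrM.
  have [/andP[th0 th1] _] := tP h.
  rewrite (ger0_norm th0); apply: le_trans (_ : `|D h| <= _); first by rewrite ler_piMl.
  near: h; move/cvgrPdist_le : D0 => /(_ _ e0); apply: filterS => h.
  by rewrite sub0r normrN.
pose q h := h^-1 *: (F (h *: coords 0 v + p) - F p).
suff C : (fun h => h^-1 *: (f (h *: v + x) - f x)) @ 0^' -->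
    - ('D_(coords 0 v) F p * ('D_(coords 1 0) F p)^-1).
  by split; [apply/cvg_ex; eexists; exact: C|exact: cvg_lim C].
have /near_eq_cvg/cvg_trans : \forall h \near 0^',
    - (q h * ('D_(coords 1 0) F (coords (f x) (h *: v + x) + (t h * D h) *: coords 1 0))^-1) =
    h^-1 *: (f (h *: v + x) - f x).
  near=> h; have [_ /(_ _ _)] := tP h.
  have -> : F (coords (f (h *: v + x)) (h *: v + x)) = 0.
    apply: F0; near: h; apply: hx; exact: open_nbhs_nbhs.
  rewrite sub0r => E.
  have : D h = - F (coords (f x) (h *: v + x)) * ('D_(coords 1 0) F
      (coords (f x) (h *: v + x) + (t h * D h) *: coords 1 0))^-1.
    rewrite E ?mulfK //.
    - near: h.
      have := cvg_comp _ _ xic (cFe _ (AO Ax)).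
      by move=> /cvgr_neq0; apply; exact: dF0.
    - near: h; move/cvgrPdist_le : D0 => /(_ _ r0); apply: filterS => h.
      by rewrite sub0r normrN.
    - near: h; have := hx; move=> /cvgrPdist_le /(_ _ r0); apply: filterS => h.
      by rewrite opprD addrCA subrr addr0 normrN.
  move=> DhE; rewrite -/(D h) [in RHS]DhE /q (F0 Ax) subr0.
  have -> : h *: coords 0 v + p = coords (f x) (h *: v + x).
    by rewrite /p -coordsZ -coordsD mulr0 add0r.
  by rewrite mulNr scalerN scalerAl.
apply; apply: cvgN; apply: cvgM; first exact: (dF _ (AO Ax)).
apply: cvgV; first exact: dF0.
exact: (cvg_comp _ _ xic (cFe _ (AO Ax))).
Unshelve. all: by end_near. Qed.

(** The formula for the derivative contains [f] itself but no derivative of [f], so each order of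
    smoothness of [f] yields the next. *)
Lemma implicit_Ck k : Ck k A f.
Proof.
elim: k => [|k IH]; split=> // v; split=> [x Ax|].
  by have [] := implicit_is_derive v Ax.
have Cp : Ck k A (fun x => coords (f x) x) by apply: Ck_coords => //; exact: Ck_id.
have Cd w : Ck k A (fun x => 'D_w F (coords (f x) x)).
  apply: (Ck_comp (F := 'D_w F) (h := fun x => coords (f x) x) oA oO) => //.
  by have [_ /(_ w) []] := CF k.+1.
have := CkM oA (Ck_cst oA k (-1 : R)) (CkM oA (Cd (coords 0 v)) (CkV oA dF0 (Cd (coords 1 0)))).
apply: Ck_eq => // x Ax; have [_ ->] := implicit_is_derive v Ax.
by rewrite /= mulN1r.
Qed.

End ImplicitFunction.
End Coordinates.

(** * Charts and Lorentzian linear algebra *)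

Section ChartTheory.
Variables (R : realType) (N : topologicalType) (n : nat).
Variable M : smooth_manifold R N n.
Implicit Types phi psi : chart R N n.

Lemma cdom_cinv phi y : is_chart phi -> ccod phi y -> cdom phi (cinv phi y).
Proof. by move=> [_ _ cK _ _] [p pd <-]; rewrite cK. Qed.

Lemma cinvK phi y : is_chart phi -> ccod phi y -> cmap phi (cinv phi y) = y.
Proof. by move=> [_ _ cK _ _] [p pd <-]; rewrite cK. Qed.

Lemma ccod_cmap phi p : cdom phi p -> ccod phi (cmap phi p).
Proof. by move=> pd; exists p. Qed.

Lemma continuous_cmap phi p : is_chart phi -> cdom phi p ->
  {for p, continuous (cmap phi)}.
Proof.
move=> [od _ _ cm _] pd; have := cm; rewrite continuous_open_subspace //.
by move=> /(_ p); apply; rewrite inE.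
Qed.

Lemma continuous_cinv phi y : is_chart phi -> ccod phi y ->
  {for y, continuous (cinv phi)}.
Proof.
move=> [_ oc _ _ cm] yc; have := cm; rewrite continuous_open_subspace //.
by move=> /(_ y); apply; rewrite inE.
Qed.

Definition overlap phi psi : set 'rV[R]_n :=
  cmap phi @` (cdom phi `&` cdom psi).

Lemma overlapP phi psi y : is_chart phi ->
  overlap phi psi y <-> ccod phi y /\ cdom psi (cinv phi y).
Proof.
move=> [_ _ cK _ _]; split=> [[p [pd pd'] <-]|[[p pd <-]]].
  by rewrite cK //; split=> //; exact: ccod_cmap.
by rewrite cK // => pd'; exists p.
Qed.

Lemma open_overlap phi psi : is_chart phi -> open (cdom psi) ->
  open (overlap phi psi).
Proof.
move=> cphi od; rewrite openE => y /(overlapP _ _ cphi) [yc yd].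
have ny : nbhs y (ccod phi).
  by case: cphi => _ oc _ _ _; exact: open_nbhs_nbhs.
have nd : nbhs y (cinv phi @^-1` cdom psi).
  by apply: (continuous_cinv cphi yc); exact: open_nbhs_nbhs.
by near=> z; apply/(overlapP _ _ cphi); split; near: z.
Unshelve. all: by end_near. Qed.

(** [smooth_on] gives a smooth local extension; since overlaps are open, the transition agrees with
    it near [y] and is itself [Ck]. *)
Lemma transition_smooth phi psi y : atlas M phi -> atlas M psi ->
  overlap phi psi y -> exists O : set ('rV[R]_n),
    [/\ open O, O y, O `<=` overlap phi psi &
        forall k, Ck k O (transition phi psi)].
Proof.
move=> aphi apsi oy.
have [S _] := atlas_compatible aphi apsi.
have [U [F [[oU Uy] CF E]]] := S _ oy.
have cphi := atlas_chart aphi; have [od _ _ _ _] := atlas_chart apsi.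
have oov := open_overlap cphi od.
exists (U `&` overlap phi psi); split; [exact: openI|by []|by move=> z []|].
move=> k; apply: (@Ck_eq _ _ _ k _ F); first exact: openI.
  by move=> z [Uz oz]; rewrite -E.
by apply: Ck_sub (CF k) => z [].
Qed.

(** The curve [c] and the straight line through [c t] with velocity [c'] give the same sum of
    partial derivatives in [chain_rule]; for the line this sum is the directional derivative along
    [c']. *)
Lemma vector_chain_rule m (T : 'rV[R]_n -> 'rV[R]_m) (c : R -> 'rV[R]_n)
    (t : R) (c' : 'rV[R]_n) (O : set 'rV[R]_n) :
  open O -> O (c t) -> Ck 1 O T -> is_derive t 1 c c' ->
  is_derive t 1 (T \o c) ('D_c' T (c t)).
Proof.
move=> oO Oct CT dc.
have dT : derivable T (c t) c' by have [_ /(_ c') [+ _]] := CT; apply.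
have line : is_derive (0 : R) 1 (fun u => c t + u *: c') c'.
  have := @is_derive_line R _ _ id (c t) c' 0 (@derivable_id _ _ _ _).
  by rewrite derive_id.
have E j : is_derive t 1 (fun s => T (c s) ord0 j) ('D_c' T (c t) ord0 j).
  have CTj := Ck_coord oO j CT.
  have := chain_rule oO Oct CTj dc.
  have := @chain_rule _ _ (fun y => T y ord0 j) _ 0 _ _ oO _ CTj line.
  rewrite /= scale0r addr0 => /(_ Oct) [_ <-].
  have dTj : derivable (fun y => T y ord0 j) (c t + 0 *: c') c'.
    by rewrite scale0r addr0; have /derivable_mxP := dT; exact.
  have [_ ->] := is_derive_line dTj.
  by rewrite scale0r addr0 derive_mx // mxE.
have dTc : derivable (T \o c) t 1.
  by apply/derivable_mxP => i j; rewrite (ord1 i); have [] := E j.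
split=> //; rewrite derive_mx //; apply/rowP => j; rewrite mxE.
by have [_ ->] := E j.
Qed.

Lemma derive_transition phi psi (c : R -> 'rV[R]_n) (t : R) (v : 'rV[R]_n) :
  atlas M phi -> atlas M psi -> overlap phi psi (c t) -> is_derive t 1 c v ->
  is_derive t 1 (transition phi psi \o c)
    (change_comp phi psi (cinv phi (c t)) v).
Proof.
move=> aphi apsi oc dc; have cphi := atlas_chart aphi.
have [U [oU Uc _ C]] := transition_smooth aphi apsi oc.
have [yc _] := (overlapP _ _ cphi).1 oc.
rewrite /change_comp cinvK //.
exact: (vector_chain_rule oU Uc (C 1)).
Qed.

End ChartTheory.

(** * The two halves of the timelike cone *)

Section LorentzAlgebra.
Variables (R : realType) (d : nat).
Implicit Types (G : 'M[R]_d.+1) (u v w : 'rV[R]_d.+1).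

Definition minkowski (a b : 'rV[R]_d.+1) : R :=
  - (a ord0 ord0 * b ord0 ord0) +
  \sum_j a ord0 (lift ord0 j) * b ord0 (lift ord0 j).

Lemma qform_minkowski G : lorentz_signature G ->
  exists h : 'rV[R]_d.+1 -> 'rV[R]_d.+1,
    forall u v, qform G u v = minkowski (h u) (h v).
Proof.
case=> P Pu PGP; exists (fun u => u *m invmx P) => u v.
rewrite /qform -{1}(mulmxKV Pu u) -{1}(mulmxKV Pu v).
rewrite trmx_mul !mulmxA -(mulmxA _ P G) -(mulmxA _ (P *m G)) PGP.
rewrite mxE big_ord_recl /minkowski; congr (_ + _).
  by rewrite mul_mx_diag !mxE /= mulrN1 mulNr.
by apply: eq_bigr => j _; rewrite mul_mx_diag !mxE /= mulr1.
Qed.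

(** A strict reverse Cauchy-Schwarz inequality. With [A], [B] the moduli of the time components and
    [Sa], [Sb] the spatial squares, termwise 2xy <= x^2 + y^2 bounds 2AB times the spatial product
    by B^2 Sa + A^2 Sb, which is less than 2 A^2 B^2. *)
Lemma minkowski_lt0 a b : minkowski a a < 0 -> minkowski b b < 0 ->
  `|\sum_j a ord0 (lift ord0 j) * b ord0 (lift ord0 j)| <
  `|a ord0 ord0 * b ord0 ord0|.
Proof.
rewrite /minkowski; set Sa := \sum_j _; set Sb := \sum_j _ => a0 b0.
have Sa0 : 0 <= Sa by apply: sumr_ge0 => j _; rewrite -expr2 sqr_ge0.
have Sb0 : 0 <= Sb by apply: sumr_ge0 => j _; rewrite -expr2 sqr_ge0.
set A := `|a ord0 ord0|; set B := `|b ord0 ord0|.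
have AE : a ord0 ord0 * a ord0 ord0 = A ^+ 2 by rewrite -expr2 real_normK ?num_real.
have BE : b ord0 ord0 * b ord0 ord0 = B ^+ 2 by rewrite -expr2 real_normK ?num_real.
have A0 : 0 < A by rewrite normr_gt0; apply: contraTneq a0 => ->; rewrite mul0r oppr0 add0r -leNgt.
have B0 : 0 < B by rewrite normr_gt0; apply: contraTneq b0 => ->; rewrite mul0r oppr0 add0r -leNgt.
rewrite normrM -/A -/B; apply: le_lt_trans (ler_norm_sum _ _ _) _.
rewrite -(ltr_pM2l (_ : 0 < 2 * A * B)); last by rewrite !mulr_gt0.
apply: (@le_lt_trans _ _ (B ^+ 2 * Sa + A ^+ 2 * Sb)).
  rewrite !mulr_sumr -big_split /=; apply: ler_sum => j _; rewrite normrM.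
  set x := a _ _; set y := b _ _.
  have -> : x * x = `|x| ^+ 2 by rewrite -expr2 real_normK ?num_real.
  have -> : y * y = `|y| ^+ 2 by rewrite -expr2 real_normK ?num_real.
  have := sqr_ge0 (B * `|x| - A * `|y|).
  by move=> h; rewrite -subr_ge0; move: h; congr (_ <= _); ring.
rewrite AE in a0; rewrite BE in b0.
have : 0 < B ^+ 2 * (A ^+ 2 - Sa) + A ^+ 2 * (B ^+ 2 - Sb).
  by apply: addr_gt0; apply: mulr_gt0; rewrite ?exprn_gt0 //; lra.
move=> h; rewrite -subr_gt0; move: h; congr (_ < _); ring.
Qed.

(** By [minkowski_lt0] the sign of a product of timelike vectors is opposite to that of the product
    of their time components. So [u] and [w] both have time components of sign opposite to that of
    [x], hence of equal sign. *)
Lemma lorentz_orientation G x u w : lorentz_signature G ->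
  qform G x x < 0 -> qform G u u < 0 -> qform G w w < 0 ->
  0 < qform G x u -> 0 < qform G x w -> qform G u w < 0.
Proof.
move=> /qform_minkowski [h hE]; rewrite !hE.
move: (h x) (h u) (h w) => a b c a0 b0 c0.
have := minkowski_lt0 a0 b0; have := minkowski_lt0 a0 c0.
have := minkowski_lt0 b0 c0; rewrite /minkowski.
set bc := \sum_j _; set ac := \sum_j _; set ab := \sum_j _.
move: (a ord0 ord0) (b ord0 ord0) (c ord0 ord0) => x0 u0 w0 hbc hac hab pab pac.
have xu : x0 * u0 < 0.
  by rewrite ltNge; apply/negP => xu; move: hab; have := ler_norm ab; rewrite (ger0_norm xu); lra.
have xw : x0 * w0 < 0.
  by rewrite ltNge; apply/negP => xw; move: hac; have := ler_norm ac; rewrite (ger0_norm xw); lra.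
have uw : 0 < u0 * w0.
  have : 0 < x0 ^+ 2 * (u0 * w0).
    have -> : x0 ^+ 2 * (u0 * w0) = (x0 * u0) * (x0 * w0) by ring.
    by rewrite nmulr_rgt0.
  rewrite pmulr_rgt0 // exprn_even_gt0 //=.
  by apply: contraTneq xu => ->; rewrite mul0r ltxx.
by move: hbc; have := ler_norm bc; rewrite (gtr0_norm uw); lra.
Qed.

Lemma lorentz_neq0 G x u : lorentz_signature G ->
  qform G x x < 0 -> qform G u u < 0 -> qform G x u != 0.
Proof.
move=> /qform_minkowski [h hE]; rewrite !hE => a0 b0.
have := minkowski_lt0 a0 b0; rewrite /minkowski; set s := \sum_j _.
by apply: contraTneq => /eqP; rewrite addrC subr_eq0 => /eqP ->; rewrite ltxx.
Qed.

Lemma qformDl G u v w : qform G (u + v) w = qform G u w + qform G v w.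
Proof. by rewrite /qform !mulmxDl mxE. Qed.

Lemma qformDr G u v w : qform G w (u + v) = qform G w u + qform G w v.
Proof. by rewrite /qform linearD mulmxDr mxE. Qed.

Lemma qformZl G (a : R) u v : qform G (a *: u) v = a * qform G u v.
Proof. by rewrite /qform -!scalemxAl mxE. Qed.

Lemma qformZr G (a : R) u v : qform G u (a *: v) = a * qform G u v.
Proof. by rewrite /qform linearZ -scalemxAr mxE. Qed.

Lemma qformC G u v : G^T = G -> qform G u v = qform G v u.
Proof.
move=> Gs; rewrite /qform -[in LHS](trmxK (u *m G *m v^T)) mxE.
by rewrite !trmx_mul trmxK Gs mulmxA.
Qed.

Lemma qformE G u v : qform G u v = \sum_i \sum_j G i j * (u ord0 i * v ord0 j).
Proof.
rewrite /qform mxE exchange_big /=; apply: eq_bigr => j _.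
by rewrite !mxE mulr_suml; apply: eq_bigr => i _; rewrite mulrCA mulrA mulrC.
Qed.

(** Each half of the cone is convex: the mixed term along the segment from [u] to [w] is negative by
    [lorentz_orientation]. *)
Lemma cone_connected G x u w : G^T = G -> lorentz_signature G ->
  qform G x x < 0 -> qform G u u < 0 -> qform G w w < 0 ->
  0 < qform G x u -> 0 < qform G x w ->
  connected_component [set v | qform G v v < 0] u w.
Proof.
move=> Gs GL x0 u0 w0 xu xw.
pose seg (t : R) : 'rV[R]_d.+1 := (1 - t) *: u + t *: w.
have cseg : continuous seg.
  move=> t; apply: cvgD; apply: cvgZr_tmp; last exact: cvg_id.
  by apply: cvgB; [exact: cvg_cst|exact: cvg_id].
exists (seg @` `[0, 1]); last first.
  exists 1; first by rewrite /= in_itv /= ler01 lexx.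
  by rewrite /seg subrr scale0r add0r scale1r.
split.
- exists 0; first by rewrite /= in_itv /= ler01 lexx.
  by rewrite /seg subr0 scale0r addr0 scale1r.
- move=> _ [t t01 <-].
  have /andP[t0 t1] : 0 <= t <= 1 by move: t01; rewrite /= in_itv.
  rewrite /= /seg !(qformDl, qformDr, qformZl, qformZr) (qformC w u) //.
  have uw := lorentz_orientation GL x0 u0 w0 xu xw.
  have [->|tn0] := eqVneq t 0; first by lra.
  have tp : 0 < t by rewrite lt_neqAle eq_sym tn0.
  have h1 : t * t * qform G w w < 0 by rewrite nmulr_llt0 // mulr_gt0.
  have h2 : (1 - t) * (1 - t) * qform G u u <= 0.
    by rewrite mulr_ge0_le0 ?(ltW u0) // -expr2 sqr_ge0.
  have h3 : (1 - t) * t * qform G u w <= 0.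
    by rewrite mulr_ge0_le0 ?(ltW uw) // mulr_ge0 // subr_ge0.
  by move: h1 h2 h3; move: (qform G w w) (qform G u u) (qform G u w) => *; lra.
- apply: connected_continuous_connected; last exact: continuous_subspaceT.
  exact: segment_connected.
Qed.

End LorentzAlgebra.

(** * Polygonal timelike curves *)

Section PolygonalCurves.
Variables (R : realType) (N : topologicalType) (d : nat).
Variables (M : smooth_manifold R N d.+1) (g : lorentz_metric M).
Implicit Types (X : chart R N d.+1 -> N -> 'rV[R]_d.+1)
  (phi psi : chart R N d.+1) (I J : set R) (gam : R -> N).

(* In signature (-,+,...,+) this puts v in the cone opposite to X p, so for
   future directed X the curves below descend. *)
Definition pointing X phi p v :=
  timelike g phi p v /\ 0 < qform (metric_comp g phi p) (X phi p) v.

(** [y] is only the formal position at parameter 0 and may lie outside the coordinate domain. *)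
Definition straight X (a b : R) gam :=
  exists phi y v, atlas M phi /\ forall s, a <= s <= b ->
    [/\ ccod phi (y + s *: v), gam s = cinv phi (y + s *: v) &
        pointing X phi (gam s) v].

(* Being a germ condition at each parameter, polygonality survives
   concatenation and infinite gluing without bookkeeping of break points; these
   may accumulate only outside of I. *)
Definition polygonal X I gam := forall t, I t ->
  (forall b, I b -> t < b -> exists2 c, t < c <= b & straight X t c gam) /\
  (forall a, I a -> a < t -> exists2 c, a <= c < t & straight X c t gam).

Lemma straight_eq X a b gam gam' : (forall s, a <= s <= b -> gam s = gam' s) ->
  straight X a b gam -> straight X a b gam'.
Proof.
move=> E [phi [y [v [aphi S]]]]; exists phi, y, v; split=> // s sab.
by rewrite -E //; exact: S.
Qed.

Lemma pointingZ X phi p v (k : R) : 0 < k -> pointing X phi p v ->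
  pointing X phi p (k *: v).
Proof.
move=> k0 [tv Xv]; rewrite /pointing /timelike qformZl !qformZr.
by rewrite !pmulr_rlt0 // pmulr_rgt0.
Qed.

Lemma straight_affine X a b a' b' gam (k t0 : R) : 0 < k ->
  (forall s, a' <= s <= b' -> a <= k * s + t0 <= b) ->
  straight X a b gam -> straight X a' b' (fun s => gam (k * s + t0)).
Proof.
move=> k0 E [phi [y [v [aphi S]]]]; exists phi, (y + t0 *: v), (k *: v).
split=> // s /E /S.
have -> : y + (k * s + t0) *: v = y + t0 *: v + s *: (k *: v).
  by rewrite scalerDl scalerA (mulrC s) -addrA [t0 *: v + _]addrC.
by move=> [h1 h2 h3]; split=> //; exact: pointingZ.
Qed.

Definition reversed X : chart R N d.+1 -> N -> 'rV[R]_d.+1 :=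
  fun phi p => - X phi p.

Lemma straight_opp X a b gam : straight X a b gam ->
  straight (reversed X) (- b) (- a) (fun s => gam (- s)).
Proof.
move=> [phi [y [v [aphi S]]]]; exists phi, y, (- v); split=> // s sab.
have := S (- s); rewrite scalerN -scaleNr; case=> [|h1 h2 [h3 h4]].
  by rewrite lerNr lerNl andbC.
split=> //; rewrite /pointing /timelike /reversed -(scaleN1r v) -(scaleN1r (X _ _)).
by rewrite !(qformZl, qformZr) !mulN1r !opprK.
Qed.

Lemma polygonal_affine X I gam (k t0 : R) : 0 < k -> polygonal X I gam ->
  polygonal X [set s | I (k * s + t0)] (fun s => gam (k * s + t0)).
Proof.
move=> k0 PI t /= It; have [PR PL] := PI _ It.
have mono s s' : (k * s + t0 < k * s' + t0) = (s < s').
  by rewrite ltrD2r ltr_pM2l.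
have monoe s s' : (k * s + t0 <= k * s' + t0) = (s <= s').
  by rewrite lerD2r ler_pM2l.
pose inv c := k^-1 * (c - t0).
have invK c : k * inv c + t0 = c by rewrite mulVKf ?gt_eqF // subrK.
split=> [b Ib tb|a Ia at_].
  have [|c] := PR _ Ib; first by rewrite mono.
  rewrite -(invK c) mono monoe => tc S; exists (inv c) => //.
  by apply: straight_affine S => // s; rewrite !monoe.
have [|c] := PL _ Ia; first by rewrite mono.
rewrite -(invK c) mono monoe => tc S; exists (inv c) => //.
by apply: straight_affine S => // s; rewrite !monoe.
Qed.

Lemma polygonal_opp X I gam : polygonal X I gam ->
  polygonal (reversed X) [set s | I (- s)] (fun s => gam (- s)).
Proof.
move=> PI t /= It; have [PR PL] := PI _ It; split=> [b Ib tb|a Ia at_].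
  have [|c /andP[bc ct] S] := PL _ Ib; first by rewrite ltrN2.
  exists (- c); first by rewrite ltrNr ct lerNl.
  by have := straight_opp S; rewrite opprK.
have [|c /andP[tc ca] S] := PR _ Ia; first by rewrite ltrN2.
exists (- c); first by rewrite lerNr ca ltrNl.
by have := straight_opp S; rewrite opprK.
Qed.

Lemma polygonal_sub X I J gam : J `<=` I -> polygonal X I gam ->
  polygonal X J gam.
Proof.
move=> JI PI t /JI /PI [PR PL]; split=> [b /JI /PR|a /JI /PL]; exact.
Qed.

Lemma polygonal_eq X I gam gam' : is_interval I ->
  (forall s, I s -> gam s = gam' s) -> polygonal X I gam -> polygonal X I gam'.
Proof.
move=> iI E PI t It; have [PR PL] := PI _ It; split=> [b Ib tb|a Ia at_].
  have [c /andP[tc cb] S] := PR _ Ib tb; exists c; first by rewrite tc.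
  apply: straight_eq S => s /andP[ts sc]; apply: E.
  by apply: (iI _ _ It Ib); rewrite ts (le_trans sc).
have [c /andP[ac ct] S] := PL _ Ia at_; exists c; first by rewrite ac.
apply: straight_eq S => s /andP[cs st]; apply: E.
by apply: (iI _ _ Ia It); rewrite st (le_trans ac).
Qed.

(** The velocities on the two sides of [t0] need not be compared with each other, because [pointing]
    compares both with [X]. *)
Lemma polygonal_glue X I gam t0 : is_interval I -> I t0 ->
  polygonal X (I `&` [set s | s <= t0]) gam ->
  polygonal X (I `&` [set s | t0 <= s]) gam -> polygonal X I gam.
Proof.
move=> iI I0 PL PR t It; split=> [b Ib tb|a Ia at_].
- have [tt0|t0t] := ltP t t0; last first.
    have [+ _] := PR t (conj It t0t); apply=> //; split=> //=.
    exact: le_trans (ltW tb).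
  have [bt0|t0b] := leP b t0.
    by have [+ _] := PL t (conj It (ltW tt0)); apply=> //; split.
  have [/(_ t0 (conj I0 (lexx t0)) tt0) [c /andP[tc ct0] S] _] :=
    PL t (conj It (ltW tt0)).
  by exists c => //; rewrite tc (le_trans ct0 (ltW t0b)).
- have [t0t|tt0] := ltP t0 t; last first.
    have [_] := PL t (conj It tt0); apply=> //; split=> //=.
    exact: le_trans (ltW at_) tt0.
  have [t0a|at0] := leP t0 a.
    by have [_] := PR t (conj It (ltW t0t)); apply=> //; split.
  have [_ /(_ t0 (conj I0 (lexx t0)) t0t) [c /andP[tc ct0] S]] :=
    PR t (conj It (ltW t0t)).
  by exists c => //; rewrite ct0 (le_trans (ltW at0) tc).
Qed.

Lemma straight_continuous X a b gam t W : straight X a b gam -> a <= t <= b ->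
  nbhs (gam t) W ->
  exists2 e : R, 0 < e & forall s, a <= s <= b -> `|s - t| < e -> W (gam s).
Proof.
move=> [phi [y [v [aphi S]]]] tab; have [yc -> _] := S _ tab => nW.
have cc := continuous_cinv (atlas_chart aphi) yc.
have ct : (fun s => y + s *: v) @ t --> y + t *: v.
  by apply: cvgD; [exact: cvg_cst|apply: cvgZr_tmp; exact: cvg_id].
have /nbhs_ballP[e /= e0 eW] : nbhs t (fun s => W (cinv phi (y + s *: v))).
  exact: (cvg_comp _ _ ct cc).
exists e => // s sab st; have [_ -> _] := S _ sab.
by apply: eW; rewrite /ball /= distrC.
Qed.

Lemma polygonal_continuous X I gam t W : polygonal X I gam -> I t ->
  nbhs (gam t) W ->
  exists2 e : R, 0 < e & forall s, I s -> `|s - t| < e -> W (gam s).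
Proof.
move=> PI It nW; have [PR PL] := PI _ It.
have [eR eR0 HR] : exists2 e : R, 0 < e & forall s, I s -> t <= s ->
    `|s - t| < e -> W (gam s).
  have [[b [Ib tb]]|nb] := pselect (exists b, I b /\ t < b); last first.
    exists 1 => // s Is; rewrite le_eqVlt => /orP[/eqP <- _|ts].
      exact: nbhs_singleton.
    by case: nb; exists s.
  have [c /andP[tc cb] S] := PR _ Ib tb.
  have [|e e0 H] := straight_continuous S _ nW; first by rewrite lexx ltW.
  exists (Num.min e (c - t)); first by rewrite lt_min e0 subr_gt0.
  move=> s Is ts; rewrite lt_min => /andP[se sc]; apply: H => //.
  rewrite ts /=; move: sc; rewrite ger0_norm ?subr_ge0 //.
  by rewrite ltrD2r => /ltW.
have [eL eL0 HL] : exists2 e : R, 0 < e & forall s, I s -> s <= t ->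
    `|s - t| < e -> W (gam s).
  have [[a [Ia at_]]|na] := pselect (exists a, I a /\ a < t); last first.
    exists 1 => // s Is; rewrite le_eqVlt => /orP[/eqP -> _|ts].
      exact: nbhs_singleton.
    by case: na; exists s.
  have [c /andP[ac ct] S] := PL _ Ia at_.
  have [|e e0 H] := straight_continuous S _ nW; first by rewrite lexx ltW.
  exists (Num.min e (t - c)); first by rewrite lt_min e0 subr_gt0.
  move=> s Is st; rewrite lt_min => /andP[se sc]; apply: H => //.
  rewrite st andbT; move: sc; rewrite distrC ger0_norm ?subr_ge0 //.
  by rewrite ltrD2l ltrN2 => /ltW.
exists (Num.min eR eL); first by rewrite lt_min eR0.
move=> s Is; rewrite lt_min => /andP[sR sL].
by have [st|/ltW ts] := leP s t; [exact: HL|exact: HR].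
Qed.

(** Bolzano-Weierstrass: otherwise [S] would accumulate at a point of the segment, near which the
    hypothesis leaves at most that point itself. *)
Lemma locally_finite_segment (S : set R) (a b : R) :
  (forall t, a <= t <= b -> exists2 e : R, 0 < e &
    forall s, a <= s <= b -> S s -> `|s - t| < e -> s = t) ->
  finite_set (S `&` `[a, b]%classic).
Proof.
move=> H; apply: contrapT => infS.
have [|l /limit_point_infinite_setP ll] := infinite_bounded_limit_point_nonempty infS.
  exists (Num.max `|a| `|b|); split; first exact: num_real.
  move=> x xm s [_ /=]; rewrite in_itv /= => /andP[as_ sb].
  apply: le_trans (ltW xm); rewrite ler_norml le_max.
  rewrite (le_trans sb (ler_norm b)) orbT andbT.
  apply: le_trans as_; rewrite lerNl le_max.
  by rewrite (le_trans (ler_norm (-a))) // normrN.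
have lab : a <= l <= b.
  rewrite andbC leNgt [X in _ && X]leNgt; apply/andP; split; apply/negP => h.
  - have /ll [] : nbhs l [set x | b < x] by exact: lt_nbhsr.
    apply: (@sub_finite_set _ _ set0); last exact: finite_set0.
    by move=> x [/= bx [_]] /=; rewrite in_itv /= => /andP[_]; rewrite leNgt bx.
  - have /ll [] : nbhs l [set x | x < a] by exact: lt_nbhsl.
    apply: (@sub_finite_set _ _ set0); last exact: finite_set0.
    by move=> x [/= bx [_]] /=; rewrite in_itv /= => /andP[]; rewrite leNgt bx.
have [e e0 He] := H _ lab.
have /ll [] : nbhs l (ball l e) by exact: nbhsx_ballx.
apply: (@sub_finite_set _ _ [set l]); last exact: finite_set1.
move=> x [/= bx [Sx]] /=; rewrite in_itv /= => xab.
by apply: He => //; rewrite distrC.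
Qed.

Lemma Ck_line k (y v : 'rV[R]_d.+1) : Ck k [set: R] (fun s : R => y + s *: v).
Proof.
apply: Ck_rV; first exact: openT.
move=> i; have := CkD openT (Ck_cst openT k (y ord0 i))
  (CkM openT (Ck_id (V := R) k openT) (Ck_cst openT k (v ord0 i))).
by apply: Ck_eq => [|x _]; [exact: openT|rewrite /= !mxE].
Qed.

Lemma straight_smooth X a b gam J (O : set R) t : straight X a b gam ->
  open_nbhs t O -> J `&` O `<=` `[a, b] ->
  exists (phi : chart R N d.+1) (O : set R),
    [/\ atlas M phi, open_nbhs t O,
        forall s, J s -> O s -> cdom phi (gam s) &
        smooth_on (J `&` O) (cmap phi \o gam)].
Proof.
move=> [phi [y [v [aphi S]]]] oO Jab; exists phi, O.
have cphi := atlas_chart aphi.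
have Sab s : J s -> O s -> ccod phi (y + s *: v) /\ gam s = cinv phi (y + s *: v).
  move=> Js Os; have := Jab s (conj Js Os); rewrite /= in_itv /= => /S.
  by case.
split=> // [s Js Os|s [Js Os]].
  by have [h ->] := Sab _ Js Os; exact: cdom_cinv.
exists setT, (fun s => y + s *: v); split.
- by split=> //; exact: openT.
- by move=> k; exact: Ck_line.
- by move=> r [Jr Or] _; have [h /= ->] := Sab _ Jr Or; rewrite cinvK.
Qed.

(** Break points are declared to be the parameters interior to no straight piece. They are isolated,
    since on each side of any parameter a whole interval is interior to one piece. *)
Lemma polygonal_piecewise_smooth X I gam : is_interval I -> polygonal X I gam ->
  piecewise_smooth M I gam.
Proof.
move=> iI PI.
exists [set t | ~ exists a b, a < t < b /\ straight X a b gam]; split.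
  move=> a b Ia Ib; apply: locally_finite_segment => t /andP[at_ tb].
  have It : I t by apply: (iI _ _ Ia Ib); rewrite at_.
  have [PR PL] := PI _ It.
  have [eR eR0 HR] : exists2 e : R, 0 < e & forall s, s <= b -> t < s ->
      `|s - t| < e -> exists a b, a < s < b /\ straight X a b gam.
    move: tb; rewrite le_eqVlt => /orP[/eqP ->|tb].
      by exists 1 => // s sb bs; move: (lt_le_trans bs sb); rewrite ltxx.
    have [c /andP[tc cb] S] := PR _ Ib tb.
    exists (c - t); first by rewrite subr_gt0.
    move=> s _ ts; rewrite ger0_norm ?subr_ge0 ?(ltW ts) // ltrD2r => sc.
    by exists t, c; rewrite ts sc.
  have [eL eL0 HL] : exists2 e : R, 0 < e & forall s, a <= s -> s < t ->
      `|s - t| < e -> exists a b, a < s < b /\ straight X a b gam.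
    move: at_; rewrite le_eqVlt => /orP[/eqP <-|at_].
      by exists 1 => // s sb bs; move: (lt_le_trans bs sb); rewrite ltxx.
    have [c /andP[ac ct] S] := PL _ Ia at_.
    exists (t - c); first by rewrite subr_gt0.
    move=> s _ st; rewrite distrC ger0_norm ?subr_ge0 ?(ltW st) //.
    by rewrite ltrD2l ltrN2 => sc; exists c, t; rewrite st sc.
  exists (Num.min eR eL); first by rewrite lt_min eR0.
  move=> s /andP[as_ sb] nS; rewrite lt_min => /andP[sR sL].
  have [st|ts|//] := ltgtP s t; first by case: nS; exact: HL.
  by case: nS; exact: HR.
move=> a b Ia Ib ab nS t /=; rewrite in_itv /= => /andP[at_ tb].
have [PRa _] := PI _ Ia; have [_ PLb] := PI _ Ib.
have [at'|ta] := ltP a t; last first.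
  have -> : t = a by apply/le_anti; rewrite at_ ta.
  have [c /andP[ac cb] S] := PRa _ Ib ab.
  apply: (straight_smooth (O := [set s | s < c]) S).
    by split=> //; exact: open_lt.
  by move=> s [/=]; rewrite !in_itv /= => /andP[-> _] /ltW.
have [tb'|bt] := ltP t b; last first.
  have -> : t = b by apply/le_anti; rewrite tb bt.
  have [c /andP[ac cb] S] := PLb _ Ia ab.
  apply: (straight_smooth (O := [set s | c < s]) S).
    by split=> //; exact: open_gt.
  by move=> s [/=]; rewrite !in_itv /= => /andP[_ ->] /ltW ->.
have [a' [b' [tab' S]]] : exists a b, a < t < b /\ straight X a b gam.
  by apply: contrapT => /nS; rewrite at' tb'.
apply: (straight_smooth (O := `]a', b'[%classic) S).
  by split; [exact: itv_open|rewrite /= in_itv].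
by move=> s [_]; exact: subset_itv_oo_cc.
Qed.

End PolygonalCurves.

(** * Polygonal curves are timelike *)

Section TimelikeCurves.
Variables (R : realType) (N : topologicalType) (d : nat).
Variables (M : smooth_manifold R N d.+1) (g : lorentz_metric M).
Variables (X : chart R N d.+1 -> N -> 'rV[R]_d.+1).
Hypothesis HX : time_orientation g X.
Implicit Types (phi psi : chart R N d.+1) (I J : set R) (gam : R -> N).

Lemma time_orientation_reversed : time_orientation g (reversed X).
Proof.
case: HX => X1 X2 X3; split.
- move=> phi psi p aphi apsi pd pd'; rewrite /reversed (X1 phi psi) //.
  rewrite /change_comp; set T := transition phi psi; set y := cmap phi p.
  have cphi := atlas_chart aphi.
  have oy : overlap phi psi y by exists p.
  have [U [oU Uy _ C]] := transition_smooth aphi apsi oy.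
  (* Homogeneity in the direction is needed for [- X] to transform as a vector field; it is read off
     from the expression through partial derivatives. *)
  have D (k : R) (v : 'rV[R]_d.+1) : 'D_(k *: v) T y = k *: 'D_v T y.
    have line : is_derive (0 : R) 1 (fun u => y + (u * k) *: v) (k *: v).
      have := @is_derive_line R _ _ id y (k *: v) 0 (@derivable_id _ _ _ _).
      by rewrite derive_id; under eq_fun do rewrite scalerA.
    have lin2 : is_derive (0 : R) 1 (fun u => y + u *: v) v.
      have := @is_derive_line R _ _ id y v 0 (@derivable_id _ _ _ _).
      by rewrite derive_id.
    apply/rowP => j; rewrite mxE.
    have dT w : derivable T y w by have [_ /(_ w) [+ _]] := C 1; apply.
    rewrite !derive_mx // !mxE.
    have CTj := Ck_coord oU j (C 1).
    have dTj w : derivable (fun y => T y ord0 j) y w.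
      by have /derivable_mxP := dT w; exact.
    have DT w := @derive_comp R _ _ (fun y => T y ord0 j) id _ y w oU Uy CTj
      (@derivable_id _ _ _ _).
    move: (DT (k *: v)) (DT v); rewrite !derive_id => -[_ E2] [_ E1].
    rewrite [LHS]E2 [X in _ * X]E1 mulr_sumr.
    by apply: eq_bigr => i _; rewrite mxE mulrA.
  by rewrite -(scaleN1r (X phi p)) D scaleN1r.
- move=> phi aphi p; apply: continuousN; exact: X2.
- move=> phi p aphi pd; rewrite /timelike /reversed -scaleN1r qformZl qformZr.
  by rewrite !mulN1r opprK; exact: X3.
Qed.

Lemma pointing_change phi psi p v : atlas M phi -> atlas M psi ->
  cdom phi p -> cdom psi p -> pointing g X phi p v ->
  pointing g X psi p (change_comp phi psi p v).
Proof.
case: HX => X1 _ _ aphi apsi pd pd'.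
rewrite /pointing /timelike (X1 phi psi p) //.
by rewrite !(metric_tensor g aphi apsi pd pd').
Qed.

Lemma pointing_component phi p v w : atlas M phi -> cdom phi p ->
  pointing g X phi p v -> pointing g X phi p w ->
  connected_component [set u | timelike g phi p u] v w.
Proof.
case: HX => _ _ X3 aphi pd [tv Xv] [tw Xw].
exact: (cone_connected (Defs.metric_sym g aphi pd) (metric_sign g aphi pd)
  (X3 _ _ aphi pd) tv tw Xv Xw).
Qed.

(** The filter [F] stands for either one-sided approach to 0. By uniqueness of limits the velocity
    in the chart [psi] is the transformed direction of the piece, and [pointing] is independent of
    the chart. *)
Lemma straight_velocity (F : set_system R) (FF : ProperFilter F) a b gam t psi w :
  F --> (0 : R)^' -> straight g X a b gam -> a <= t <= b ->
  (\forall h \near F, a <= t + h <= b) ->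
  atlas M psi -> cdom psi (gam t) ->
  (fun h : R => h^-1 *: (cmap psi (gam (t + h)) - cmap psi (gam t))) @ F --> w ->
  pointing g X psi (gam t) w.
Proof.
move=> F0 [phi [y [v [aphi S]]]] tab Fab apsi pd Fw.
have [yc gt vt] := S _ tab; have cphi := atlas_chart aphi.
have pd' : cdom phi (gam t) by rewrite gt; exact: cdom_cinv.
have ov : overlap phi psi (y + t *: v).
  by apply/(overlapP _ _ cphi); rewrite -gt.
suff -> : w = change_comp phi psi (gam t) v by exact: pointing_change.
have dl : is_derive t 1 (fun u => y + u *: v) v.
  have := @is_derive_line R _ _ id y v t (@derivable_id _ _ _ _).
  by rewrite derive_id.
have [dT <-] : is_derive t 1 (transition phi psi \o (fun u => y + u *: v))
    (change_comp phi psi (gam t) v).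
  by rewrite gt; exact: (derive_transition aphi apsi ov dl).
apply: (cvg_unique _ Fw) => //.
have := cvg_comp _ _ F0 dT; apply: cvg_trans.
apply: near_eq_cvg; near=> h.
have [|_ gth _] := S (t + h); first by near: h.
by rewrite gth gt /= [h *: 1]mulr1 [h + t]addrC.
Unshelve. all: by end_near. Qed.

(** At a break point both velocities lie in the half of the cone singled out by [X], which is
    connected. *)
Lemma polygonal_timelike I gam : is_interval I ->
  (exists a b, [/\ I a, I b & a < b]) -> polygonal g X I gam ->
  timelike_curve g I gam.
Proof.
move=> iI Iab PI.
have PR t v : I t -> (exists2 b, I b & t < b) ->
    has_right_velocity (chart_at M (gam t)) gam t v ->
    pointing g X (chart_at M (gam t)) (gam t) v.
  move=> It [b Ib tb] Hv; have [/(_ b Ib tb) [c /andP[tc cb] S] _] := PI _ It.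
  apply: (@straight_velocity (0 : R)^'+ _ t c gam) Hv => //.
  - move=> A [e e0 eA]; exists e => // x xe x0; apply: eA => //=.
    by rewrite gt_eqF.
  - by rewrite lexx ltW.
  - near=> h; rewrite lerDl -lerBrDl; apply/andP; split; near: h.
      exact: nbhs_right_ge.
    by apply: nbhs_right_le; rewrite subr_gt0.
  - exact: chart_at_atlas.
  - exact: chart_at_dom.
have PL t v : I t -> (exists2 a, I a & a < t) ->
    has_left_velocity (chart_at M (gam t)) gam t v ->
    pointing g X (chart_at M (gam t)) (gam t) v.
  move=> It [b Ib tb] Hv; have [_ /(_ b Ib tb) [c /andP[tc cb] S]] := PI _ It.
  apply: (@straight_velocity (0 : R)^'- _ c t gam) Hv => //.
  - move=> A [e e0 eA]; exists e => // x xe x0; apply: eA => //=.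
    by rewrite lt_eqF.
  - by rewrite lexx ltW.
  - near=> h; rewrite gerDl -lerBlDl; apply/andP; split; near: h.
      by apply: nbhs_left_ge; rewrite subr_lt0.
    exact: nbhs_left_le.
  - exact: chart_at_atlas.
  - exact: chart_at_dom.
split=> //.
- exact: polygonal_piecewise_smooth PI.
- by move=> t v It tb /(PR _ _ It tb) [].
- by move=> t v It tb /(PL _ _ It tb) [].
- move=> t v w It ta tb Hv Hw; apply: pointing_component.
  + exact: chart_at_atlas.
  + exact: chart_at_dom.
  + exact: PL.
  + exact: PR.
Unshelve. all: by end_near. Qed.

End TimelikeCurves.

(** * Inextendible rays and the chronological relation *)

Section Rays.
Variables (R : realType) (N : topologicalType) (d : nat).
Variables (M : smooth_manifold R N d.+1) (g : lorentz_metric M).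
Implicit Types (X : chart R N d.+1 -> N -> 'rV[R]_d.+1).
Implicit Types (phi psi : chart R N d.+1) (I J : set R) (gam : R -> N).

(** Divergence at the right end in positive form, so that the neighbourhoods carry over when curves
    are restricted, shifted or glued. *)
Definition escapes_right I gam := forall p : N, exists2 W, nbhs p W &
  forall t0, I t0 -> exists t, [/\ I t, t0 <= t & ~ W (gam t)].

Definition escapes_left I gam := forall p : N, exists2 W, nbhs p W &
  forall t0, I t0 -> exists t, [/\ I t, t <= t0 & ~ W (gam t)].

Lemma escapes_rightP I gam :
  escapes_right I gam <-> ~ (exists p : N, gam @ right_end I --> p).
Proof.
split=> [H [p /= cv]|H p].
  have [W /cv [t0 I0 sub] HW] := H p.
  by have [t [It t0t]] := HW _ I0; apply; apply: sub.
apply: contrapT => nW; apply: H; exists p => W nbW /=.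
apply: contrapT => nF; apply: nW; exists W => // t0 It0.
apply: contrapT => nt; apply: nF; exists t0 => // t [It t0t].
by apply: contrapT => nWt; apply: nt; exists t.
Qed.

Lemma escapes_leftP I gam :
  escapes_left I gam <-> ~ (exists p : N, gam @ left_end I --> p).
Proof.
split=> [H [p /= cv]|H p].
  have [W /cv [t0 I0 sub] HW] := H p.
  by have [t [It t0t]] := HW _ I0; apply; apply: sub.
apply: contrapT => nW; apply: H; exists p => W nbW /=.
apply: contrapT => nF; apply: nW; exists W => // t0 It0.
apply: contrapT => nt; apply: nF; exists t0 => // t [It t0t].
by apply: contrapT => nWt; apply: nt; exists t.
Qed.

Lemma inextendibleP I gam :
  inextendible I gam <-> escapes_right I gam /\ escapes_left I gam.
Proof. by rewrite /inextendible escapes_rightP escapes_leftP. Qed.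

(** Past and future refer to the parameter: a past ray arrives at [p] and a future ray starts there.
    [past_ray_lt] ensures that a curve glued from the two has a nondegenerate interval. *)
Record past_ray X p I gam := PastRay {
  past_ray_itv : is_interval I;
  past_ray0 : I 0;
  past_ray_le : forall s, I s -> s <= 0;
  past_ray_lt : exists2 s, I s & s < 0;
  past_ray_poly : polygonal g X I gam;
  past_ray_start : gam 0 = p;
  past_ray_escapes : escapes_left I gam }.

Record future_ray X p I gam := FutureRay {
  future_ray_itv : is_interval I;
  future_ray0 : I 0;
  future_ray_ge : forall s, I s -> 0 <= s;
  future_ray_poly : polygonal g X I gam;
  future_ray_start : gam 0 = p;
  future_ray_escapes : escapes_right I gam }.

(** For future directed [X], polygonal curves descend and [q] is in the chronological past of
    [p]. *)
Definition reach X p q := exists gam,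
  [/\ polygonal g X `[0, 1]%classic gam, gam 0 = p & gam 1 = q].

Lemma polygonal_concat X I1 I2 gam1 gam2 (t0 : R) :
  is_interval I1 -> is_interval I2 -> I1 t0 -> I2 t0 ->
  (forall s, I1 s -> s <= t0) -> (forall s, I2 s -> t0 <= s) ->
  gam1 t0 = gam2 t0 -> polygonal g X I1 gam1 -> polygonal g X I2 gam2 ->
  exists gam, [/\ is_interval (I1 `|` I2), polygonal g X (I1 `|` I2) gam,
      forall s, I1 s -> gam s = gam1 s & forall s, I2 s -> gam s = gam2 s].
Proof.
move=> i1 i2 h1 h2 le1 le2 E P1 P2; set I := I1 `|` I2.
pose gam s := if s <= t0 then gam1 s else gam2 s; exists gam.
have E1 s : I1 s -> gam s = gam1 s by rewrite /gam => /le1 ->.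
have E2 s : I2 s -> gam s = gam2 s.
  rewrite /gam => /le2; rewrite le_eqVlt => /orP[/eqP <-|]; first by rewrite lexx.
  by rewrite ltNge => /negbTE ->.
have iI : is_interval I.
  move=> a b Ia Ib c /andP[ac cb]; have [ct|tc] := leP c t0.
    left; apply: (i1 a t0) => //; last by rewrite ac.
    case: Ia => // Ia; have := le2 _ Ia => ta.
    by have -> : a = t0 by apply/le_anti; rewrite ta (le_trans ac ct).
  right; apply: (i2 t0 b) => //; last by rewrite (ltW tc).
  case: Ib => // Ib; have := le1 _ Ib => tb.
  by have := lt_le_trans tc (le_trans cb tb); rewrite ltxx.
split=> //; apply: (@polygonal_glue _ _ _ _ _ _ _ _ t0) => //; first by left.
- have -> : I `&` [set s | s <= t0] = I1.
    apply/seteqP; split=> [s [[//|I2s] st]|s I1s]; last by split; [left|exact: le1].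
    by have -> : s = t0 by apply/le_anti; rewrite st le2.
  by apply: polygonal_eq P1 => // s I1s; rewrite E1.
- have -> : I `&` [set s | t0 <= s] = I2.
    apply/seteqP; split=> [s [[I1s|//] st]|s I2s]; last by split; [right|exact: le2].
    by have -> : s = t0 by apply/le_anti; rewrite st le1.
  by apply: polygonal_eq P2 => // s I2s; rewrite E2.
Qed.

Lemma reach_sub X I gam s t : is_interval I -> polygonal g X I gam ->
  I s -> I t -> s < t -> reach X (gam s) (gam t).
Proof.
move=> iI PI Is It st; have st0 : 0 < t - s by rewrite subr_gt0.
exists (fun u => gam ((t - s) * u + s)); split.
- apply: polygonal_sub (polygonal_affine (t0 := s) st0 PI) => u /=.
  rewrite in_itv /= => /andP[u0 u1]; apply: (iI _ _ Is It).
  by rewrite lerDr mulr_ge0 ?(ltW st0) //= -lerBrDr ler_piMr // ltW.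
- by rewrite mulr0 add0r.
- by rewrite mulr1 subrK.
Qed.

Lemma reach_opp X p q : reach (reversed X) p q -> reach X q p.
Proof.
move=> [gam [P g0 g1]].
have := polygonal_affine (t0 := -1) (@ltr01 R) (polygonal_opp P).
have -> : reversed (reversed X) = X.
  by apply/funext => phi; apply/funext => r; rewrite /reversed opprK.
move=> PX; exists (fun s => gam (- (1 * s + -1))); split.
- apply: polygonal_sub PX => u /=; rewrite !in_itv /= => /andP[u0 u1].
  by apply/andP; split; lra.
- by rewrite mulr0 add0r opprK.
- by rewrite mulr1 subrr oppr0.
Qed.

(** The ray keeps the parameters of [gam], so that [p] and [q] sit at the distinct parameters 0 and
    1 of one ray. *)
Lemma future_ray_reach X p q gam J gam' :
  polygonal g X `[0, 1]%classic gam -> gam 0 = p -> gam 1 = q ->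
  future_ray X q J gam' ->
  exists I gam2, [/\ future_ray X p I gam2, I 1,
    forall s, 0 <= s <= 1 -> I s /\ gam2 s = gam s & gam2 1 = q].
Proof.
move=> P g0 g1 [iJ J0 Jge PJ gJ eJ].
pose J' := [set s | J (1 * s + -1)].
have iJ' : is_interval J'.
  move=> a b Ja Jb c /andP[ac cb]; apply: (iJ _ _ Ja Jb).
  by rewrite !mul1r !lerD2r ac.
have J'1 : J' 1 by rewrite /J' /= mulr1 subrr.
have [||||||gam2 [iI PI E1 E2]] := @polygonal_concat X `[0, 1]%classic J' gam
  (fun s => gam' (1 * s + -1)) 1 (@interval_is_interval _ `[0, 1]) iJ' _ J'1.
- by rewrite /= in_itv /= ler01 lexx.
- by move=> s /=; rewrite in_itv /= => /andP[].
- by move=> s /Jge; rewrite mul1r subr_ge0.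
- by rewrite g1 mulr1 subrr gJ.
- exact: P.
- exact: (polygonal_affine (t0 := -1) ltr01 PJ).
set I := _ `|` _ in iI PI *.
have I01 s : 0 <= s <= 1 -> I s /\ gam2 s = gam s.
  by move=> s01; split; [left|apply: E1]; rewrite /= in_itv.
exists I, gam2; split=> //.
- split=> //.
  + by apply: (I01 0 _).1; rewrite lexx ler01.
  + move=> s [/=|/Jge]; first by rewrite in_itv /= => /andP[].
    by rewrite mul1r subr_ge0; exact: le_trans.
  + by rewrite E1 //= in_itv /= lexx ler01.
  + move=> r; have [W nW HW] := eJ r; exists W => // t0 It0.
    have [t1 J't1 t01] : exists2 t1, J' t1 & t0 <= t1.
      have [t1|/ltW t1] := leP t0 1; first by exists 1.
      by case: It0 => [/=|]; [rewrite in_itv /= => /andP[_ ?]; exists 1|exists t0].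
    have [t [Jt tt nWt]] := HW _ J't1; exists (t + 1).
    have J't : J' (t + 1) by rewrite /J' /= mul1r addrK.
    split; first by right.
      by apply: le_trans t01 _; rewrite -lerBlDr; move: tt; rewrite mul1r.
    by rewrite E2 //= mul1r addrK.
- by apply: (I01 1 _).1; rewrite lexx ler01.
- by rewrite E1 //= in_itv /= lexx ler01.
Qed.

Lemma reach_trans X p q r : reach X p q -> reach X q r -> reach X p r.
Proof.
move=> [gam [P g0 g1]] [gam' [P' g0' g1']].
pose J' : set R := [set s | `[0, 1]%classic (1 * s + -1)].
have J'E s : J' s <-> 1 <= s <= 2.
  by rewrite /J' /= in_itv /= mul1r subr_ge0 lerBlDr.
have iJ' : is_interval J'.
  move=> a b /J'E /andP[a1 _] /J'E /andP[_ b2] c /andP[ac cb].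
  by apply/J'E; rewrite (le_trans a1 ac) (le_trans cb b2).
have J'1 : J' 1 by apply/J'E; rewrite lexx ler1n.
have [||||||gam2 [iI PI E1 E2]] := @polygonal_concat X `[0, 1]%classic J' gam
  (fun s => gam' (1 * s + -1)) 1 (@interval_is_interval _ `[0, 1]) iJ' _ J'1.
- by rewrite /= in_itv /= ler01 lexx.
- by move=> s /=; rewrite in_itv /= => /andP[].
- by move=> s /J'E /andP[].
- by rewrite g1 mulr1 subrr g0'.
- exact: P.
- exact: (polygonal_affine (t0 := -1) ltr01 P').
have J'2 : J' 2 by apply/J'E; rewrite ler1n lexx.
have h0 : `[0 : R, 1]%classic (0 : R) by rewrite /= in_itv /= lexx ler01.
have := reach_sub iI PI (or_introl h0) (or_intror J'2) (ltr0Sn R 1).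
rewrite (E1 _ h0) (E2 _ J'2) g0 mul1r.
have -> : 2 - 1 = 1 :> R by lra.
by rewrite g1'.
Qed.

Section Sequence.
Variables (X : chart R N d.+1 -> N -> 'rV[R]_d.+1) (p : nat -> N).
Variable (gam : nat -> R -> N).
Hypotheses (Pgam : forall n, polygonal g X `[0, 1]%classic (gam n))
  (gam0 : forall n, gam n 0 = p n) (gam1 : forall n, gam n 1 = p n.+1).

Definition chain (t : R) : N :=
  gam (Num.truncn t) (t - (Num.truncn t)%:R).

Lemma chainE n (t : R) : n%:R <= t <= n.+1%:R -> chain t = gam n (t - n%:R).
Proof.
move=> /andP[nt]; rewrite le_eqVlt => /orP[/eqP ->|tn].
  by rewrite /chain natrK subrr gam0 -natrB // subSnn gam1.
by rewrite /chain (@truncn_def _ t n) // nt tn.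
Qed.

Lemma polygonal_chain : polygonal g X `[0, +oo[%classic chain.
Proof.
have step n : polygonal g X `[n%:R, n.+1%:R]%classic chain.
  have := polygonal_affine (t0 := - n%:R) (@ltr01 R) (Pgam n).
  have -> : [set s : R | `[0, 1]%classic (1 * s + - n%:R)] = `[n%:R, n.+1%:R]%classic.
    by apply/seteqP; split=> s /=; rewrite !in_itv /= mul1r subr_ge0 lerBlDr -natr1 addrC.
  apply: polygonal_eq; first exact: (@interval_is_interval _ `[n%:R, n.+1%:R]).
  by move=> s /=; rewrite in_itv /= mul1r => h; rewrite (chainE h).
move=> t /=; rewrite in_itv /= andbT => t0.
have /andP[nt tn] := truncn_itv t0; set n := Num.truncn t in nt tn *.
have nn : n%:R <= n.+1%:R :> R by rewrite ler_nat.
split=> [b _ tb|a]; last (rewrite /= in_itv /= andbT => a0 at_).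
  have t_in : `[n%:R, n.+1%:R]%classic t by rewrite /= in_itv /= nt ltW.
  have [/(_ (Num.min b n.+1%:R)) + _] := step n t t_in; case=> [||c /andP[tc cb] S].
  - rewrite /= in_itv /= le_min ge_min lexx orbT andbT nn.
    by rewrite (le_trans nt (ltW tb)).
  - by rewrite lt_min tb.
  - by exists c => //; rewrite tc /=; move: cb; rewrite le_min => /andP[].
(* To the left of an integer [t] it is the preceding piece that counts, whereas the integer part of
   [t] names the following one. *)
have [m [mt tm]] : exists m : nat, m%:R < t /\ t <= m.+1%:R.
  move: nt; rewrite le_eqVlt => /orP[/eqP E|nt]; last by exists n; rewrite nt ltW.
  case: n E {tn nn} => [|m] E; first by move: (le_lt_trans a0 at_); rewrite -E ltxx.
  by exists m; rewrite -E lexx ltr_nat.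
have t_in : `[m%:R, m.+1%:R]%classic t by rewrite /= in_itv /= tm ltW.
have [_ /(_ (Num.max a m%:R))] := step m t t_in; case=> [||c /andP[ac ct] S].
- by rewrite /= in_itv /= ge_max le_max lexx orbT (le_trans (ltW at_) tm) ler_nat leqnSn.
- by rewrite gt_max at_.
- by exists c => //; rewrite ct andbT; move: ac; rewrite ge_max => /andP[].
Qed.

Lemma future_ray_chain :
  (forall q : N, exists2 W, nbhs q W & forall n, exists2 m, (n <= m)%N & ~ W (p m)) ->
  future_ray X (p 0%N) `[0, +oo[%classic chain.
Proof.
move=> H; have chn n : chain n%:R = p n by rewrite (@chainE n) ?subrr // lexx ler_nat leqnSn.
split=> //.
- exact: (@interval_is_interval _ `[0, +oo[).
- by rewrite /= in_itv /= lexx.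
- by move=> s /=; rewrite in_itv /= andbT.
- exact: polygonal_chain.
- exact: (chn 0%N).
- move=> q; have [W nW HW] := H q; exists W => // t0 /=; rewrite in_itv /= andbT => t00.
  have [m nm Wm] := HW (Num.truncn t0).+1; exists m%:R; split.
  + by rewrite /= in_itv /= ler0n.
  + have /andP[_ /ltW h] := truncn_itv t00; apply: le_trans h _.
    by rewrite ler_nat.
  + by rewrite chn.
Qed.

End Sequence.

Section CauchyRays.
Variables (X : chart R N d.+1 -> N -> 'rV[R]_d.+1) (Sigma : set N).
Hypotheses (HX : time_orientation g X) (HS : cauchy_hypersurface g Sigma).

(** The rays join at [p] to one inextendible timelike curve. The existence of its intersection with
    [Sigma] refutes a ray avoiding [Sigma]; uniqueness along the second ray gives achronality. *)
Lemma cauchy_rays p I1 gam1 I2 gam2 :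
  past_ray X p I1 gam1 -> future_ray X p I2 gam2 ->
  (exists s : R, (I1 s /\ Sigma (gam1 s)) \/ (I2 s /\ Sigma (gam2 s))) /\
  (forall s t : R, I2 s -> I2 t -> Sigma (gam2 s) -> Sigma (gam2 t) -> s = t).
Proof.
move=> [i1 I10 le1 [a I1a a0] P1 g1 e1] [i2 I20 le2 P2 g2 e2].
have := polygonal_concat i1 i2 I10 I20 le1 le2 (etrans g1 (esym g2)) P1 P2.
set I := _ `|` _; move=> [gam [iI PI E1 E2]].
have tl : timelike_curve g I gam.
  by apply: (polygonal_timelike HX) => //; exists a, 0; split=> //; left.
have inx : inextendible I gam.
  apply/inextendibleP; split=> q.
    have [W nW HW] := e2 q; exists W => // t0 It0.
    have [t1 I2t1 t01] : exists2 t1, I2 t1 & t0 <= t1.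
      by case: It0 => [/le1 t00|?]; [exists 0|exists t0].
    have [t [It tt nWt]] := HW _ I2t1; exists t; split; first by right.
      exact: le_trans tt.
    by rewrite E2.
  have [W nW HW] := e1 q; exists W => // t0 It0.
  have [t1 I1t1 t01] : exists2 t1, I1 t1 & t1 <= t0.
    by case: It0 => [?|/le2 t00]; [exists t0|exists 0].
  have [t [It tt nWt]] := HW _ I1t1; exists t; split; first by left.
    exact: le_trans t01.
  by rewrite E1.
have [t [[It St] U]] := HS.2 I gam tl inx; split.
  exists t; case: It => h; [left|right]; split=> //; first by rewrite -E1.
  by rewrite -E2.
move=> s u I2s I2u Ss Su; rewrite -(U s) ?(U u) //; split; rewrite ?E2 //; by right.
Qed.

End CauchyRays.

End Rays.

(** * Flow lines and Cauchy hypersurfaces *)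

Section FlowCharts.
Variables (R : realType) (N : topologicalType) (d : nat).
Variables (M : smooth_manifold R N d.+1) (g : lorentz_metric M).
Variables (X : chart R N d.+1 -> N -> 'rV[R]_d.+1).
Hypothesis HX : time_orientation g X.
Implicit Types (phi psi : chart R N d.+1) (I J : set R) (gam : R -> N).

Definition chart_base psi : set 'rV[R]_d := @spatial R d @` ccod psi.

(** As no interval over the base is empty, the base in the definition of a regular flow chart must
    be the projection of the coordinate domain. *)
Lemma regular_lines psi : regular_flow_chart g psi ->
  exists I : 'rV[R]_d -> set R,
  [/\ forall x, chart_base psi x -> open (I x) /\ is_interval (I x),
      forall y, ccod psi y <-> chart_base psi (spatial y) /\
        I (spatial y) (y ord0 ord0),
      (euclid_diam (chart_base psi) < +oo)%E &
      forall x, chart_base psi x ->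
        inextendible (I x) (fun s => cinv psi (coords s x))].
Proof.
move=> [_ _ [B [I [BI cE dB inx]]]].
have BE : chart_base psi = B.
  apply/seteqP; split=> [_ [y + <-]|x Bx].
    by rewrite cE => -[z [Bz _] <-]; rewrite spatial_coords.
  have [[s Is] _ _] := BI _ Bx; exists (coords s x); last exact: spatial_coords.
  by rewrite cE; exists (s, x).
exists I; rewrite BE; split=> // [x /BI[]//|y]; rewrite cE; split.
  by move=> [z [Bz Iz] <-]; rewrite spatial_coords coords_ord0.
by move=> [By Iy]; exists (y ord0 ord0, spatial y) => //=; exact: coords_spatial.
Qed.

Lemma continuous_metric phi p : atlas M phi -> cdom phi p ->
  {for p, continuous (metric_comp g phi)}.
Proof.
move=> aphi pd; have [od _ _ _ _] := atlas_chart aphi.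
have := @metric_continuous _ _ _ _ g phi aphi; rewrite continuous_open_subspace //.
by move=> /(_ p); apply; rewrite inE.
Qed.

Lemma continuous_time_orientation phi p : atlas M phi -> cdom phi p ->
  {for p, continuous (X phi)}.
Proof.
move=> aphi pd; have [od _ _ _ _] := atlas_chart aphi.
have [_ /(_ phi aphi) + _] := HX; rewrite continuous_open_subspace //.
by move=> /(_ p); apply; rewrite inE.
Qed.

Lemma cvg_qform (T : Type) (F : set_system T) {FF : Filter F}
    (G : T -> 'M[R]_d.+1) (u v : T -> 'rV[R]_d.+1) G0 u0 v0 :
  G @ F --> G0 -> u @ F --> u0 -> v @ F --> v0 ->
  (fun t => qform (G t) (u t) (v t)) @ F --> qform G0 u0 v0.
Proof.
move=> cG cu cv; under eq_fun do rewrite qformE; rewrite qformE.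
apply: cvg_sumr => i; apply: cvg_sumr => j; apply: cvgM.
  exact: (cvg_comp _ _ cG (@coord_continuous _ _ _ i j _)).
apply: cvgM.
  exact: (cvg_comp _ _ cu (@coord_continuous _ _ _ ord0 i _)).
exact: (cvg_comp _ _ cv (@coord_continuous _ _ _ ord0 j _)).
Qed.

Lemma qform_e0 (G : 'M[R]_d.+1) : qform G (coords 1 0) (coords 1 0) = G ord0 ord0.
Proof.
rewrite qformE (bigD1 ord0) //= [X in X + _](bigD1 ord0) //=.
rewrite coords_ord0 !mulr1 !big1 ?addr0 // => i; rewrite eq_sym => /unlift_some [j -> _].
  by apply: big1 => k _; rewrite coords_lift mxE mul0r mulr0.
by rewrite coords_lift mxE !mulr0.
Qed.

Lemma flow_timelike psi p : regular_flow_chart g psi -> cdom psi p ->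
  timelike g psi p (coords 1 0).
Proof.
move=> [_ [C [c [c0 H]]] _] pd; rewrite /timelike qform_e0.
exact: le_lt_trans (H _ pd).2 c0.
Qed.

(** A coordinate line of the chart, run in the direction prescribed by [X] and shifted so that [p]
    is at parameter 0. [flow_line_full] makes it the whole fibre over its base point. *)
Record flow_line psi p I gam : Prop := FlowLine {
  flow_line_itv : is_interval I;
  flow_line_open : open I;
  flow_line0 : I 0;
  flow_line_start : gam 0 = p;
  flow_line_poly : polygonal g X I gam;
  flow_line_inext : inextendible I gam;
  flow_line_dom : forall s, I s -> cdom psi (gam s) /\
    spatial (cmap psi (gam s)) = spatial (cmap psi p);
  flow_line_full : forall q, cdom psi q ->
    spatial (cmap psi q) = spatial (cmap psi p) -> exists2 s, I s & gam s = q }.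

Lemma flow_line_exists psi p : regular_flow_chart g psi -> cdom psi p ->
  exists I gam, flow_line psi p I gam.
Proof.
move=> rpsi pd; have apsi := flow_chart_atlas rpsi.
have cpsi := atlas_chart apsi; have [od oc cK _ _] := cpsi.
have [I [BI cE _ inx]] := regular_lines rpsi.
set y := cmap psi p; set x := spatial y; set s0 := y ord0 ord0.
have [Bx Is0] : chart_base psi x /\ I x s0 by apply/cE; exact: ccod_cmap.
have [oI iI] := BI _ Bx.
have ycod u : I x u -> ccod psi (coords u x).
  by move=> Iu; apply/cE; rewrite spatial_coords coords_ord0.
pose line u := cinv psi (coords u x).
pose q u := qform (metric_comp g psi (line u)) (X psi (line u)) (coords 1 0).
have ld u : I x u -> cdom psi (line u) by move=> /ycod; exact: cdom_cinv.
have q0 u : I x u -> q u != 0.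
  move=> Iu; apply: lorentz_neq0.
  - exact: (metric_sign g apsi (ld _ Iu)).
  - by have [_ _] := HX; apply=> //; exact: ld.
  - exact: flow_timelike (ld _ Iu).
have cq u : I x u -> {for u, continuous q}.
  move=> Iu; have cl : {for u, continuous line}.
    have cc : (fun u => coords u x) @ u --> coords u x.
      by apply: (cvg_coords _ (cvg_cst x)); exact: cvg_id.
    exact: (cvg_comp _ _ cc (continuous_cinv cpsi (ycod _ Iu))).
  apply: cvg_qform; last exact: cvg_cst.
    exact: (cvg_comp _ _ cl (continuous_metric apsi (ld _ Iu))).
  exact: (cvg_comp _ _ cl (continuous_time_orientation apsi (ld _ Iu))).
(* The product of [X] with the flow direction never vanishes, so by the intermediate value theorem
   its sign is constant along the line. *)
have sgn u v : I x u -> I x v -> 0 < q u -> 0 < q v.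
  move=> Iu Iv qu; rewrite lt_neqAle eq_sym q0 //= leNgt; apply/negP => qv.
  have sub w : Num.min u v <= w <= Num.max u v -> I x w.
    case: (leP u v) => uv; [exact: iI|exact: iI].
  have cqs : {within `[Num.min u v, Num.max u v], continuous q}.
    apply: continuous_in_subspaceT => w; rewrite inE /= in_itv /= => /sub.
    exact: cq.
  have [||w] := @IVT R q (Num.min u v) (Num.max u v) 0 _ cqs.
  - by rewrite ge_min le_max lexx.
  - by case: (leP u v) => _; rewrite ge_min le_max (ltW qu) (ltW qv) !orbT.
  - by rewrite in_itv /= => /sub /q0 /eqP.
(* Reverses the line if its coordinate direction points to the wrong side of [X]. Being its own
   inverse, [sg] serves both directions of the reparametrization. *)
pose sg : R := if 0 < q s0 then 1 else -1.
have sg2 : sg * sg = 1 by rewrite /sg; case: ifP; rewrite ?mulr1 // mulrNN mulr1.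
have sgq u : I x u -> 0 < sg * q u.
  move=> Iu; rewrite /sg; case: ifPn => [h|]; first by rewrite mul1r; exact: sgn h.
  rewrite mulN1r oppr_gt0 -leNgt le_eqVlt (negbTE (q0 _ Is0)) /= => h.
  rewrite lt_neqAle q0 //= leNgt; apply/negP => /(sgn _ _ Iu Is0).
  by rewrite ltNge ltW.
have E u : coords s0 x + u *: (sg *: coords 1 0) = coords (s0 + u * sg) x.
  by rewrite scalerA -coordsZ -coordsD mulr1 scaler0 addr0.
pose gam u := line (s0 + u * sg).
pose I' := [set u | I x (s0 + u * sg)].
have Kinv u : s0 + (u - s0) * sg * sg = u.
  by rewrite -mulrA sg2 mulr1 addrC subrK.
have sgE : sg = 1 \/ sg = -1 by rewrite /sg; case: ifP => _; [left|right].
have iI' : is_interval I'.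
  move=> a b Ia Ib c /andP[ac cb]; rewrite /I' /= in Ia Ib *.
  case: sgE => sgE; rewrite sgE ?(mulr1, mulrN1) in Ia Ib *.
    by apply: (iI _ _ Ia Ib); rewrite !lerD2l ac.
  by apply: (iI _ _ Ib Ia); rewrite !lerD2l !lerN2 ac cb.
have S a b : I' a -> I' b -> straight g X a b gam.
  move=> Ia Ib; exists psi, (coords s0 x), (sg *: coords 1 0); split=> // s sab.
  have Is : I' s by apply: (iI' a b).
  rewrite E; split=> //; first exact: ycod.
  split; last by rewrite qformZr; exact: sgq.
  have := flow_timelike rpsi (ld _ Is).
  by rewrite /timelike qformZl qformZr mulrA sg2 mul1r.
have [/escapes_rightP eR /escapes_leftP eL] := inx _ Bx.
exists I', gam; split=> //.
- apply: open_comp oI => u _; apply: cvgD; first exact: cvg_cst.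
  by apply: cvgM; [exact: cvg_id|exact: cvg_cst].
- by rewrite /I' /= mul0r addr0.
- by rewrite /gam /line mul0r addr0 coords_spatial cK.
- move=> t It; split=> [b Ib tb|a Ia at_].
    by exists b; [rewrite tb lexx|exact: S].
  by exists a; [rewrite at_ lexx|exact: S].
- apply/inextendibleP; rewrite /escapes_right /escapes_left.
  rewrite /I' /gam; case: sgE => sgE; rewrite sgE in Kinv *; split=> r.
  + have [W nW HW] := eR r; exists W => // t0 /= It0.
    have [u [Iu tu nWu]] := HW _ It0; exists ((u - s0) * 1).
    by rewrite Kinv; split=> //; move: tu; lra.
  + have [W nW HW] := eL r; exists W => // t0 /= It0.
    have [u [Iu tu nWu]] := HW _ It0; exists ((u - s0) * 1).
    by rewrite Kinv; split=> //; move: tu; lra.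
  + have [W nW HW] := eL r; exists W => // t0 /= It0.
    have [u [Iu tu nWu]] := HW _ It0; exists ((u - s0) * -1).
    by rewrite Kinv; split=> //; move: tu; lra.
  + have [W nW HW] := eR r; exists W => // t0 /= It0.
    have [u [Iu tu nWu]] := HW _ It0; exists ((u - s0) * -1).
    by rewrite Kinv; split=> //; move: tu; lra.
- move=> s Is; split; first exact: ld.
  by rewrite /gam /line cinvK ?spatial_coords //; exact: ycod.
- move=> r rd rx; set v := cmap psi r ord0 ord0; exists ((v - s0) * sg).
    rewrite /I' /= Kinv.
    by have /cE [_] := ccod_cmap rd; rewrite rx.
  by rewrite /gam Kinv /line /x -rx coords_spatial cK.
Qed.

Lemma flow_past_ray psi p I gam : flow_line psi p I gam ->
  past_ray g X p (I `&` [set s | s <= 0]) gam.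
Proof.
case=> iI oI I0 g0 P /inextendibleP[_ eL] _ _; split=> //.
- move=> a b [Ia a0] [Ib b0] c acb; split; first exact: (iI a b).
  by case/andP: acb => _ cb; exact: le_trans b0.
- by split; rewrite //= lexx.
- by move=> s [].
- have /nbhs_ballP[e /= e0 eI] : nbhs (0 : R) I by exact: open_nbhs_nbhs.
  exists (- (e / 2)); last by rewrite oppr_lt0 divr_gt0.
  split; last by rewrite /= oppr_le0 divr_ge0 // ltW.
  apply: eI; rewrite /ball /= sub0r opprK ger0_norm ?divr_ge0 ?(ltW e0) //.
  by rewrite ltr_pdivrMr // ltr_pMr // ltr1n.
- by apply: polygonal_sub P => s [].
- move=> r; have [W nW HW] := eL r; exists W => // t0 [It0 t00].
  have [t [It tt nWt]] := HW _ It0; exists t; split=> //; split=> //.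
  exact: le_trans t00.
Qed.

Lemma flow_future_ray psi p I gam : flow_line psi p I gam ->
  future_ray g X p (I `&` [set s | 0 <= s]) gam.
Proof.
case=> iI oI I0 g0 P /inextendibleP[eR _] _ _; split=> //.
- move=> a b [Ia a0] [Ib b0] c acb; split; first exact: (iI a b).
  by case/andP: acb => ac _; exact: le_trans ac.
- by split; rewrite //= lexx.
- by move=> s [].
- by apply: polygonal_sub P => s [].
- move=> r; have [W nW HW] := eR r; exists W => // t0 [It0 t00].
  have [t [It tt nWt]] := HW _ It0; exists t; split=> //; split=> //.
  exact: le_trans tt.
Qed.

Section Cauchy.
Variable Sigma : set N.
Hypothesis HS : cauchy_hypersurface g Sigma.

(** The three positions of [p] relative to [h] are the signs of the hitting parameter. [h] is the
    only point of [Sigma] in its fibre because the flow line fills the fibre. *)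
Lemma flow_line_hit psi p : regular_flow_chart g psi -> cdom psi p ->
  exists h, [/\ Sigma h, cdom psi h,
    spatial (cmap psi h) = spatial (cmap psi p),
    p = h \/ reach g X p h \/ reach g X h p &
    forall h', Sigma h' -> cdom psi h' ->
      spatial (cmap psi h') = spatial (cmap psi p) -> h' = h].
Proof.
move=> rpsi pd; have [I [gam [iI oI I0 g0 P inx Id full]]] := flow_line_exists rpsi pd.
have tl : timelike_curve g I gam.
  apply: (polygonal_timelike HX) => //.
  have /nbhs_ballP[e /= e0 eI] : nbhs (0 : R) I by exact: open_nbhs_nbhs.
  exists 0, (e / 2); split=> //; last by rewrite divr_gt0.
  apply: eI; rewrite /ball /= sub0r normrN ger0_norm ?divr_ge0 ?(ltW e0) //.
  by rewrite ltr_pdivrMr // ltr_pMr // ltr1n.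
have [t [[It St] U]] := HS.2 I gam tl inx.
have [td tx] := Id _ It; exists (gam t); split=> //; last first.
  move=> h' Sh' h'd h'x; have [s Is gs] := full _ h'd h'x.
  by rewrite -gs (U s) // gs.
have [t0|t0|<-] := ltgtP 0 t; last by left.
  by right; left; rewrite -g0; exact: reach_sub P I0 It t0.
by right; right; rewrite -g0; exact: reach_sub P It I0 t0.
Qed.

End Cauchy.

Section Cover.
Variables (K : nat) (psi : 'I_K -> chart R N d.+1).
Hypotheses (psi_regular : forall k, regular_flow_chart g (psi k))
  (psi_cover : \bigcup_(k in [set: 'I_K]) cdom (psi k) = [set: N]).
Variable Sigma : set N.
Hypothesis HS : cauchy_hypersurface g Sigma.

Lemma covering_chart p : exists k, cdom (psi k) p.
Proof.
by have : [set: N] p by []; rewrite -psi_cover => -[k _ pk]; exists k.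
Qed.

Lemma past_ray_exists p : exists I gam, past_ray g X p I gam.
Proof.
have [k pk] := covering_chart p.
have [I [gam F]] := flow_line_exists (psi_regular k) pk.
by eexists; eexists; exact: flow_past_ray F.
Qed.

Lemma future_ray_exists p : exists I gam, future_ray g X p I gam.
Proof.
have [k pk] := covering_chart p.
have [I [gam F]] := flow_line_exists (psi_regular k) pk.
by eexists; eexists; exact: flow_future_ray F.
Qed.

(** With a past ray at [p] and a future ray at [q], both taken from flow lines, the curve becomes
    inextendible and meets [Sigma] at the parameters 0 and 1. *)
Lemma achronal p q : reach g X p q -> Sigma p -> Sigma q -> False.
Proof.
move=> [gam [P g0 g1]] Sp Sq.
have [I1 [gam1 pr]] := past_ray_exists p.
have [J [gam' fr]] := future_ray_exists q.
have [I2 [gam2 [fr2 I21 E g21]]] := future_ray_reach P g0 g1 fr.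
have [_ U] := cauchy_rays HX HS pr fr2.
have := U 0 1 (future_ray0 fr2) I21.
rewrite g21 (future_ray_start fr2) => /(_ Sp Sq) /esym/eqP.
by rewrite oner_eq0.
Qed.

End Cover.

End FlowCharts.

(** * Connectedness of Cauchy hypersurfaces *)

Section ChartGraph.
Variables (R : realType) (N : topologicalType) (d : nat).
Variables (M : smooth_manifold R N d.+1) (g : lorentz_metric M).
Variables (K : nat) (psi : 'I_K -> chart R N d.+1).
Hypotheses (psi_regular : forall k, regular_flow_chart g (psi k))
  (psi_cover : \bigcup_(k in [set: 'I_K]) cdom (psi k) = [set: N]).
Implicit Types (X : chart R N d.+1 -> N -> 'rV[R]_d.+1).

Lemma open_cdom k : open (cdom (psi k)).
Proof. by have [] := atlas_chart (flow_chart_atlas (psi_regular k)). Qed.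

(** The image of a closed coordinate ball is compact, hence closed in all of the Hausdorff space [N]
    and not merely in the chart. *)
Lemma closed_nbhs_cdom k p : cdom (psi k) p ->
  exists2 W, nbhs p W & closed W /\ W `<=` cdom (psi k).
Proof.
move=> pd; have cpsi := atlas_chart (flow_chart_atlas (psi_regular k)).
have [od oc cK _ ci] := cpsi.
set y := cmap (psi k) p.
have /nbhs_ballP[r /= r0 rc] : nbhs y (ccod (psi k)).
  by apply: open_nbhs_nbhs; split=> //; exact: ccod_cmap.
pose C := closed_ball_ (fun z : 'rV[R]_d.+1 => `|z|) y (r / 2).
have Cc : C `<=` ccod (psi k).
  move=> z yz; apply: rc; rewrite mx_norm_ball /ball_ /=.
  by apply: le_lt_trans yz _; rewrite ltr_pdivrMr // ltr_pMr // ltr1n.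
exists (cinv (psi k) @` C); last split.
- have nC : nbhs (cmap (psi k) p) C.
    apply/nbhs_ballP; exists (r / 2); first by rewrite /= divr_gt0.
    by move=> z; rewrite mx_norm_ball /ball_ /= => /ltW.
  have nC' : nbhs p (cmap (psi k) @^-1` C) := continuous_cmap cpsi pd nC.
  have nd : nbhs p (cdom (psi k)) by exact: open_nbhs_nbhs.
  apply: filterS2 nC' nd => q Cq dq; exists (cmap (psi k) q) => //; exact: cK.
- apply: compact_closed; first exact: (manifold_hausdorff M).
  apply: continuous_compact; first exact: continuous_subspaceW ci.
  apply: bounded_closed_compact; last exact: closed_closed_ball_.
  exists (`|y| + r / 2); split; first exact: num_real.
  move=> x /ltW xr z /= yz; apply: le_trans xr; rewrite -[z](subrKC y).
  by apply: le_trans (ler_normD _ _) _; rewrite lerD2l distrC.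
- by move=> _ [z /Cc zc <-]; exact: cdom_cinv.
Unshelve. all: by end_near. Qed.

Lemma closed_cover_sequence : (exists p : N, True) ->
  exists W : nat -> set N,
    (forall n, closed (W n) /\ exists k, W n `<=` cdom (psi k)) /\
    forall p : N, exists n, nbhs p (W n).
Proof.
case=> p0 _; have [k0 _] := covering_chart psi_cover p0.
have [B /countable_injP[f finj] [oB bB]] := manifold_second_countable M.
pose good (b : set N) := B b /\ exists k, closure b `<=` cdom (psi k).
have step n : exists W : set N, (closed W /\ exists k, W `<=` cdom (psi k)) /\
    forall b, good b -> f b = n -> b `<=` W.
  have [[b [[Bb [k bk]] fb]]|nb] := pselect (exists b, good b /\ f b = n).
    exists (closure b); split; first by split; [exact: closed_closure|exists k].
    move=> b' [Bb' _] fb'.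
    have -> : b' = b by apply: finj; rewrite ?inE // fb fb'.
    exact: subset_closure.
  exists set0; split; first by split; [exact: closed0|exists k0 => ?].
  by move=> b gb fb; case: nb; exists b.
have [W HW] := choice step; exists W; split=> [n|p]; first exact: (HW n).1.
have [k pk] := covering_chart psi_cover p.
have [C nC [cC Ck]] := closed_nbhs_cdom pk.
have [b [Bb bp] /= bC] := bB p _ nC.
have gb : good b.
  split=> //; exists k; apply: subset_trans Ck.
  by rewrite (closure_id C).1 //; exact: closureS.
exists (f b); apply: filterS ((HW (f b)).2 b gb erefl) _.
by apply: open_nbhs_nbhs; split=> //; exact: oB.
Qed.

(** * Two classes of charts without a common point on Sigma *)

Section TwoClasses.
Variables (X : chart R N d.+1 -> N -> 'rV[R]_d.+1) (Sigma : set N).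
Hypotheses (HX : time_orientation g X) (HS : cauchy_hypersurface g Sigma).

Definition separated (a : 'I_K -> bool) := forall i j p,
  Sigma p -> cdom (psi i) p -> cdom (psi j) p -> a i = a j.

Definition in_class (a : 'I_K -> bool) p :=
  Sigma p /\ exists2 i, a i & cdom (psi i) p.

(** The set Q of the overview. *)
Definition above_both a p :=
  (exists2 h, in_class a h & reach g X p h) /\
  (exists2 h, in_class (fun i => ~~ a i) h & reach g X p h).

Lemma separatedN a : separated a -> separated (fun i => ~~ a i).
Proof. by move=> H i j p Sp pi pj; congr (~~ _); exact: H Sp pi pj. Qed.

Lemma above_bothN a p : above_both (fun i => ~~ a i) p <-> above_both a p.
Proof.
have E : (fun i => ~~ ~~ a i) = a by apply/funext => i; rewrite negbK.
by rewrite /above_both E; split=> -[].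
Qed.

(* The flow line through a point of the curve hits Sigma in a point of the first
   class, and it does so below: otherwise Sigma would be hit again at b. *)
Lemma above_both_along a gam b k t : separated a ->
  polygonal g X `[0, 1]%classic gam -> gam 1 = b ->
  in_class (fun i => ~~ a i) b -> a k -> 0 <= t <= 1 -> cdom (psi k) (gam t) ->
  above_both a (gam t).
Proof.
move=> sa P g1 [Sb [i ai bi]] ak /andP[t0 t1] td.
have tlt1 : t < 1.
  rewrite lt_neqAle t1 andbT; apply/eqP => tE; move: td; rewrite tE g1 => bk.
  by move: ai; rewrite (sa i k b Sb bi bk) ak.
have rb : reach g X (gam t) b.
  rewrite -g1; apply: (reach_sub _ P) tlt1.
  - exact: (@interval_is_interval _ `[0, 1]).
  - by rewrite /= in_itv /= t0 t1.
  - by rewrite /= in_itv /= ler01 lexx.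
have [h [Sh hd _ hE _]] := flow_line_hit HX HS (psi_regular k) td.
have ach q : Sigma q -> reach g X q b -> False.
  by move=> Sq qb; exact: (achronal HX psi_regular psi_cover HS qb).
split; last by exists b => //; split=> //; exists i.
case: hE => [E|[rh|rh]].
- by case: (ach (gam t)) => //; rewrite E.
- by exists h => //; split=> //; exists k.
- by case: (ach h) => //; exact: reach_trans rb.
Qed.

(** The curve [beta] descends to a point of the other class. It must leave [W], since no chart of
    class [a] contains its end point; it is followed until just after it first does so, while still
    in the chart. *)
Lemma escape_closed_aux a p W k : separated a -> above_both a p ->
  closed W -> W `<=` cdom (psi k) -> (W p -> a k) ->
  (~ W p -> exists2 j, a j & cdom (psi j) p) ->
  exists gq : (R -> N) * N, [/\ polygonal g X `[0, 1]%classic gq.1, gq.1 0 = p,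
    gq.1 1 = gq.2, forall s, 0 <= s <= 1 -> above_both a (gq.1 s) & ~ W gq.2].
Proof.
move=> sa [_ [b Bb [beta [P b0 b1]]]] cW Wk Wa nWa.
have bi := @interval_is_interval _ `[(0 : R), 1].
(* By [above_both_along], it suffices that an initial piece of [beta] lies in a single chart of
   class [a] and ends outside [W]. *)
suff [t [j [/andP[t0 t1] aj bj nWt]]] : exists t j, [/\ 0 < t <= 1, a j,
    forall s, 0 <= s <= t -> cdom (psi j) (beta s) & ~ W (beta t)].
  exists (fun u => beta (t * u + 0), beta t); split=> //=.
  - apply: polygonal_sub (polygonal_affine (t0 := 0) t0 P) => u /=.
    rewrite !in_itv /= addr0 => /andP[u0 u1].
    by rewrite mulr_ge0 ?(ltW t0) //= mulr_ile1 // ltW.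
  - by rewrite mulr0 addr0.
  - by rewrite mulr1 addr0.
  - move=> s /andP[s0 s1]; rewrite addr0.
    have ts0 : 0 <= t * s by rewrite mulr_ge0 // ltW.
    have tst : t * s <= t by rewrite ler_piMr // ltW.
    apply: (above_both_along sa P b1 Bb aj); first by rewrite ts0 (le_trans tst).
    by apply: bj; rewrite ts0.
have in01 s : 0 <= s <= 1 -> `[(0 : R), 1]%classic s by rewrite /= in_itv.
(* Outside [W] a short step is taken all the same, since a constant curve is not polygonal. *)
have [Wp|nWp] := pselect (W p); last first.
  have [j aj pj] := nWa nWp.
  have nb : nbhs (beta 0) (cdom (psi j) `&` ~` W).
    rewrite b0; apply: open_nbhs_nbhs; split=> //.
    by apply: openI; [exact: open_cdom|exact: closed_openC].
  have [|e e0 He] := polygonal_continuous P _ nb.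
    by apply: in01; rewrite lexx ler01.
  have m0 : 0 < Num.min (e / 2) 1 by rewrite lt_min ltr01 divr_gt0.
  have me : Num.min (e / 2) 1 < e.
    by rewrite gt_min ltr_pdivrMr // ltr_pMr // ltr1n.
  have m1 : Num.min (e / 2) 1 <= 1 by rewrite ge_min lexx orbT.
  exists (Num.min (e / 2) 1), j; split=> //; first by rewrite m0.
    move=> s /andP[s0 sm]; apply: (He s _ _).1; first by apply: in01; rewrite s0 (le_trans sm).
    by rewrite subr0 ger0_norm // (le_lt_trans sm).
  apply: (He _ _ _).2; first by apply: in01; rewrite (ltW m0).
  by rewrite subr0 gtr0_norm.
have ak := Wa Wp.
(* [tau] is the last parameter up to which [beta] stays in [W]; closedness of [W] puts [beta tau] in
   [W], hence in the open chart domain. *)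
pose E := [set t : R | 0 <= t <= 1 /\ forall s, 0 <= s <= t -> W (beta s)].
have E0 : E 0.
  split; first by rewrite lexx ler01.
  by move=> s s0; have -> : s = 0 by [apply/le_anti; rewrite andbC|]; rewrite b0.
have supE : has_sup E by split; [exists 0|exists 1 => t [/andP[]]].
set tau := sup E.
have tau0 : 0 <= tau by apply: sup_upper_bound.
have tau1 : tau <= 1 by apply: ge_sup => [|t [/andP[]]//]; exists 0.
have Wlt s : 0 <= s < tau -> W (beta s).
  move=> /andP[s0 st]; have ts : 0 < tau - s by rewrite subr_gt0.
  have [t [_ tE] lt] := sup_adherent ts supE.
  by apply: tE; rewrite s0 /=; move: lt; rewrite -/tau subKr; exact: ltW.
have Wtau : W (beta tau).
  apply: contrapT => nWt; have tin : `[(0 : R), 1]%classic tau by apply: in01; rewrite tau0.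
  have nb : nbhs (beta tau) (~` W).
    by apply: open_nbhs_nbhs; split=> //; exact: closed_openC.
  have [e e0 He] := polygonal_continuous P tin nb.
  have [tau00|taup] := leP tau 0.
    by apply: nWt; have -> : tau = 0 by [apply/le_anti; rewrite tau00|]; rewrite b0.
  have sp : 0 < Num.min (e / 2) (tau / 2) by rewrite lt_min !divr_gt0.
  pose s := tau - Num.min (e / 2) (tau / 2).
  have s0 : 0 <= s.
    rewrite subr_ge0 ge_min; apply/orP; right.
    by rewrite ler_pdivrMr // ler_pMr // ler1n.
  have st : s < tau by rewrite gtrBl.
  have /(_ _) := He s; rewrite /= => /(_ (in01 _ _)); apply.
  - by rewrite s0 (le_trans (ltW st)).
  - rewrite distrC opprB addrC subrK gtr0_norm // gt_min; apply/orP; left.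
    by rewrite ltr_pdivrMr // ltr_pMr // ltr1n.
  - by apply: Wlt; rewrite s0.
have ktau := Wk _ Wtau.
have taul : tau < 1.
  rewrite lt_neqAle tau1 andbT; apply/eqP => E1; move: ktau; rewrite E1 b1 => bk.
  have [Sb [i ai bi']] := Bb.
  by move: ai; rewrite (sa i k b Sb bi' bk) ak.
have tin : `[(0 : R), 1]%classic tau by apply: in01; rewrite tau0.
have nb : nbhs (beta tau) (cdom (psi k)).
  by apply: open_nbhs_nbhs; split=> //; exact: open_cdom.
have [e e0 He] := polygonal_continuous P tin nb.
pose m := Num.min (e / 2) (1 - tau).
have m0 : 0 < m by rewrite lt_min divr_gt0 // subr_gt0.
have me : m < e by rewrite gt_min ltr_pdivrMr // ltr_pMr // ltr1n.
have m1 : tau + m <= 1 by rewrite -lerBrDl ge_min lexx orbT.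
(* Points outside [W] occur arbitrarily soon after [tau], so one can be taken before [beta] leaves
   the chart. *)
have [t [tt tm nWt]] : exists t, [/\ tau < t, t <= tau + m & ~ W (beta t)].
  apply: contrapT => nt; have : E (tau + m).
    split; first by rewrite m1 addr_ge0 // ltW.
    move=> s /andP[s0 sm]; have [st|ts|->//] := ltgtP s tau.
      by apply: Wlt; rewrite s0.
    by apply: contrapT => nWs; apply: nt; exists s.
  move=> /(sup_upper_bound supE); rewrite -/tau gerDl leNgt m0 //.
exists t, k; split=> //.
  by rewrite (le_lt_trans tau0 tt) (le_trans tm m1).
move=> s /andP[s0 st]; have [stau|/ltW taus] := leP s tau.
  move: stau; rewrite le_eqVlt => /orP[/eqP -> //|stau].
  by apply/Wk/Wlt; rewrite s0.
apply: He; first by apply: in01; rewrite s0 (le_trans st) // (le_trans tm).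
rewrite ger0_norm ?subr_ge0 //; apply: le_lt_trans me.
by rewrite lerBlDl (le_trans st).
Qed.

(* While in one flow chart, a descending curve ending in the class opposite to
   that of the chart stays above both classes; but it must leave the chart. *)
Lemma escape_closed a p W : separated a -> above_both a p ->
  closed W -> (exists k, W `<=` cdom (psi k)) ->
  exists gq : (R -> N) * N, [/\ polygonal g X `[0, 1]%classic gq.1, gq.1 0 = p,
    gq.1 1 = gq.2, forall s, 0 <= s <= 1 -> above_both a (gq.1 s) & ~ W gq.2].
Proof.
move=> sa ap cW [k Wk].
(* The class followed is that of the chart around [W] if [p] lies in [W], and that of any chart at
   [p] otherwise; complementing [a] exchanges the classes. *)
pose k' := if pselect (W p) is left _ then k else
  sval (cid (covering_chart psi_cover p)).
have k'p : cdom (psi k') p.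
  by rewrite /k'; case: pselect => [Wp|_]; [exact: Wk|case: cid].
have kk' : W p -> k = k' by rewrite /k'; case: pselect.
case ak : (a k').
  apply: (escape_closed_aux sa ap cW Wk) => [/kk' ->//|_]; by exists k'.
have ap' := (above_bothN a p).2 ap.
have [||gq [P g0 g1 gs nW]] := escape_closed_aux (separatedN sa) ap' cW Wk.
- by move=> /kk' ->; rewrite ak.
- by move=> _; exists k'; rewrite ?ak.
by exists gq; split=> // s /gs /above_bothN.
Qed.

(** No point above both classes lies on [Sigma], by achronality, so the chain built inside this set
    avoids [Sigma]. Its limit is excluded because it leaves every [W i] infinitely often. *)
Lemma not_above_both a p : separated a -> ~ above_both a p.
Proof.
move=> sa ap; have [|W [HW Wp]] := closed_cover_sequence; first by exists p.
(* takes every value infinitely often *)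
pose e n := logn 2 n.+1.
have step (np : nat * N) : exists gq : (R -> N) * N, above_both a np.2 ->
    [/\ polygonal g X `[0, 1]%classic gq.1, gq.1 0 = np.2,
    gq.1 1 = gq.2, forall s, 0 <= s <= 1 -> above_both a (gq.1 s) & ~ W (e np.1) gq.2].
  have [anp|nanp] := pselect (above_both a np.2); last by exists (fun=> p, p).
  by have [gq H] := escape_closed sa anp (HW (e np.1)).1 (HW (e np.1)).2; exists gq.
have [F HF] := choice step.
pose q := fix q n := if n is n'.+1 then (F (n', q n')).2 else p.
have qa n : above_both a (q n).
  elim: n => //= n IH; have [_ _ <- + _] := HF (n, q n) IH; apply.
  by rewrite lexx ler01.
pose gam n := (F (n, q n)).1.
have Pg n : polygonal g X `[0, 1]%classic (gam n) by have [] := HF (n, q n) (qa n).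
have g0 n : gam n 0 = q n by have [] := HF (n, q n) (qa n).
have g1 n : gam n 1 = q n.+1 by have [] := HF (n, q n) (qa n).
have ga n s : 0 <= s <= 1 -> above_both a (gam n s).
  by have [_ _ _ + _] := HF (n, q n) (qa n); apply.
have nW n : ~ W (e n) (q n.+1) by have [] := HF (n, q n) (qa n).
have fr : future_ray g X p `[0, +oo[%classic (chain gam).
  apply: (future_ray_chain Pg g0 g1) => r; have [i Wi] := Wp r.
  (* The 2-adic valuation of 2^i (2n+1) is [i], so step [m] escapes from [W i], and m + 1 is at
     least n. *)
  exists (W i) => // n; pose m := (2 ^ i * n.*2.+1).-1.
  have mS : m.+1 = (2 ^ i * n.*2.+1)%N by rewrite /m prednK // muln_gt0 expn_gt0.
  have em : e m = i.
    rewrite /e mS lognM ?expn_gt0 // pfactorK // (@lognE 2 n.*2.+1) /=.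
    by rewrite dvdn2 /= odd_double addn0.
  exists m.+1; last by rewrite -em; exact: nW.
  rewrite mS -addnn; apply: leq_trans (leq_pmull _ (expn_gt0 2 i)).
  by rewrite ltnW // ltnS leq_addr.
have [I1 [gam1 pr]] := past_ray_exists HX psi_regular psi_cover p.
have [[s Hs] _] := cauchy_rays HX HS pr fr.
have [[h [Sh _] ph] _] := ap.
have ach r : Sigma r -> reach g X r h -> False.
  by move=> Sr rh; exact: (achronal HX psi_regular psi_cover HS rh).
(* Wherever the intersection lies, before or after [p], it reaches some point of [Sigma]. *)
case: Hs => -[Is Ss].
  have [s0|s0|s0] := ltgtP s 0.
  - apply: ach Ss _; apply: reach_trans ph; rewrite -(past_ray_start pr).
    exact: (reach_sub (past_ray_itv pr) (past_ray_poly pr) Is (past_ray0 pr)).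
  - by have := past_ray_le pr Is; rewrite leNgt s0.
  - by move: Ss; rewrite s0 (past_ray_start pr) => Sp; exact: ach ph.
have s0 := future_ray_ge fr Is; have /andP[ns sn] := truncn_itv s0.
have [|[h' [Sh' _] rh] _] := ga (Num.truncn s) (s - (Num.truncn s)%:R).
  by rewrite subr_ge0 ns /= lerBlDl natr1 ltW.
exact: (achronal HX psi_regular psi_cover HS rh).
Qed.

End TwoClasses.

Variables (X0 : chart R N d.+1 -> N -> 'rV[R]_d.+1) (Sigma : set N).
Hypotheses (HX0 : time_orientation g X0) (HS : cauchy_hypersurface g Sigma).
Hypothesis N_connected : connected [set: N].

(** Nonemptiness excludes charts that could be put into either class at will. If the classes
    differed, connectedness would give a point [p] in charts of both. *)
Lemma separated_classes a i j : separated Sigma a -> cdom (psi i) !=set0 ->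
  cdom (psi j) !=set0 -> a i = a j.
Proof.
move=> sa ni nj; apply: contrapT => aij.
wlog [ai aj] : i j ni nj aij / a i /\ ~~ a j.
  move=> H; case ai : (a i); case aj : (a j); rewrite ?ai ?aj // in aij.
    by apply: (H i j) => //; rewrite ai aj.
  by apply: (H j i) => //; rewrite ai aj.
pose U := \bigcup_(k in [set k | a k]) cdom (psi k).
pose V := \bigcup_(k in [set k | ~~ a k]) cdom (psi k).
have oU : open U by apply: bigcup_open => k _; exact: open_cdom.
have oV : open V by apply: bigcup_open => k _; exact: open_cdom.
have [p [[k ak pk] [l al pl]]] : exists p, U p /\ V p.
  apply: contrapT => nUV.
  have EU : U = ~` V.
    apply/seteqP; split=> [p Up Vp|p nVp]; first by apply: nUV; exists p.
    have [k pk] := covering_chart psi_cover p; case ak : (a k); first by exists k.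
    by case: nVp; exists k => //=; rewrite ak.
  have UT : U = [set: N].
    apply: N_connected.
    - by have [p pi] := ni; exists p, i.
    - by exists U => //; rewrite setTI.
    - by exists U; rewrite ?setTI // EU; exact: open_closedC.
  have [p pj] := nj; apply: nUV; exists p; split; first by rewrite UT.
  by exists j.
have [h [Sh hk _ hE _]] := flow_line_hit HX0 HS (psi_regular k) pk.
have [h' [Sh' hl _ hE' _]] := flow_line_hit HX0 HS (psi_regular l) pl.
have kl r : Sigma r -> cdom (psi k) r -> cdom (psi l) r -> False.
  by move=> Sr rk rl; move: al; rewrite /= -(sa k l r Sr rk rl) ak.
(* Hits on opposite sides of [p] are joined through [p] by a timelike curve, against achronality;
   hits both below put [p] above both classes. *)
case: hE => [E|[rh|rh]]; first by apply: (kl p) => //; rewrite E.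
  case: hE' => [E|[rh'|rh']]; first by apply: (kl p) => //; rewrite E.
    apply: (not_above_both HX0 HS sa (p := p)); split.
      by exists h => //; split=> //; exists k.
    by exists h' => //; split=> //; exists l.
  exact: (achronal HX0 psi_regular psi_cover HS (reach_trans rh' rh)).
case: hE' => [E|[rh'|rh']]; first by apply: (kl p) => //; rewrite E.
  exact: (achronal HX0 psi_regular psi_cover HS (reach_trans rh rh')).
(* Both hits are above [p]: the opposite time orientation turns them into hits below. *)
have rK : reversed (reversed X0) = X0.
  by apply/funext => phi; apply/funext => r; rewrite /reversed opprK.
apply: (not_above_both (time_orientation_reversed HX0) HS sa (p := p)); split.
  exists h; first by split=> //; exists k.
  by apply: reach_opp; rewrite rK.
exists h'; first by split=> //; exists l.
by apply: reach_opp; rewrite rK.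
Qed.

Definition chart_meet : rel 'I_K := fun i j =>
  `[< exists p, [/\ Sigma p, cdom (psi i) p & cdom (psi j) p] >].

(** The charts linked to [i] form a separated class containing [i], hence containing [j]. *)
Lemma chart_meet_connect i j : cdom (psi i) !=set0 -> cdom (psi j) !=set0 ->
  connect chart_meet i j.
Proof.
move=> ni nj; rewrite -(@separated_classes (connect chart_meet i) i j) //.
move=> k l p Sp pk pl; apply/idP/idP => c; apply: connect_trans c _;
  by apply: connect1; apply/asboolP; exists p.
Qed.

End ChartGraph.

(** * Lengths of curves *)

Section Integration.
Variable R : realType.
Local Notation mu := (@lebesgue_measure R).

(* The integrand of a curve length is not known to be measurable. *)
Lemma le_integral_nonmeasurable (D : set R) (f1 f2 : R -> \bar R) :
  (forall x, D x -> (0 <= f1 x)%E) -> (forall x, D x -> (f1 x <= f2 x)%E) ->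
  (\int[mu]_(x in D) f1 x <= \int[mu]_(x in D) f2 x)%E.
Proof.
move=> f10 f12; have f20 x : D x -> (0 <= f2 x)%E.
  by move=> Dx; exact: le_trans (f10 _ Dx) (f12 _ Dx).
rewrite !ge0_integralE //; apply: ge_ereal_sup => _ [h /= hf <-].
apply: ereal_sup_ubound; exists h => // x /=; apply: le_trans (hf x) _.
by rewrite /patch; case: ifPn => // /set_mem; exact: f12.
Qed.

(** As [f] may be nonmeasurable, its values on [S] cannot be discarded directly. It is first
    dominated everywhere by a measurable function, infinite on [S], from which the null set may then
    be removed. *)
Lemma le_integral_off_finite (S : set R) (f : R -> \bar R) (w : R -> R) :
  finite_set S -> measurable_fun [set: measurableTypeR R] w ->
  (forall x, (0 <= f x)%E) -> (forall x, 0 <= w x) ->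
  (forall x, 0 <= x <= 1 -> ~ S x -> (f x <= (w x)%:E)%E) ->
  (\int[mu]_(x in `[0%R, 1%R]%classic) f x <=
   \int[mu]_(x in `[0%R, 1%R]%classic) (w x)%:E)%E.
Proof.
move=> fS mw f0 w0 fw.
have mS : measurable (S : set (measurableTypeR R)).
  by apply: countable_measurable => //; exact: finite_set_countable.
have S0 : mu S = 0%E by apply: countable_lebesgue_measure0; exact: finite_set_countable.
pose f2 x := if x \in S then +oo%E else (w x)%:E.
have mI : measurable (`[0%R, 1%R]%classic : set (measurableTypeR R)) by exact: measurable_itv.
have mwE : measurable_fun [set: measurableTypeR R] (fun x => (w x)%:E) by exact/measurable_EFinP.
have mf2 : measurable_fun [set: measurableTypeR R] f2.
  apply: measurable_fun_ifT => //; apply: (@measurable_fun_bool _ _ _ _ true).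
  rewrite setTI (_ : _ @^-1` _ = S) //.
  by apply/seteqP; split=> x /=; [exact: set_mem|exact: mem_set].
apply: (@le_trans _ _ (\int[mu]_(x in `[0%R, 1%R]%classic) f2 x)%E).
  apply: le_integral_nonmeasurable => x; first by move=> _; exact: f0.
  rewrite /= in_itv /= => x01; rewrite /f2; case: ifPn => [_|/negP nS]; first exact: leey.
  by apply: fw => // Sx; apply: nS; rewrite inE.
have mf2I : measurable_fun (`[0%R, 1%R]%classic : set (measurableTypeR R)) f2.
  exact: measurable_funTS.
have mwI : measurable_fun (`[0%R, 1%R]%classic : set (measurableTypeR R))
    (fun x => (w x)%:E) by exact: measurable_funTS.
rewrite (ge0_negligible_integral mS mI mf2I _ S0); last first.
  by move=> x _; rewrite /f2; case: ifP => // _; rewrite lee_fin.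
rewrite [leRHS](ge0_negligible_integral mS mI mwI _ S0); last first.
  by move=> x _ /=; rewrite lee_fin.
under eq_integral.
  move=> x; rewrite inE => -[_ nSx]; rewrite /f2 memNset //.
  over.
by [].
Qed.

(** By its values on half-open intervals, Lebesgue measure is [k] times its image under the affine
    map. This works for integrands that are merely measurable. *)
Lemma integral_affine (k t0 : R) (D : set R) (w : R -> R) : 0 < k ->
  measurable (D : set (measurableTypeR R)) ->
  measurable_fun [set: measurableTypeR R] w -> (forall x, 0 <= w x) ->
  (\int[mu]_(x in D) (w x)%:E =
   \int[mu]_(x in [set x | D (k * x + t0)%R]) (k * w (k * x + t0))%R%:E)%E.
Proof.
move=> k0 mD mw w0; pose phi (x : measurableTypeR R) : measurableTypeR R := k * x + t0.
have mphi : measurable_fun setT phi.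
  apply: continuous_measurable_fun => x; apply: cvgD; last exact: cvg_cst.
  by apply: cvgM; [exact: cvg_cst|exact: cvg_id].
have mwE : measurable_fun [set: measurableTypeR R] (fun x => (w x)%:E) by exact/measurable_EFinP.
pose nu := mscale (NngNum (ltW k0)) (pushforward mu phi) : {measure set _ -> \bar R}.
have nuE A : measurable A -> mu A = nu mphi A.
  apply: lebesgue_measure_unique => X [[a b] _ <-].
  rewrite -[RHS]/(k%:E * mu (phi @^-1` `]a, b]%classic))%E.
  have -> : phi @^-1` `]a, b]%classic = `]((a - t0) / k), ((b - t0) / k)]%classic.
    apply/seteqP; split=> x /=; rewrite !in_itv /= /phi ltr_pdivrMr // ler_pdivlMr //;
    by rewrite ltrBlDr lerBrDr mulrC.
  rewrite !lebesgue_measure_itv /= !lte_fin ltr_pM2r ?invr_gt0 // ltrD2r.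
  case: ifP => _; last by rewrite mule0.
  rewrite -EFinB -EFinM; congr (_%:E).
  by rewrite -mulrBl opprB addrA subrK mulrC divfK // gt_eqF.
rewrite (eq_measure_integral (nu mphi)); last by move=> A mA _; exact: nuE.
have mwD : measurable_fun (D : set (measurableTypeR R)) (fun x => (w x)%:E).
  exact: measurable_funTS.
rewrite ge0_integral_mscale //=; last by move=> x _; rewrite lee_fin.
rewrite (ge0_integral_pushforward mphi) //; last by move=> x _; rewrite lee_fin.
rewrite -ge0_integralZl_EFin ?(ltW k0) //.
- by rewrite -[X in measurable X]setTI; exact: (mphi measurableT _ mD).
- by move=> x _; rewrite lee_fin.
- apply: measurable_funTS; apply/measurable_EFinP.
  exact: (measurableT_comp mw mphi).
Qed.

End Integration.

(** * Cauchy hypersurfaces as graphs over flow charts *)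

Section CauchyGraph.
Variables (R : realType) (N : topologicalType) (d : nat).
Variables (M : smooth_manifold R N d.+1) (g : lorentz_metric M).
Variables (K : nat) (psi : 'I_K -> chart R N d.+1).
Hypotheses (psi_regular : forall k, regular_flow_chart g (psi k))
  (psi_cover : \bigcup_(k in [set: 'I_K]) cdom (psi k) = [set: N]).
Variables (X : chart R N d.+1 -> N -> 'rV[R]_d.+1) (Sigma : set N).
Hypotheses (HX : time_orientation g X) (HS : cauchy_hypersurface g Sigma).
Implicit Types (phi : chart R N d.+1).

(* A timelike vector tangent to Sigma would make a straight segment in the
   slice chart a timelike curve inside Sigma, contradicting achronality. *)
Lemma timelike_transversal phi p v : atlas M phi -> cdom phi p -> Sigma p ->
  (forall q, cdom phi q -> (Sigma q <-> cmap phi q ord0 ord0 = 0)) ->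
  timelike g phi p v -> v ord0 ord0 != 0.
Proof.
move=> aphi pd Sp slice; have cphi := atlas_chart aphi.
have [od oc cK _ _] := cphi; have [_ _ X3] := HX.
(* Replacing [v] by [- v] if necessary, the segment points to the side of [X] used by polygonal
   curves. *)
wlog vX : v / 0 < qform (metric_comp g phi p) (X phi p) v.
  move=> H tv; have := lorentz_neq0 (metric_sign g aphi pd) (X3 _ _ aphi pd) tv.
  rewrite neq_lt => /orP[vX|vX]; last exact: H.
  rewrite -oppr_eq0; have := H (- v); rewrite mxE; apply.
    by rewrite -scaleN1r qformZr mulN1r oppr_gt0.
  by rewrite /timelike -scaleN1r qformZl qformZr !mulN1r opprK.
move=> tv; apply/eqP => v0; set y := cmap phi p.
have cl : (fun s : R => y + s *: v) @ (0 : R) --> y.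
  have H : (fun s : R => y + s *: v) @ (0 : R) --> y + (0 : R) *: v.
    by apply: cvgD; [exact: cvg_cst|apply: cvgZr_tmp; exact: cvg_id].
  by rewrite scale0r addr0 in H.
have yc : ccod phi y by exact: ccod_cmap.
have cc : (fun s : R => cinv phi (y + s *: v)) @ (0 : R) --> p.
  have := cvg_comp _ _ cl (continuous_cinv cphi yc).
  by rewrite /= /y cK.
have cG := cvg_comp _ _ cc (@continuous_metric _ _ _ _ g _ _ aphi pd).
have cX := cvg_comp _ _ cc (continuous_time_orientation HX aphi pd).
have n1 : \forall s \near (0 : R), timelike g phi (cinv phi (y + s *: v)) v.
  by apply: (cvgr_lt _ (cvg_qform cG (cvg_cst v) (cvg_cst v)) _ tv).
have n2 : \forall s \near (0 : R), 0 < qform (metric_comp g phi (cinv phi (y + s *: v)))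
    (X phi (cinv phi (y + s *: v))) v.
  by apply: (cvgr_gt _ (cvg_qform cG cX (cvg_cst v)) _ vX).
have n3 : \forall s \near (0 : R), ccod phi (y + s *: v).
  by apply: cl; exact: open_nbhs_nbhs.
have n123 : \forall s \near (0 : R), ccod phi (y + s *: v) /\
    timelike g phi (cinv phi (y + s *: v)) v /\
    0 < qform (metric_comp g phi (cinv phi (y + s *: v)))
    (X phi (cinv phi (y + s *: v))) v.
  by apply: filterI => //; exact: filterI.
have [e /= e0 He] := (nbhs_ballP _ _).1 n123.
pose m := e / 2; have m0 : 0 < m by rewrite divr_gt0.
have Hm s : 0 <= s <= m -> ball (0 : R) e s.
  move=> /andP[s0 sm]; rewrite /ball /= sub0r normrN ger0_norm //.
  by apply: le_lt_trans sm _; rewrite ltr_pdivrMr // ltr_pMr // ltr1n.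
pose gam s := cinv phi (y + s *: v).
have P : polygonal g X `[0, m]%classic gam.
  have S a b : 0 <= a -> b <= m -> straight g X a b gam.
    move=> a0 bm; exists phi, y, v; split=> // s /andP[as_ sb].
    have sm : 0 <= s <= m by rewrite (le_trans a0 as_) (le_trans sb bm).
    by have [h3 [h1 h2]] := He s (Hm s sm).
  move=> t; rewrite /= in_itv /= => /andP[t0 tm]; split=> [b|a].
    rewrite in_itv /= => /andP[_ bm] tb; exists b; first by rewrite tb lexx.
    exact: S.
  rewrite in_itv /= => /andP[a0 _] at_; exists a; first by rewrite at_ lexx.
  exact: S.
have r : reach g X (gam 0) (gam m).
  apply: (reach_sub _ P) => //; first exact: (@interval_is_interval _ `[0, m]).
  - by rewrite /= in_itv /= lexx ltW.
  - by rewrite /= in_itv /= lexx ltW.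
apply: (achronal HX psi_regular psi_cover HS r).
  by rewrite /gam scale0r addr0 /y cK.
have mm : 0 <= m <= m by rewrite lexx ltW.
have [mc _] := He m (Hm m mm).
apply/slice; first exact: cdom_cinv.
rewrite cinvK // !mxE v0 mulr0 addr0.
exact: (slice p pd).1.
Qed.

Section OneChart.
Variable k : 'I_K.
Local Notation ps := (psi k).
Local Notation B := (chart_base ps).

Let aps : atlas M ps := flow_chart_atlas (psi_regular k).
Let cps : is_chart ps := atlas_chart aps.

Lemma open_chart_base : open B.
Proof.
have [_ oc _ _ _] := cps; rewrite openE => x [y yc <-].
have cx : (fun x' => coords (y ord0 ord0) x') @ (spatial y) -->
    coords (y ord0 ord0) (spatial y).
  exact: (cvg_coords (FF := nbhs_filter _) (f := fun=> y ord0 ord0) (h := id) (cvg_cst _) (@cvg_id _ _)).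
rewrite coords_spatial in cx.
have n : nbhs (spatial y) (fun x' => ccod ps (coords (y ord0 ord0) x')).
  by apply: cx; exact: open_nbhs_nbhs.
apply: filterS n => x' x'c; exists (coords (y ord0 ord0) x') => //.
exact: spatial_coords.
Qed.

Lemma cauchy_graph : exists f : 'rV[R]_d -> R,
  (forall x, B x ->
     ccod ps (coords (f x) x) /\ Sigma (cinv ps (coords (f x) x))) /\
  (forall y, ccod ps y -> Sigma (cinv ps y) -> y ord0 ord0 = f (spatial y)).
Proof.
have [_ _ cK _ _] := cps.
have step x : exists s, B x -> [/\ ccod ps (coords s x), Sigma (cinv ps (coords s x)) &
    forall y, ccod ps y -> Sigma (cinv ps y) -> spatial y = x -> y ord0 ord0 = s].
  have [[y yc yx]|nB] := pselect (B x); last by exists 0.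
  have [h [Sh hd hx _ U]] := flow_line_hit HX HS (psi_regular k) (cdom_cinv cps yc).
  rewrite cinvK // yx in hx U; exists (cmap ps h ord0 ord0) => _.
  have E : coords (cmap ps h ord0 ord0) x = cmap ps h by rewrite -hx coords_spatial.
  split; rewrite ?E; [exact: ccod_cmap|by rewrite cK|].
  move=> y' y'c Sy' y'x; rewrite -(U (cinv ps y')) ?cinvK //.
  exact: cdom_cinv.
have [f fP] := choice step; exists f; split=> [x Bx|y yc Sy].
  by have [] := fP x Bx.
have By : B (spatial y) by exists y.
by have [_ _] := fP _ By; apply.
Qed.

Variable f : 'rV[R]_d -> R.
Hypotheses (fS : forall x, B x ->
    ccod ps (coords (f x) x) /\ Sigma (cinv ps (coords (f x) x)))
  (fU : forall y, ccod ps y -> Sigma (cinv ps y) -> y ord0 ord0 = f (spatial y)).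

(** [F] is the slice coordinate of a chart adapted to [Sigma], read in the flow chart. Its time
    derivative is nonzero because the flow direction is timelike, hence transversal to [Sigma]. *)
Lemma graph_equation x : B x -> exists (U : set 'rV[R]_d.+1) (F : 'rV[R]_d.+1 -> R),
  [/\ open U, U (coords (f x) x), forall n, Ck n U F,
      'D_(coords 1 0) F (coords (f x) x) != 0 &
      forall y, U y -> ccod ps y /\ (Sigma (cinv ps y) <-> F y = 0)].
Proof.
move=> Bx; have [yc Sy] := fS Bx; set y := coords (f x) x in yc Sy *.
have [HE _] := HS; have [phi [aphi pd] slice] := HE _ Sy.
have cphi := atlas_chart aphi.
have ov : overlap ps phi y by apply/(overlapP _ _ cps).
have [U [oU Uy Uov CT]] := transition_smooth aps aphi ov.
exists U, (fun z => transition ps phi z ord0 ord0); split=> //.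
- by move=> n; exact: Ck_coord.
- have tl : timelike g phi (cinv ps y) (change_comp ps phi (cinv ps y) (coords 1 0)).
    rewrite /timelike -(metric_tensor g aps aphi (cdom_cinv cps yc) pd).
    exact: (flow_timelike (psi_regular k) (cdom_cinv cps yc)).
  have := timelike_transversal aphi pd Sy slice tl.
  rewrite /change_comp cinvK // derive_mx ?mxE //.
  by have [_ /(_ (coords 1 0)) [+ _]] := CT 1; apply.
- move=> z /Uov /(overlapP _ _ cps) [zc zd]; split=> //.
  by rewrite (slice _ zd).
Qed.

(** [F] has opposite signs on the flow line of [x] at heights slightly above and below [f x], and
    keeps them on nearby flow lines. These contain a zero in between, which by uniqueness of the hit
    is the value of [f]. *)
Lemma graph_continuous x : B x -> {for x, continuous f}.
Proof.
move=> Bx; have [U [F [oU Uy CF dF FS]]] := graph_equation Bx.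
have [yc Sy] := fS Bx.
have F0 : F (coords (f x) x) = 0 by apply: (FS _ Uy).2.1.
have nx := nbhs_filter x; apply/cvgrPdist_le => e e0.
have [_ /(_ (coords 1 0)) [/(_ _ Uy) dFy _]] := CF 1.
set D := 'D_(coords 1 0) F (coords (f x) x) in dF.
(* The factor [D] makes the limit positive whatever the sign of [D]. *)
pose q h := h^-1 *: (F (h *: coords 1 0 + coords (f x) x) - F (coords (f x) x)) * D.
have cq : q @ 0^' --> D * D.
  by apply: cvgM; [exact: dFy|exact: cvg_cst].
have DD : 0 < D * D by rewrite -expr2 exprn_even_gt0.
have nU : nbhs (coords (f x) x) U by exact: open_nbhs_nbhs.
have /nbhs_ballP[r /= r0 rU] := nU.
have [h [h0 he hr Hp Hm]] : exists h : R, [/\ 0 < h, h <= e, h < r,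
    0 < F (coords (f x + h) x) * D & F (coords (f x - h) x) * D < 0].
  have [r1 /= r10 H1] : nbhs (0 : R)^' (fun h : R => 0 < q h).
    exact: (cvgr_gt _ cq _ DD).
  pose h := Num.min (r1 / 2) (Num.min e (r / 2)).
  have h0 : 0 < h by rewrite !lt_min !divr_gt0 ?e0.
  have half (a : R) : 0 < a -> a / 2 < a.
    by move=> a0; rewrite ltr_pdivrMr // ltr_pMr // ltr1n.
  have hr1 : h < r1 by rewrite gt_min half.
  have E s : s *: coords 1 0 + coords (f x) x = coords (f x + s) x.
    by rewrite -coordsZ -coordsD mulr1 scaler0 add0r addrC.
  exists h; split=> //.
  - by rewrite !ge_min lexx !orbT.
  - by rewrite !gt_min (half r) // !orbT.
  - have := H1 h; rewrite /= sub0r normrN gtr0_norm // => /(_ hr1).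
    rewrite gt_eqF // => /(_ isT); rewrite /q F0 subr0 E.
    by rewrite -[_ *: _]/(_ * _) -mulrA pmulr_rgt0 ?invr_gt0.
  - have := H1 (- h); rewrite /= sub0r opprK gtr0_norm // => /(_ hr1).
    rewrite oppr_eq0 gt_eqF // => /(_ isT); rewrite /q F0 subr0 E.
    by rewrite -[_ *: _]/(_ * _) -mulrA nmulr_rgt0 // invr_lt0 oppr_lt0.
have cF s : `|s| < r ->
    (fun x' => F (coords (f x + s) x') * D) @ x --> F (coords (f x + s) x) * D.
  move=> sr; apply: cvgM; last exact: cvg_cst.
  have Us : U (coords (f x + s) x).
    apply: rU; rewrite mx_norm_ball /ball_ /= distrC -[- coords (f x) x]scaleN1r.
    rewrite -coordsZ -coordsD mulN1r scaleN1r subrr addrAC subrr add0r.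
    by apply: le_lt_trans sr; apply: coords_norm => //; rewrite normr0 normr_ge0.
  have cx : (fun x' => coords (f x + s) x') @ x --> coords (f x + s) x.
    exact: (cvg_coords (FF := nbhs_filter _) (h := id) (cvg_cst (f x + s)) (@cvg_id _ _)).
  exact: (cvg_comp _ _ cx (Ck_cont (CF 0) Us)).
have np : \forall x' \near x, 0 < F (coords (f x + h) x') * D.
  by apply: (cvgr_gt _ (cF h _) _ Hp); rewrite gtr0_norm.
have nm : \forall x' \near x, F (coords (f x - h) x') * D < 0.
  by apply: (cvgr_lt _ (cF (- h) _) _ Hm); rewrite normrN gtr0_norm.
have nB : nbhs x (ball x r) by exact: nbhsx_ballx.
near=> x'.
have xr : `|x' - x| < r.
  have : ball x r x' by near: x'.
  by rewrite mx_norm_ball /ball_ /= distrC.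
have seg s : f x - h <= s <= f x + h -> U (coords s x').
  move=> /andP[s1 s2]; apply: rU; rewrite mx_norm_ball /ball_ /= distrC.
  rewrite -[- coords (f x) x]scaleN1r -coordsZ -coordsD mulN1r scaleN1r.
  apply: (@le_lt_trans _ _ (Num.max h `|x' - x|)); last by rewrite gt_max hr.
  apply: coords_norm; rewrite le_max; last by rewrite lexx orbT.
  by apply/orP; left; rewrite ler_norml; apply/andP; split; lra.
have cs : {within `[f x - h, f x + h], continuous (fun s => F (coords s x') * D)}.
  apply: continuous_in_subspaceT => s; rewrite inE /= in_itv /= => /seg Us.
  apply: cvgM; last exact: cvg_cst.
  have cx : (fun s => coords s x') @ s --> coords s x'.
    exact: (cvg_coords (FF := nbhs_filter _) (f := id) (@cvg_id _ _) (cvg_cst x')).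
  exact: (cvg_comp _ _ cx (Ck_cont (CF 0) Us)).
have hh : f x - h <= f x + h by lra.
have [|s] := @IVT R _ _ _ 0 hh cs.
  have p1 : 0 < F (coords (f x + h) x') * D by near: x'.
  have p2 : F (coords (f x - h) x') * D < 0 by near: x'.
  by rewrite ge_min le_max (ltW p1) (ltW p2) orbT.
rewrite in_itv /= => sh /eqP; rewrite mulf_eq0 (negbTE dF) orbF => /eqP Fs.
have [sc sS] := FS _ (seg _ sh).
have := fU sc (sS.2 Fs); rewrite coords_ord0 spatial_coords => <-.
by rewrite ler_norml; move: sh => /andP[s1 s2]; apply/andP; split; lra.
Unshelve. all: by end_near. Qed.

Lemma graph_smooth x : B x -> exists A : set 'rV[R]_d,
  [/\ open A, A x & forall n, Ck n A f].
Proof.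
move=> Bx; have [U [F [oU Uy CF dF FS]]] := graph_equation Bx.
have cx : (fun x' => coords (f x') x') @ x --> coords (f x) x.
  exact: (cvg_coords (FF := nbhs_filter _) (h := id) (graph_continuous Bx) (@cvg_id _ _)).
have nx := nbhs_filter x.
have [_ /(_ (coords 1 0)) [_ [cdF _]]] := CF 1.
have n1 : \forall x' \near x, U (coords (f x') x').
  by apply: cx; exact: open_nbhs_nbhs.
have n2 : \forall x' \near x, 'D_(coords 1 0) F (coords (f x') x') != 0.
  by have := cvg_comp _ _ cx (cdF _ Uy); move=> /cvgr_neq0; apply.
have n3 : \forall x' \near x, B x'.
  by apply: open_nbhs_nbhs; split=> //; exact: open_chart_base.
have n123 : \forall x' \near x, U (coords (f x') x') /\
    'D_(coords 1 0) F (coords (f x') x') != 0 /\ B x'.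
  by apply: filterI => //; exact: filterI.
have [r /= r0 H] := (nbhs_ballP _ _).1 n123.
exists (ball x r); split; [exact: ball_open|exact: ballxx|].
apply: (implicit_Ck oU _ CF) =>
  [|x' /H[]|x' /H[Ux' [_ Bx']]|x' /H[_ []]|x' /H[_ [_ /graph_continuous]]] //.
  exact: ball_open.
by apply: (FS _ Ux').2.1; exact: (fS Bx').2.
Qed.

End OneChart.
End CauchyGraph.

(** * The slope constant of a flow chart *)

Section QformBound.
Variables (R : realType) (d : nat).

Lemma sum_norm_sqr (v : 'rV[R]_d) :
  (\sum_i `|v ord0 i|) ^+ 2 <= d%:R * \sum_i v ord0 i ^+ 2.
Proof.
rewrite expr2 big_distrlr /=.
have E : \sum_i \sum_j (v ord0 i ^+ 2 + v ord0 j ^+ 2) =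
    2 * (d%:R * \sum_i v ord0 i ^+ 2).
  under eq_bigr => i _ do rewrite big_split /= sumr_const card_ord.
  by rewrite big_split /= sumr_const card_ord sumrMnl [d%:R * _]mulr_natl mulr_natl mulr2n.
rewrite -(ler_pM2l (ltr0Sn R 1)) -E mulr_sumr; apply: ler_sum => i _.
rewrite mulr_sumr; apply: ler_sum => j _.
have := sqr_ge0 (`|v ord0 i| - `|v ord0 j|).
rewrite -[v ord0 i ^+ 2]real_normK ?num_real // -[v ord0 j ^+ 2]real_normK ?num_real //.
by rewrite sqrrB; lra.
Qed.

(** With [s] the sum of the moduli of the spatial components, maximizing the form over the time
    component leaves at most (C'^2 / (-c) + C') s^2, as c < 0. Passing from [s] to the Euclidean
    norm by [sum_norm_sqr] costs the factor d. *)
Lemma qform_slice_bound (C c : R) : c < 0 -> exists kappa : R, 0 <= kappa /\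
  forall (G : 'M[R]_d.+1) (u : 'rV[R]_d.+1),
    (forall i j, `|G i j| <= C) -> G ord0 ord0 <= c ->
    qform G u u <= (kappa * euclid_norm (spatial u)) ^+ 2.
Proof.
move=> c0; pose C' := `|C|; pose q := (C' ^+ 2 / (- c) + C') * d%:R.
have C'0 : 0 <= C' by exact: normr_ge0.
have qq0 : 0 <= C' ^+ 2 / (- c) + C'.
  by rewrite addr_ge0 // divr_ge0 ?exprn_ge0 // oppr_ge0 ltW.
have q0 : 0 <= q by rewrite mulr_ge0.
exists (Num.sqrt q); split; first exact: sqrtr_ge0.
move=> G u GC Gc; set x := spatial u; set a := u ord0 ord0.
have GC' i j : `|G i j| <= C' := le_trans (GC i j) (ler_norm C).
have e0 : 0 <= \sum_i x ord0 i ^+ 2 by apply: sumr_ge0 => i _; exact: sqr_ge0.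
rewrite exprMn sqr_sqrtr // /euclid_norm sqr_sqrtr //.
set s := \sum_i `|x ord0 i|.
have s0 : 0 <= s by apply: sumr_ge0.
apply: (@le_trans _ _ ((C' ^+ 2 / (- c) + C') * s ^+ 2)); last first.
  by rewrite /q -[leRHS]mulrA; apply: ler_wpM2l => //; exact: sum_norm_sqr.
have xE j : u ord0 (lift ord0 j) = x ord0 j by rewrite mxE.
have b i j (z : R) : G i j * z <= C' * `|z|.
  by apply: le_trans (ler_norm _) _; rewrite normrM ler_wpM2r.
rewrite qformE big_ord_recl big_ord_recl -/a.
under [X in _ + X + _]eq_bigr do rewrite xE.
under [X in _ + X <= _]eq_bigr => i _.
  rewrite big_ord_recl -/a xE; under eq_bigr do rewrite xE.
  over.
rewrite big_split /=.
have h1 : G ord0 ord0 * (a * a) <= c * a ^+ 2.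
  by rewrite -expr2; apply: ler_wpM2r => //; exact: sqr_ge0.
have h2 : \sum_(j < d) G ord0 (lift ord0 j) * (a * x ord0 j) <= C' * `|a| * s.
  rewrite mulr_sumr; apply: ler_sum => j _; apply: le_trans (b _ _ _) _.
  by rewrite normrM mulrA.
have h3 : \sum_(i < d) G (lift ord0 i) ord0 * (x ord0 i * a) <= C' * `|a| * s.
  rewrite mulr_sumr; apply: ler_sum => j _; apply: le_trans (b _ _ _) _.
  by rewrite normrM [`|x ord0 j| * _]mulrC mulrA.
have h4 : \sum_(i < d) \sum_(j < d)
    G (lift ord0 i) (lift ord0 j) * (x ord0 i * x ord0 j) <= C' * s ^+ 2.
  rewrite expr2 big_distrlr /= mulr_sumr; apply: ler_sum => i _.
  rewrite mulr_sumr; apply: ler_sum => j _; apply: le_trans (b _ _ _) _.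
  by rewrite normrM.
(* complete the square in |a| *)
have key : c * a ^+ 2 + 2 * (C' * `|a| * s) <= C' ^+ 2 / (- c) * s ^+ 2.
  have nc : 0 < - c by rewrite oppr_gt0.
  have cc : (- c) * (- c)^-1 = 1 by rewrite divff // gt_eqF.
  rewrite -[a ^+ 2]real_normK ?num_real //.
  have i0 : 0 <= (- c)^-1 by rewrite invr_ge0 ltW.
  have := mulr_ge0 i0 (sqr_ge0 ((- c) * `|a| - C' * s)).
  have -> : (- c)^-1 * ((- c) * `|a| - C' * s) ^+ 2 =
     (- c) * (- c)^-1 * ((- c) * `|a| ^+ 2) - 2 * ((- c) * (- c)^-1) * (C' * `|a| * s)
     + C' ^+ 2 / (- c) * s ^+ 2 by ring.
  by rewrite cc; lra.
by move: h1 h2 h3 h4 key; lra.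
Qed.

End QformBound.

(** * Speed bounds and joining curves *)

Section Speed.
Variables (R : realType) (N : topologicalType) (d : nat).
Variables (M : smooth_manifold R N d.+1) (g : lorentz_metric M).
Implicit Types (phi : chart R N d.+1) (gam : R -> N).

(** The chart is free, whereas [curve_length] uses [chart_at], which may jump along the curve.
    Invariance of the metric identifies the two speeds. *)
Definition speed_le gam (s w : R) := exists phi (v : 'rV[R]_d.+1),
  [/\ atlas M phi, \forall t \near s, cdom phi (gam t),
      is_derive s 1 (cmap phi \o gam) v &
      qform (metric_comp g phi (gam s)) v v <= w ^+ 2].

Lemma speed_le_chart_at gam s w : 0 <= w -> speed_le gam s w ->
  let phi := chart_at M (gam s) in let v := derive1 (cmap phi \o gam) s in
  Num.sqrt (qform (metric_comp g phi (gam s)) v v) <= w.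
Proof.
move=> w0 [phi [v [aphi nd dv vw]]] /=; set psi := chart_at M (gam s).
have apsi : atlas M psi := chart_at_atlas M (gam s).
have pd : cdom psi (gam s) := chart_at_dom M (gam s).
have pd' : cdom phi (gam s) := nbhs_singleton nd.
have cphi := atlas_chart aphi; have [_ _ cK _ _] := cphi.
have ov : overlap phi psi ((cmap phi \o gam) s) by exists (gam s).
have := derive_transition aphi apsi ov dv; rewrite /= cK // => dT.
have [_ E] : is_derive s 1 (cmap psi \o gam) (change_comp phi psi (gam s) v).
  apply: near_eq_is_derive dT; near=> t; rewrite /= /transition /= cK //.
  by near: t.
rewrite derive1E E -(metric_tensor g aphi apsi pd' pd).
by rewrite -[leRHS]ger0_norm // -sqrtr_sqr; exact: ler_wsqrtr.
Unshelve. all: by end_near. Qed.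

Lemma speed_le_eq gam gam' s w : (\forall t \near s, gam t = gam' t) ->
  speed_le gam s w -> speed_le gam' s w.
Proof.
move=> E [phi [v [aphi nd dv vw]]]; exists phi, v; split=> //.
- by near=> t; have <- : gam t = gam' t; near: t.
- by apply: near_eq_is_derive dv; near=> t; rewrite /=; have -> : gam t = gam' t by near: t.
- by rewrite -(nbhs_singleton E).
Unshelve. all: by end_near. Qed.

Lemma speed_le_affine gam (k t0 s w : R) : 0 < k -> speed_le gam (k * s + t0) w ->
  speed_le (fun u => gam (k * u + t0)) s (k * w).
Proof.
move=> k0 [phi [v [aphi nd [dv vE] vw]]]; exists phi, (k *: v).
have ca : (fun u : R => k * u + t0) @ s --> k * s + t0.
  by apply: cvgD; [apply: cvgM; [exact: cvg_cst|exact: cvg_id]|exact: cvg_cst].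
split; [exact: aphi|exact: (ca _ nd)| |].
- have da : is_derive s 1 (fun u : R => k * u + t0) k.
    have := @is_derive_line R R R id t0 k s (@derivable_id _ _ _ _).
    rewrite derive_id; congr (is_derive _ _ _ _).
    by apply/funext => u; rewrite addrC [_ *: _]mulrC.
  have da' : differentiable (fun u : R => k * u + t0) s.
    by apply/derivable1_diffP; case: da.
  have dv' : differentiable (cmap phi \o gam) (k * s + t0) by apply/derivable1_diffP.
  have dc : differentiable ((cmap phi \o gam) \o (fun u : R => k * u + t0)) s.
    exact: differentiable_comp.
  split; first exact/derivable1_diffP.
  rewrite -[LHS]/('D_1 ((cmap phi \o gam) \o (fun u : R => k * u + t0)) s).
  rewrite (deriveE _ dc) diff_comp //= -(deriveE _ da').
  have [_ ->] := da; rewrite -[X in 'd _ _ X]mulr1 [LHS]linearZ /=.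
  by rewrite -(deriveE _ dv') vE.
- by rewrite qformZl qformZr mulrA -expr2 exprMn; apply: ler_wpM2l => //; exact: sqr_ge0.
Qed.

(* The speed is bounded by an explicit measurable function because, unlike the
   integrand of curve_length, such a bound is easily reparametrized. *)
Definition joined (Sigma : set N) (p q : N) (L : R) :=
  exists gam (w : R -> R) (S : set R),
  [/\ piecewise_smooth M `[0, 1]%classic gam,
      forall s, 0 <= s <= 1 -> Sigma (gam s), gam 0 = p & gam 1 = q] /\
  [/\ finite_set S, measurable_fun [set: measurableTypeR R] w,
      forall s, 0 <= w s,
      forall s, 0 < s < 1 -> ~ S s -> speed_le gam s (w s) &
      (\int[lebesgue_measure]_(s in `[0%R, 1%R]%classic) (w s)%:E <= L%:E)%E].

Lemma joined_length Sigma p q L : joined Sigma p q L -> exists gam,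
  [/\ piecewise_smooth M `[0, 1]%classic gam,
      forall s, 0 <= s <= 1 -> Sigma (gam s), gam 0 = p, gam 1 = q &
      (curve_length g gam <= L%:E)%E].
Proof.
move=> [gam [w [S [[Pg gS g0 g1] [fS mw w0 sp intw]]]]]; exists gam; split=> //.
apply: le_trans intw.
(* At 0 and 1 the derivative also sees the curve outside [0, 1], where nothing is known about it. *)
apply: (@le_integral_off_finite _ (S `|` [set 0; 1])) => //.
- by rewrite finite_setU; split=> //; exact: finite_set2.
- by move=> s; rewrite lee_fin sqrtr_ge0.
- move=> s /andP[s0 s1] nS; rewrite lee_fin; apply: speed_le_chart_at => //.
  apply: sp => [|Ss]; last by apply: nS; left.
  rewrite !lt_neqAle s0 s1 !andbT; apply/andP; split; apply/eqP => E.
    by apply: nS; right; left.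
  by apply: nS; right; right.
Qed.

End Speed.

(** * Concatenation of joining curves *)

Section Concatenation.
Variables (R : realType) (N : topologicalType) (d : nat).
Variables (M : smooth_manifold R N d.+1) (g : lorentz_metric M).
Implicit Types (phi : chart R N d.+1) (gam : R -> N).

Lemma Ck_affine (W : normedModType R) n (U : set R) (G : R -> W) (k t0 : R) :
  Ck n U G -> Ck n [set s | U (k * s + t0)] (fun s => G (k * s + t0)).
Proof.
have ca (s : R) : (fun u : R => k * u + t0) @ s --> k * s + t0.
  by apply: cvgD; [apply: cvgM; [exact: cvg_cst|exact: cvg_id]|exact: cvg_cst].
elim: n G => [|n IH] G [cG dG]; split=> //;
  try by move=> s Us; exact: (cvg_comp _ _ (ca s) (cG _ Us)).
move=> v; have E s : (fun h : R => h^-1 *: (G (k * (h *: v + s) + t0) - G (k * s + t0))) =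
    (fun h : R => h^-1 *: (G (h *: (k * v) + (k * s + t0)) - G (k * s + t0))).
  apply/funext => h; congr (_ *: (G _ - _)).
  by rewrite mulrDr addrA; congr (_ + _ + _); exact: mulrCA.
have [dGv CGv] := dG (k * v); split=> [s Us|].
  by rewrite /derivable [X in cvg (X @ _)]E; exact: dGv.
have -> : 'D_v (fun s : R => G (k * s + t0)) = (fun s => 'D_(k * v) G (k * s + t0)).
  by apply/funext => s; rewrite /derive [X in lim (X @ _)]E.
exact: (IH ('D_(k * v) G)).
Qed.

Lemma smooth_curve_affine (J : set R) gam (k t0 : R) :
  smooth_curve M J gam ->
  smooth_curve M [set s | J (k * s + t0)] (fun s => gam (k * s + t0)).
Proof.
have ca (s : R) : (fun u : R => k * u + t0) @ s --> k * s + t0.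
  by apply: cvgD; [apply: cvgM; [exact: cvg_cst|exact: cvg_id]|exact: cvg_cst].
have op (U : set R) : open U -> open [set s | U (k * s + t0)].
  by move=> oU; apply: open_comp oU => s _; exact: ca.
move=> H t /= Jt; have [phi [U [aphi [oU Ut] dU sU]]] := H _ Jt.
exists phi, [set s | U (k * s + t0)]; split=> //; first by split=> //; exact: op.
- by move=> s Js Us; exact: dU.
- move=> s [Js Us]; have [V [F [[oV Vs] CF E]]] := sU _ (conj Js Us).
  exists [set s | V (k * s + t0)], (fun s => F (k * s + t0)); split.
  + by split=> //; exact: op.
  + by move=> n; exact: Ck_affine.
  + by move=> r [Jr Ur] Vr; rewrite /= -E.
Qed.

Lemma smooth_curve_sub (J J' : set R) gam : J' `<=` J ->
  smooth_curve M J gam -> smooth_curve M J' gam.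
Proof.
move=> JJ H t /JJ Jt; have [phi [U [aphi oU dU sU]]] := H _ Jt.
exists phi, U; split=> // [s /JJ|s [/JJ Js Us]]; first exact: dU.
have [V [F [oV CF E]]] := sU _ (conj Js Us); exists V, F; split=> //.
by move=> r [/JJ Jr Ur]; exact: E.
Qed.

Lemma smooth_curve_eq (J : set R) gam gam' : (forall s, J s -> gam s = gam' s) ->
  smooth_curve M J gam -> smooth_curve M J gam'.
Proof.
move=> gg H t Jt; have [phi [U [aphi oU dU sU]]] := H _ Jt.
exists phi, U; split=> // [s Js|s [Js Us]]; first by rewrite -gg //; exact: dU.
have [V [F [oV CF E]]] := sU _ (conj Js Us); exists V, F; split=> //.
by move=> r [Jr Ur] Vr; rewrite -E // /= gg.
Qed.

Lemma piecewise_smooth_concat gam1 gam2 : gam1 1 = gam2 0 ->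
  piecewise_smooth M `[0, 1]%classic gam1 ->
  piecewise_smooth M `[0, 1]%classic gam2 ->
  piecewise_smooth M `[0, 1]%classic
    (fun s => if s <= 2^-1 then gam1 (2 * s + 0) else gam2 (2 * s + -1)).
Proof.
move=> E12 [S1 [f1 P1]] [S2 [f2 P2]].
have half2 : 2 * 2^-1 = 1 :> R by rewrite divff.
have i0 : `[(0 : R), 1]%classic (0 : R) by rewrite /= in_itv /= lexx ler01.
have i1 : `[(0 : R), 1]%classic (1 : R) by rewrite /= in_itv /= lexx ler01.
(* The midpoint is a break point, so an interval free of break points lies in one half. *)
exists ([set s | s <= 2^-1 /\ S1 (2 * s + 0)] `|`
        [set s | 2^-1 <= s /\ S2 (2 * s + -1)] `|` [set 2^-1]); split.
  move=> a b; rewrite /= !in_itv /= => /andP[a0 a1] /andP[b0 b1].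
  rewrite !setIUl !finite_setU; split; [split|]; last first.
  - by apply: sub_finite_set (@finite_set1 _ (2^-1 : R)) => s [].
  - apply: (@sub_finite_set _ _ ((fun u => (u + 1) / 2) @` (S2 `&` `[0, 1]%classic))).
      move=> s [[sh Ss]] /=; rewrite in_itv /= => /andP[as_ sb].
      exists (2 * s + -1); last by rewrite subrK mulrC mulKf.
      by split=> //=; rewrite in_itv /=; apply/andP; split; lra.
    by apply: finite_image; exact: f2.
  - apply: (@sub_finite_set _ _ ((fun u => u / 2) @` (S1 `&` `[0, 1]%classic))).
      move=> s [[sh Ss]] /=; rewrite in_itv /= => /andP[as_ sb].
      exists (2 * s + 0); last by rewrite addr0 mulrC mulKf.
      by split=> //=; rewrite in_itv /=; apply/andP; split; lra.
    by apply: finite_image; exact: f1.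
move=> a b; rewrite /= !in_itv /= => /andP[a0 a1] /andP[b0 b1] ab nS.
have [bh|hb] := leP b 2^-1.
  have H : smooth_curve M `[2 * a + 0, 2 * b + 0]%classic gam1.
    apply: P1; rewrite /= ?in_itv /=; try by (apply/andP; split; lra).
      by lra.
    move=> c Sc /andP[ac cb]; apply: (nS (c / 2)); last by apply/andP; split; lra.
    left; left; split; first by lra.
    by rewrite addr0 mulrC divfK.
  apply: smooth_curve_eq (smooth_curve_sub _ (smooth_curve_affine H)).
    move=> s /=; rewrite in_itv /= => /andP[as_ sb].
    by rewrite (le_trans sb bh).
  by move=> s /=; rewrite !in_itv /= => /andP[as_ sb]; apply/andP; split; lra.
have ha : 2^-1 <= a.
  by rewrite leNgt; apply/negP => ah; apply: (nS 2^-1); [right|rewrite ah hb].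
have H : smooth_curve M `[2 * a + -1, 2 * b + -1]%classic gam2.
  apply: P2; rewrite /= ?in_itv /=; try by (apply/andP; split; lra).
    by lra.
  move=> c Sc /andP[ac cb]; apply: (nS ((c + 1) / 2)); last by apply/andP; split; lra.
  left; right; split; first by lra.
  by rewrite mulrC divfK // addrK.
apply: smooth_curve_eq (smooth_curve_sub _ (smooth_curve_affine H)).
  move=> s /=; rewrite in_itv /= => /andP[as_ sb].
  case: ifPn => // sh; have -> : s = 2^-1 by apply/le_anti; rewrite sh (le_trans ha as_).
  by rewrite half2 addr0 subrr E12.
by move=> s /=; rewrite !in_itv /= => /andP[as_ sb]; apply/andP; split; lra.
Qed.

Lemma joined_trans Sigma p q r L1 L2 : joined g Sigma p q L1 ->
  joined g Sigma q r L2 -> joined g Sigma p r (L1 + L2).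
Proof.
move=> [gam1 [w1 [S1 [[P1 G1 g10 g11] [f1 m1 w10 sp1 int1]]]]].
move=> [gam2 [w2 [S2 [[P2 G2 g20 g21] [f2 m2 w20 sp2 int2]]]]].
(* Each half is run at double speed. *)
pose w s := if s <= 2^-1 then 2 * w1 (2 * s + 0) else 2 * w2 (2 * s + -1).
exists (fun s => if s <= 2^-1 then gam1 (2 * s + 0) else gam2 (2 * s + -1)), w.
exists ((fun u => u / 2) @` S1 `|` (fun u => (u + 1) / 2) @` S2 `|` [set 2^-1]).
have half2 : 2 * 2^-1 = 1 :> R by rewrite divff.
have h0 : 0 < 2^-1 :> R by rewrite invr_gt0.
have h1 : 2^-1 < 1 :> R by lra.
have two : 0 < 2 :> R by [].
have mw : measurable_fun [set: measurableTypeR R] w.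
  have mphi (t0 : R) : measurable_fun [set: measurableTypeR R]
      (fun s : measurableTypeR R => 2 * s + t0 : measurableTypeR R).
    apply: continuous_measurable_fun => x; apply: cvgD; last exact: cvg_cst.
    by apply: cvgM; [exact: cvg_cst|exact: cvg_id].
  apply: measurable_fun_ifT.
  + exact: measurable_fun_ler.
  + by apply: measurable_funM => //; exact: (measurableT_comp m1 (mphi 0)).
  + by apply: measurable_funM => //; exact: (measurableT_comp m2 (mphi (-1))).
split; split.
- by apply: piecewise_smooth_concat => //; rewrite g11 g20.
- move=> s /andP[s0 s1]; case: ifPn => [sh|].
    by apply: G1; apply/andP; split; lra.
  by rewrite -ltNge => sh; apply: G2; apply/andP; split; lra.
- by rewrite ltW // mulr0 addr0.
- by rewrite leNgt h1 /= mulr1; have -> : 2 + -1 = 1 :> R by lra.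
- by rewrite !finite_setU; split; [split; exact: finite_image|exact: finite_set1].
- exact: mw.
- by move=> s; rewrite /w; case: ifP => _; rewrite mulr_ge0.
- move=> s /andP[s0 s1] nS.
  have sn : s != 2^-1 by apply/eqP => sE; apply: nS; right.
  rewrite /w; case: (ltgtP s 2^-1) sn => // [sh|sh] _.
    apply: (@speed_le_eq _ _ _ _ _ (fun u => gam1 (2 * u + 0))).
      near=> u; have -> // : u <= 2^-1 by near: u; exact: lt_le_nbhsl.
    apply: speed_le_affine => //; apply: sp1; first by apply/andP; split; lra.
    by move=> Ss; apply: nS; left; left; exists (2 * s + 0) => //; rewrite addr0 mulrC mulKf.
  apply: (@speed_le_eq _ _ _ _ _ (fun u => gam2 (2 * u + -1))).
    near=> u; rewrite leNgt; have -> // : 2^-1 < u by near: u; exact: lt_nbhsr.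
  apply: speed_le_affine => //; apply: sp2; first by apply/andP; split; lra.
  by move=> Ss; apply: nS; left; right; exists (2 * s + -1) => //; rewrite subrK mulrC mulKf.
- have mI (i : interval R) : measurable ([set` i] : set (measurableTypeR R)).
    exact: measurable_itv.
  have mwE : measurable_fun [set: measurableTypeR R] (fun s => (w s)%:E).
    exact/measurable_EFinP.
  have w0 s : (0 <= (w s)%:E)%E.
    by rewrite lee_fin /w; case: ifP => _; rewrite mulr_ge0.
  have -> : `[0, 1]%classic = `[0, 2^-1]%classic `|` `]2^-1, 1]%classic :> set R.
    apply/seteqP; split=> s /=; rewrite !in_itv /=.
      by move=> /andP[-> ->]; case: (leP s 2^-1); [left|right].
    by move=> [] /andP[s0 s1]; apply/andP; split; lra.
  rewrite ge0_integral_setU //=; last first.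
    apply/disj_setPS => s []; rewrite /= !in_itv /= => /andP[_ sh] /andP[hs _].
    by move: (le_lt_trans sh hs); rewrite ltxx.
  by apply: measurable_funTS.
  rewrite EFinD; apply: leeD.
    apply: le_trans int1.
    rewrite (@integral_affine R 2 0 `[0, 1]%classic w1 two (mI `[0, 1]) m1 w10).
    have -> : [set x | `[(0 : R), 1]%classic (2 * x + 0)] = `[0, 2^-1]%classic.
      by apply/seteqP; split=> s /=; rewrite !in_itv /= => /andP[? ?]; apply/andP; split; lra.
    rewrite le_eqVlt; apply/orP; left; apply/eqP; apply: eq_integral => s.
    by rewrite inE /= in_itv /= => /andP[_ sh]; rewrite /w sh.
  apply: le_trans int2.
  (* The second half omits the midpoint to keep the two domains disjoint, so it rescales to the
     half-open unit interval. *)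
  apply: (@le_trans _ _ (\int[lebesgue_measure]_(s in `]0%R, 1%R]%classic) (w2 s)%:E)%E).
    rewrite [leRHS](@integral_affine R 2 (-1) `]0, 1]%classic w2 two (mI `]0, 1]) m2 w20).
    have -> : [set x | `](0 : R), 1]%classic (2 * x + -1)] = `]2^-1, 1]%classic.
      by apply/seteqP; split=> s /=; rewrite !in_itv /= => /andP[? ?]; apply/andP; split; lra.
    rewrite le_eqVlt; apply/orP; left; apply/eqP; apply: eq_integral => s.
    by rewrite inE /= in_itv /= => /andP[sh _]; rewrite /w leNgt sh.
  apply: ge0_subset_integral.
  + exact: (mI `]0, 1]).
  + exact: (mI `[0, 1]).
  + by apply: measurable_funTS; exact/measurable_EFinP.
  + by move=> s _; rewrite lee_fin.
  + by move=> s /=; rewrite !in_itv /= => /andP[/ltW -> ->].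
Unshelve. all: by end_near. Qed.

End Concatenation.

(** * Lifting curves from the base to a Cauchy hypersurface *)

Section Lift.
Variables (R : realType) (N : topologicalType) (d : nat).
Variables (M : smooth_manifold R N d.+1) (g : lorentz_metric M).
Variables (K : nat) (psi : 'I_K -> chart R N d.+1).
Hypotheses (psi_regular : forall k, regular_flow_chart g (psi k))
  (psi_cover : \bigcup_(k in [set: 'I_K]) cdom (psi k) = [set: N]).
Variables (X : chart R N d.+1 -> N -> 'rV[R]_d.+1).
Hypothesis (HX : time_orientation g X).

Lemma euclid_diam_curve (B : set 'rV[R]_d) : (euclid_diam B < +oo)%E ->
  exists2 L : R, 0 <= L & forall x y, B x -> B y -> exists gam : R -> 'rV[R]_d,
    [/\ piecewise (fun J => smooth_on J gam) `[0, 1]%classic,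
        forall s, 0 <= s <= 1 -> B (gam s), gam 0 = x, gam 1 = y &
        (euclid_length gam <= L%:E)%E].
Proof.
(* Adding 1 makes the bound strict, so that some curve satisfies it although the infimum need not be
   attained. *)
move=> dB; pose L := `|fine (euclid_diam B)| + 1.
have L0 : 0 <= L by rewrite addr_ge0.
have dL : (euclid_diam B < L%:E)%E.
  move: dB; rewrite /L; case: (euclid_diam B) => [r _|//|_] /=; last exact: ltNyr.
  by rewrite lte_fin (le_lt_trans (ler_norm r)) // ltrDl.
exists L => // x y Bx By.
have /ereal_inf_lt[_ [gam [ag gB g0 g1] <-] gL] : (ereal_inf
    [set euclid_length gam | gam in [set gam : R -> 'rV[R]_d |
      [/\ piecewise (fun J => smooth_on J gam) `[0%R, 1%R]%classic,
          forall s : R, (0 <= s <= 1)%R -> B (gam s), gam 0%R = x & gam 1%R = y]]]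
    < L%:E)%E.
  by apply: le_lt_trans dL; apply: ereal_sup_ubound; exists (x, y).
by exists gam; split=> //; exact: ltW.
Qed.

(** Smoothness on a closed interval is one-sided at its ends; a parameter off the break points is
    interior to such an interval, so there [gam] has a two-sided smooth representative. *)
Lemma interior_smooth (gam : R -> 'rV[R]_d) (S : set R) :
  finite_set (S `&` `[0, 1]%classic) ->
  (forall a b, `[0, 1]%classic a -> `[0, 1]%classic b -> a < b ->
     (forall c, S c -> ~ (a < c < b)) -> smooth_on `[a, b]%classic gam) ->
  let U := `]0, 1[%classic `\` (S `&` `[0, 1]%classic) in
  open U /\ forall s, U s -> exists (V : set R) (F : R -> 'rV[R]_d),
    [/\ open V, V s, forall n, Ck n V F & forall y, V y -> gam y = F y /\ 0 < y < 1].
Proof.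
move=> fS H U; have oU : open U.
  apply: openI; first exact: itv_open.
  apply: closed_openC; apply: (accessible_finite_set_closed.1 _ _ fS).
  by apply: hausdorff_accessible; exact: Rhausdorff.
split=> // s Us; have /nbhs_ballP[e /= e0 He] : nbhs s U by exact: open_nbhs_nbhs.
have eh : e / 2 < e by rewrite ltr_pdivrMr // ltr_pMr // ltr1n.
have e20 : 0 < e / 2 by rewrite divr_gt0.
have HU r : s - e / 2 <= r <= s + e / 2 -> U r.
  move=> /andP[r1 r2]; apply: He; rewrite /ball /=.
  by apply: le_lt_trans eh; rewrite ler_norml; apply/andP; split; lra.
have I01 r : U r -> 0 < r < 1 by move=> [/=]; rewrite in_itv.
have [V [F [[oV Vs] CF E]]] : exists (V : set R) (F : R -> 'rV[R]_d),
    [/\ open_nbhs s V, forall k, Ck k V F &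
    forall y, `[s - e / 2, s + e / 2]%classic y -> V y -> gam y = F y].
  apply: H => [||||]; rewrite /= ?in_itv /=.
  - have /HU/I01 : s - e / 2 <= s - e / 2 <= s + e / 2 by apply/andP; split; lra.
    by move=> /andP[/ltW -> /ltW ->].
  - have /HU/I01 : s - e / 2 <= s + e / 2 <= s + e / 2 by apply/andP; split; lra.
    by move=> /andP[/ltW -> /ltW ->].
  - by lra.
  - move=> c Sc /andP[/ltW c1 /ltW c2].
    have [/= c01 nc] := HU c (introT andP (conj c1 c2)).
    by apply: nc; split=> //; apply: subset_itv_oo_cc c01.
  - by apply/andP; split; lra.
exists (V `&` `]s - e / 2, s + e / 2[%classic), F; split.
- by apply: openI => //; exact: itv_open.
- by split=> //=; rewrite in_itv /=; apply/andP; split; lra.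
- by move=> n; apply: Ck_sub (CF n) => z [].
- move=> y [Vy yI]; have yI' := subset_itv_oo_cc yI; split; first exact: E.
  by move: yI'; rewrite in_itv /= => /HU/I01.
Qed.

Section OneSurface.
Variable Sigma : set N.
Hypothesis HS : cauchy_hypersurface g Sigma.
Variable k : 'I_K.
Local Notation ps := (psi k).
Local Notation B := (chart_base ps).
Variable f : 'rV[R]_d -> R.
Hypotheses (fS : forall x, B x ->
    ccod ps (coords (f x) x) /\ Sigma (cinv ps (coords (f x) x)))
  (fU : forall y, ccod ps y -> Sigma (cinv ps y) -> y ord0 ord0 = f (spatial y)).

Lemma lift_Ck (V : set R) (F : R -> 'rV[R]_d) t :
  open V -> V t -> (forall n, Ck n V F) -> B (F t) ->
  exists V', [/\ open V', V' t, V' `<=` V &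
    forall n, Ck n V' (fun s => coords (f (F s)) (F s))].
Proof.
move=> oV Vt CF BF.
have [A [oA AF CA]] := graph_smooth psi_regular psi_cover HX HS fS fU BF.
exists (V `&` F @^-1` A); have oV' : open (V `&` F @^-1` A).
  rewrite openE => s [Vs As]; apply: filterI; first exact: open_nbhs_nbhs.
  by apply: (Ck_cont (CF 0) Vs); exact: open_nbhs_nbhs.
split; [exact: oV'|by split|by move=> s []|move=> n]; have CF' : Ck n (V `&` F @^-1` A) F.
  by apply: Ck_sub (CF n) => s [].
apply: Ck_coords => //.
by apply: (Ck_comp oV' oA) => // s [].
Qed.

Lemma lift_smooth J (gam : R -> 'rV[R]_d) : (forall s, J s -> B (gam s)) ->
  smooth_on J gam -> smooth_on J (fun s => coords (f (gam s)) (gam s)).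
Proof.
move=> JB H t Jt; have [V [F [[oV Vt] CF E]]] := H _ Jt.
have [|V' [oV' V't V'V C]] := lift_Ck oV Vt CF; first by rewrite -E //; exact: JB.
exists V', (fun s => coords (f (F s)) (F s)); split=> //.
by move=> s Js /V'V Vs; rewrite -E.
Qed.

Lemma lift_joined (kappa C c L : R) (gam : R -> 'rV[R]_d) : 0 <= kappa ->
  (forall (G : 'M[R]_d.+1) (u : 'rV[R]_d.+1),
    (forall i j, `|G i j| <= C) -> G ord0 ord0 <= c ->
    qform G u u <= (kappa * euclid_norm (spatial u)) ^+ 2) ->
  (forall p, cdom ps p -> (forall mu nu, `|metric_comp g ps p mu nu| <= C) /\
      metric_comp g ps p ord0 ord0 <= c) ->
  piecewise (fun J => smooth_on J gam) `[0, 1]%classic ->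
  (forall s, 0 <= s <= 1 -> B (gam s)) -> (euclid_length gam <= L%:E)%E ->
  joined g Sigma (cinv ps (coords (f (gam 0)) (gam 0)))
    (cinv ps (coords (f (gam 1)) (gam 1))) (kappa * L).
Proof.
move=> kap0 Hq Hb [S [fS0 PS]] gB gL.
have aps := flow_chart_atlas (psi_regular k); have cps := atlas_chart aps.
pose c' s := coords (f (gam s)) (gam s).
have c01 s : 0 <= s <= 1 -> ccod ps (c' s) /\ Sigma (cinv ps (c' s)).
  by move=> /gB /fS.
have i0 : `[(0 : R), 1]%classic (0 : R) by rewrite /= in_itv /= lexx ler01.
have i1 : `[(0 : R), 1]%classic (1 : R) by rewrite /= in_itv /= lexx ler01.
have [oU HU] := interior_smooth (fS0 _ _ i0 i1) PS.
set U := _ `\` _ in oU HU.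
pose e s := euclid_norm (derive1 gam s).
(* Euclidean speed is continuous on the open set [U], so its extension by zero is measurable. *)
pose w0 := e \_ U.
have w00 s : 0 <= w0 s by rewrite /w0 /patch; case: ifP => // _; exact: sqrtr_ge0.
have ce s : U s -> {for s, continuous e}.
  move=> Us; have [V [F [oV Vs CF E]]] := HU _ Us.
  have nV : \forall y \near s, V y by exact: open_nbhs_nbhs.
  have dE y : V y -> derive1 gam y = 'D_1 F y.
    move=> Vy; rewrite derive1E; apply: near_eq_derive.
    by near=> z; apply: (E _ _).1; near: z; exact: open_nbhs_nbhs.
  have [_ /(_ (1 : R)) [_ [cDF _]]] := CF 1.
  have cg : (derive1 gam) @ s --> derive1 gam s.
    rewrite (dE _ Vs); apply: cvg_trans (cDF _ Vs); apply: near_eq_cvg.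
    by apply: filterS nV => y Vy; rewrite dE.
  have cs : (fun y => \sum_i derive1 gam y ord0 i ^+ 2) @ s --> \sum_i derive1 gam s ord0 i ^+ 2.
    apply: cvg_sumr => i; under eq_fun do rewrite expr2; rewrite expr2.
    have ci := cvg_comp _ _ cg (@coord_continuous _ _ _ ord0 i _).
    by apply: cvgM; exact: ci.
  exact: (cvg_comp _ _ cs (@sqrt_continuous _ _)).
have mw0 : measurable_fun [set: measurableTypeR R] w0.
  have mU : measurable (U : set (measurableTypeR R)) by exact: open_measurable.
  apply/(measurable_restrictT (e : measurableTypeR R -> measurableTypeR R) mU).
  apply: open_continuous_measurable_fun => // s; rewrite inE.
  exact: ce.
exists (cinv ps \o c'), (fun s => kappa * w0 s), (S `&` `[0, 1]%classic).
split; split=> //.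
- exists S; split=> // a b Ia Ib ab nS.
  have sub s : `[a, b]%classic s -> 0 <= s <= 1.
    move: Ia Ib; rewrite /= !in_itv /= => /andP[a0 _] /andP[_ b1] /andP[as_ sb].
    by rewrite (le_trans a0 as_) (le_trans sb b1).
  move=> t Jt; exists ps, setT; split=> //; first by split=> //; exact: openT.
    by move=> s /sub /c01 [cs _] _; exact: cdom_cinv.
  move=> s [Js _].
  have JB r : `[a, b]%classic r -> B (gam r) by move=> /sub /gB.
  have [V [F [oV CF E]]] := lift_smooth JB (PS _ _ Ia Ib ab nS) Js.
  exists V, F; split=> // r [Jr _] Vr; rewrite -E //= cinvK //.
  by have [] := c01 _ (sub _ Jr).
- by move=> s /c01 [].
- exact: (fS0 _ _ i0 i1).
- by apply: measurable_funM => //; exact: measurable_cst.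
- by move=> s; exact: mulr_ge0.
- move=> s s01 nS.
  have Us : U s by split; rewrite /= ?in_itv.
  rewrite /w0 patchE mem_set //.
  have [V [F [oV Vs CF E]]] := HU _ Us.
  have Bs : B (gam s) by apply: gB; case/andP: s01 => /ltW -> /ltW ->.
  have [|V' [oV' V's V'V CV]] := lift_Ck oV Vs CF; first by rewrite -(E _ Vs).1.
  have nc : \forall y \near s, coords (f (F y)) (F y) = c' y.
    near=> y; have Vy : V y by near: y; exact: open_nbhs_nbhs.
    by rewrite /c' (E y Vy).1.
  have ng : \forall y \near s, F y = gam y.
    near=> y; have Vy : V y by near: y; exact: open_nbhs_nbhs.
    by rewrite (E y Vy).1.
  have dc : derivable c' s 1.
    by apply: near_eq_derivable nc _; have [_ /(_ (1 : R)) [+ _]] := CV 1; apply.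
  have dg : derivable gam s 1.
    by apply: near_eq_derivable ng _; have [_ /(_ (1 : R)) [+ _]] := CF 1; apply.
  have n01 : \forall y \near s, ccod ps (c' y).
    near=> y; apply: (c01 y _).1.
    have /andP[/ltW -> /ltW ->] // : 0 < y < 1.
    by apply: (E y _).2; near: y; exact: open_nbhs_nbhs.
  exists ps, ('D_1 c' s); split=> //.
  + by near=> y; apply: cdom_cinv => //; near: y.
  + apply: (@near_eq_is_derive _ _ _ c'); last exact: derivableP.
    by near=> y; rewrite /= cinvK //; near: y.
  + have [Cb cb] := Hb _ (cdom_cinv cps (nbhs_singleton n01)).
    (* The lift only adds a time component, so the spatial part of its velocity is the velocity of
       [gam]. *)
    have -> : kappa * e s = kappa * euclid_norm (spatial ('D_1 c' s)); last exact: Hq.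
    rewrite /e derive1E; congr (_ * euclid_norm _); apply/rowP => j.
    rewrite /spatial [RHS]mxE derive_mx // [in RHS]derive_mx // !mxE.
    by congr ('D_1 _ s); apply/funext => r; rewrite /c' coords_lift.
- have mw0E : measurable_fun (`[0%R, 1%R]%classic : set (measurableTypeR R))
      (fun s => (w0 s)%:E).
    by apply: measurable_funTS; exact/measurable_EFinP.
  under eq_integral do rewrite EFinM.
  rewrite ge0_integralZl_EFin //; last by move=> s _; rewrite lee_fin.
  rewrite EFinM; apply: lee_wpmul2l; first by rewrite lee_fin.
  apply: le_trans gL; apply: le_integral_nonmeasurable => s _; rewrite lee_fin //.
  by rewrite /w0 /patch; case: ifP => // _; exact: sqrtr_ge0.
Unshelve. all: by end_near. Qed.

End OneSurface.

(** The bound is chosen before [Sigma]: its factors come from the metric bounds of the chart and the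
    diameter of its base. *)
Lemma chart_diameter k : exists2 L : R, 0 <= L &
  forall Sigma, cauchy_hypersurface g Sigma -> forall p q, Sigma p -> Sigma q ->
    cdom (psi k) p -> cdom (psi k) q -> joined g Sigma p q L.
Proof.
have aps := flow_chart_atlas (psi_regular k); have cps := atlas_chart aps.
have [_ _ cK _ _] := cps.
have [I [_ _ dB _]] := regular_lines (psi_regular k).
have [C [c [c0 Hb]]] := flow_chart_bounds (psi_regular k).
have [L0 L00 HL] := euclid_diam_curve dB.
have [kappa [kap0 Hq]] := qform_slice_bound d C c0.
exists (kappa * L0); first exact: mulr_ge0.
move=> Sigma HS p q Sp Sq pd qd.
have [f [fS fU]] := cauchy_graph psi_regular HX HS k.
have base r : cdom (psi k) r -> chart_base (psi k) (spatial (cmap (psi k) r)).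
  by move=> rd; exists (cmap (psi k) r) => //; exact: ccod_cmap.
have E r : Sigma r -> cdom (psi k) r ->
    cinv (psi k) (coords (f (spatial (cmap (psi k) r))) (spatial (cmap (psi k) r))) = r.
  move=> Sr rd; rewrite -(fU (cmap (psi k) r)) ?coords_spatial ?cK //.
  exact: ccod_cmap.
have [gam [Pg gB g0 g1 gL]] := HL _ _ (base _ pd) (base _ qd).
have := lift_joined HS fS fU kap0 Hq Hb Pg gB gL.
by rewrite g0 g1 !E.
Qed.

Lemma joined_le Sigma p q (L L' : R) : L <= L' -> joined g Sigma p q L ->
  joined g Sigma p q L'.
Proof.
move=> LL [gam [w [S [H [H1 H2 H3 H4 H5]]]]]; exists gam, w, S; split=> //.
by split=> //; apply: le_trans H5 _; rewrite lee_fin.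
Qed.

Hypothesis N_connected : connected [set: N].

Lemma cauchy_diameter : exists L : R, forall Sigma, cauchy_hypersurface g Sigma ->
  forall p q, Sigma p -> Sigma q -> joined g Sigma p q L.
Proof.
have [L HL] := choice (fun k => let: ex_intro2 l l0 H := chart_diameter k in
  ex_intro (fun l => 0 <= l /\ forall Sigma, cauchy_hypersurface g Sigma ->
    forall p q, Sigma p -> Sigma q ->
    cdom (psi k) p -> cdom (psi k) q -> joined g Sigma p q l) l (conj l0 H)).
pose T := \sum_k L k.
have T0 : 0 <= T by apply: sumr_ge0 => k _; exact: (HL k).1.
have LT k : L k <= T.
  by rewrite /T (bigD1 k) //= lerDl; apply: sumr_ge0 => j _; exact: (HL j).1.
exists (T * K.+1%:R) => Sigma HS.
(* Consecutive charts of the walk share a point of [Sigma], where the joining curves are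
   concatenated. *)
have walk s i p q : Sigma p -> Sigma q -> cdom (psi i) p ->
    path (chart_meet psi Sigma) i s -> cdom (psi (last i s)) q ->
    joined g Sigma p q (T * (size s).+1%:R).
  elim: s i p => [|j s IH] i p Sp Sq pi /=.
    by move=> _ qi; rewrite mulr1; apply: joined_le (LT i) _; exact: (HL i).2.
  move=> /andP[/asboolP[r [Sr ri rj]] sP] ql.
  apply: (@joined_le _ _ _ (T + T * (size s).+1%:R)).
    by rewrite -[X in X + _]mulr1 -mulrDr ler_wpM2l // -natr1 [1 + _]addrC.
  apply: (@joined_trans _ _ _ _ _ _ _ r); last exact: IH rj sP ql.
  by apply: joined_le (LT i) _; exact: (HL i).2.
move=> p q Sp Sq.
have [i pi] := covering_chart psi_cover p; have [j qj] := covering_chart psi_cover q.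
have /connectP[s0 s0P s0j] : connect (chart_meet psi Sigma) i j.
  by apply: (chart_meet_connect psi_regular psi_cover HX HS N_connected); [exists p|exists q].
(* Removing repeated charts bounds the number of links by [K], uniformly in the two points and in
   [Sigma]. *)
move: qj; rewrite s0j; case: (shortenP s0P) => s sP us _ qj.
apply: joined_le (walk s i p q Sp Sq pi sP qj).
rewrite ler_wpM2l // ler_nat; have := card_uniqP us => /= <-.
by rewrite (leq_trans (max_card _)) // card_ord.
Qed.

End Lift.

Theorem theorem5p3 (R : realType) (N : topologicalType) (d : nat)
    (d_gt0 : (0 < d)%N)
    (M : smooth_manifold R N d.+1) (g : lorentz_metric M)
    (N_connected : connected [set: N])
    (N_hyperbolic : globally_hyperbolic g)
    (K : nat) (psi : 'I_K -> chart R N d.+1)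
    (psi_regular : forall k, regular_flow_chart g (psi k))
    (psi_cover : \bigcup_(k in [set: 'I_K]) cdom (psi k) = [set: N]) :
  (spacelike_diam g < +oo)%E.
Proof.
have [[X HX] _] := N_hyperbolic.
have [L HL] := cauchy_diameter psi_regular psi_cover HX N_connected.
apply: le_lt_trans (ltry L); apply: ge_ereal_sup => _ [Sigma HS <-].
apply: ge_ereal_sup => _ [[p q] [/= Sp Sq] <-].
have [gam [Pgam gS g0 g1 gL]] := joined_length (HL _ HS _ _ Sp Sq).
by apply: le_trans gL; apply: ereal_inf_lbound; exists gam.
Qed.
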